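(* Let $\Omega\subseteq\mathbb R^d$ be open, $m\in\mathbb N$, $l\in\{0,\dots,m\}$, and let $u_n\rightharpoonup 0$ weakly in $L^2_{\rm loc}(\Omega;\mathbb C^r)$ satisfy $$\sum_{l\le|\alpha|\le m}\varepsilon_n^{|\alpha|-l}\,\partial_\alpha(A_n^\alpha u_n)=f_n\quad\text{in }\Omega,$$ where $(\varepsilon_n)$ is a bounded sequence of positive numbers, $A_n^\alpha\in C(\Omega;\mathrm M_{q\times r}(\mathbb C))$, $A_n^\alpha\to A^\alpha$ locally uniformly on $\Omega$ for every $\alpha$ with $l\le|\alpha|\le m$, and $(f_n)$ is a sequence in $H^{-m}_{\rm loc}(\Omega;\mathbb C^q)$ such that for every $\varphi\in C_c^\infty(\Omega)$ $$\frac{\widehat{\varphi f_n}}{1+\sum_{s=l}^m\varepsilon_n^{s-l}|\xi|^s}\longrightarrow 0\quad\text{strongly in }L^2(\mathbb R^d;\mathbb C^q).$$ Let $(\omega_n)$ be a sequence of positive numbers with $\omega_n\to0^+$ such that $\lim_n\varepsilon_n/\omega_n$ exists in $[0,\infty]$, and let $\mu_{sc}$ be a semiclassical measure with characteristic length $(\omega_n)$ associated to (a subsequence of) $(u_n)$. Then $$p\,\mu_{sc}^\top=0\quad\text{on }\Omega\times\mathbb R^d,$$ where $$p(x,\xi)=\begin{cases}\sum_{|\alpha|=l}(2\pi i)^l\xi^\alpha A^\alpha(x),&\lim_n\varepsilon_n/\omega_n=0,\\ \sum_{l\le|\alpha|\le m}(2\pi i c)^{|\alpha|}\xi^\alpha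 A^\alpha(x),&\lim_n\varepsilon_n/\omega_n=c\in(0,\infty),\\ \sum_{|\alpha|=m}(2\pi i)^m\xi^\alpha A^\alpha(x),&\lim_n\varepsilon_n/\omega_n=\infty.\end{cases}$$
   Context: Conventions: functions on $\Omega$ are extended by zero to $\mathbb R^d$; $\hat u(\xi)=\int_{\mathbb R^d}e^{-2\pi i x\cdot\xi}u(x)\,dx$; $(a\otimes b)_{ij}=a_i\overline{b_j}$. $f\in H^{-m}_{\rm loc}(\Omega)$ means $\varphi f\in H^{-m}(\mathbb R^d)$ for all $\varphi\in C_c^\infty(\Omega)$. Semiclassical measure: if $(u_n)$ is bounded in $L^2_{\rm loc}(\Omega;\mathbb C^r)$ and $\omega_n\to0^+$, then, after passing to a subsequence, there is an $r\times r$ hermitian non-negative matrix Radon measure $\mu_{sc}$ on $\Omega\times\mathbb R^d$ such that for all $\varphi_1,\varphi_2\in C_c^\infty(\Omega)$ and $\psi\in\mathcal S(\mathbb R^d)$ $$\lim_n\int_{\mathbb R^d}\big(\widehat{\varphi_1u_n}(\xi)\otimes\widehat{\varphi_2u_n}(\xi)\big)\psi(\omega_n\xi)\,d\xi=\int_{\Omega\times\mathbb R^d}\varphi_1(x)\overline{\varphi_2(x)}\psi(\xi)\,d\bar\mu_{sc}(x,\xi),$$ where $\bar\mu_{sc}$ is the entrywise complex conjugate; $\mu_{sc}$ is called the semiclassical measure with characteristic length $(\omega_n)$ associated to the (sub)sequence. *)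

(* Defs.v *)
From HB Require Import structures.
From mathcomp Require Import all_boot all_order all_algebra.
From mathcomp Require Import all_classical all_reals all_analysis.
From mathcomp Require Import measurable_realfun.
From mathcomp.real_closed Require Import complex.

Set Implicit Arguments.
Unset Strict Implicit.
Unset Printing Implicit Defensive.

Import Order.TTheory GRing.Theory Num.Theory.
Import numFieldNormedType.Exports.
Local Open Scope classical_set_scope.
Local Open Scope ring_scope.
Local Open Scope complex_scope.

(* The complex numbers R[i] carry the topology of their modulus. *)
HB.instance Definition _ (R : realType) := GRing.ComAlgebra.copy R[i] R[i]^o.
HB.instance Definition _ (R : realType) := Vector.copy R[i] R[i]^o.
HB.instance Definition _ (R : realType) := NormedModule.copy R[i] R[i]^o.

(* R^d is 'rV[R]_d, with its Borel sigma-algebra. *)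
Section borel_rV.
Variables (R : realType) (d : nat).

Let borel : set (set 'rV[R]_d) := <<s [set A | open A] >>.
Let borel0 : borel set0. Proof. exact: sigma_algebra0. Qed.
Let borelC A : borel A -> borel (~` A). Proof. exact: sigma_algebraC. Qed.
Let borelU (F : (set 'rV[R]_d)^nat) :
  (forall i, borel (F i)) -> borel (\bigcup_i F i).
Proof. exact: sigma_algebra_bigcup. Qed.

HB.instance Definition _ := @isMeasurable.Build
  (sigma_display [set A : set 'rV[R]_d | open A]) 'rV[R]_d
  borel borel0 borelC borelU.

Lemma open_measurable_rV (A : set 'rV[R]_d) : open A -> measurable A.
Proof. exact: sub_sigma_algebra. Qed.

End borel_rV.

Definition cons_rV (R : realType) (d : nat) (z : R * 'rV[R]_d) : 'rV[R]_d.+1 :=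
  row_mx z.1%:M z.2.

Lemma open_measurable_prod_rV (R : realType) (d : nat)
    (O : set (R * 'rV[R]_d)) :
  open O -> @measurable _ (measurableTypeR R * 'rV[R]_d)%type O.
Proof.
move=> oO.
pose ctr (p : rat * 'rV[rat]_d * nat) : R * 'rV[R]_d :=
  (ratr p.1.1, map_mx ratr p.1.2).
pose box p : set (R * 'rV[R]_d) :=
  ball (ctr p).1 p.2.+1%:R^-1 `*` ball (ctr p).2 p.2.+1%:R^-1.
pose F p := if `[< box p `<=` O >] then box p else set0.
have -> : O = \bigcup_p F p.
  apply/seteqP; split=> [z Oz|z [p _]]; last first.
    by rewrite /F; case: asboolP => // boxO; exact: boxO.
  have [_/posnumP[e] ze] :=
    proj1 (nbhs_ballP _ _) (open_nbhs_nbhs (conj oO Oz)).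
  have [n nE] : exists n, n.+1%:R^-1 < e%:num / 2 :> R.
    have [n] := @ltr_add_invr R 0 (e%:num / 2) ltac:(by []).
    by rewrite add0r; exists n.
  have n0 : 0 < n.+1%:R^-1 :> R by rewrite invr_gt0.
  have near_rat (x : R) : exists q : rat, ball (ratr q : R) n.+1%:R^-1 x.
    have /rat_in_itvoo[q] : x - n.+1%:R^-1 < x + n.+1%:R^-1.
      by rewrite ltrD2l gtrN.
    rewrite in_itv/= => /andP[q1 q2]; exists q.
    rewrite /ball/= distrC ltr_distlC; exact/andP.
  have [q0 q0z] := near_rat z.1.
  have [qf qfz] := choice (fun i : 'I_d => near_rat (z.2 0 i)).
  exists (q0, \row_i qf i, n) => //.
  rewrite /F; case: asboolP => [_|/(_ _)]; last first.
    case=> w [w1 w2]; apply: ze; split.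
    - apply: (@ball_splitr _ R (ratr q0)); apply: le_ball (ltW nE) _ _ => //.
    - apply: (@ball_splitr _ 'rV[R]_d (map_mx ratr (\row_i qf i))).
        apply: le_ball (ltW nE) _ _; split => // i j.
        by rewrite ord1 !mxE.
      exact: le_ball (ltW nE) _ _.
  split=> //=; split => // i j.
  by rewrite ord1 !mxE.
apply: countable_bigcupT_measurable => // p.
rewrite /F; case: asboolP => _ //; apply: measurableX.
- exact: measurable_ball.
- by apply: open_measurable_rV; exact: ball_open.
Qed.

Lemma cons_rV_continuous (R : realType) (d : nat) :
  continuous (@cons_rV R d).
Proof.
move=> z B /nbhs_ballP[e e0 eB]; apply/nbhs_ballP; exists e => // w [w1 [_ w2]].
apply: eB; split=> // i j; rewrite !mxE; case: splitP => k _; last exact: w2.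
by rewrite !mxE !ord1 !mulr1n.
Qed.

Lemma uncons_rV_continuous (R : realType) (d : nat) :
  continuous (fun v : 'rV[R]_d.+1 => v 0 0) /\
  continuous (fun v : 'rV[R]_d.+1 => \row_(i < d) v 0 (lift ord0 i)).
Proof.
split=> v B /nbhs_ballP[e e0 eB]; apply/nbhs_ballP; exists e => // w [w1 w2];
  apply: eB; first exact: w2.
by split => // i j; rewrite !mxE.
Qed.

Lemma continuous_measurable_rV (R : realType) (d k : nat)
    (f : 'rV[R]_d -> 'rV[R]_k) : continuous f -> measurable_fun setT f.
Proof.
move=> cf; apply: (measurability [set A : set 'rV[R]_k | open A]) => //.
move=> _ [A oA <-]; rewrite setTI; apply: open_measurable_rV.
by apply: open_comp => // *; exact: cf.
Qed.

Lemma cons_rV_measurable (R : realType) (d : nat) :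
  measurable_fun [set: measurableTypeR R * 'rV[R]_d] (@cons_rV R d).
Proof.
apply: (measurability [set A : set 'rV[R]_d.+1 | open A]) => //.
move=> _ [A oA <-]; rewrite setTI.
apply: open_measurable_prod_rV; apply: open_comp => // z _.
exact: cons_rV_continuous.
Qed.

(* lebesgue_cons mu is the image of the product of the Lebesgue measure of R
   and mu under the identification of R x R^d with R^(d+1). *)
Section lebesgue_cons.
Local Open Scope ereal_scope.
Variables (R : realType) (d : nat).
Variable mu : {sigma_finite_measure set 'rV[R]_d -> \bar R}.

Definition lebesgue_cons : set 'rV[R]_d.+1 -> \bar R :=
  pushforward (@lebesgue_measure R \x mu) (@cons_rV R d).

HB.instance Definition _ := Measure.copy lebesgue_cons
  (measure_function_pushforward__canonical__measure_function_Measure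
     (@lebesgue_measure R \x mu) (@cons_rV_measurable R d)).

Let uncons (v : 'rV[R]_d.+1) : measurableTypeR R * 'rV[R]_d :=
  (v ord0 ord0, \row_i v ord0 (lift ord0 i)).

Let consK : cancel (@cons_rV R d) uncons.
Proof.
case=> x w; rewrite /uncons /cons_rV/=; congr (_, _).
  by rewrite mxE; case: splitP => // k _; rewrite [k]ord1 mxE.
apply/rowP => i; rewrite !mxE; case: splitP => [k|k].
  by rewrite ord1.
by rewrite /= /bump /= !add1n => -[ik]; congr (w _ _); apply/val_inj.
Qed.

Let uncons_measurable : measurable_fun setT uncons.
Proof.
have [c1 c2] := uncons_rV_continuous R d.
apply: measurable_fun_pair; last exact: continuous_measurable_rV.
apply: (measurability _ (RGenOpens.measurableE R)) => //.
move=> _ [_ [a [b ->] <-]]; rewrite setTI; apply: open_measurable_rV.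
by apply: open_comp => [v _|]; [exact: c1|exact: interval_open].
Qed.

Let lebesgue_cons_sigma_finite : sigma_finite setT lebesgue_cons.
Proof.
have /sigma_finiteP[F [FT ndF Foo]] := sigma_finiteT (@lebesgue_measure R).
have /sigma_finiteP[G [GT ndG Goo]] := sigma_finiteT mu.
exists (fun n => uncons @^-1` (F n `*` G n)).
  apply/esym; rewrite -subTset => v _.
  have [n _ Fn] : (\bigcup_k F k) (uncons v).1 by rewrite -FT.
  have [k _ Gk] : (\bigcup_k G k) (uncons v).2 by rewrite -GT.
  exists (maxn n k) => //; split.
  - exact: (subsetPset _ _ (ndF _ _ (leq_maxl n k))).
  - exact: (subsetPset _ _ (ndG _ _ (leq_maxr n k))).
move=> n; have [mF Fn] := Foo n; have [mG Gn] := Goo n.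
have mFG : measurable (F n `*` G n) by exact: measurableX.
split; first by rewrite -[X in measurable X]setTI; exact: uncons_measurable.
rewrite /lebesgue_cons /pushforward -comp_preimage.
rewrite (_ : uncons \o _ = id); last by apply/funext => z; exact: consK.
by rewrite preimage_id product_measure1E// lte_mul_pinfty// ge0_fin_numE.
Qed.

HB.instance Definition _ := Measure_isSigmaFinite.Build _ _ _ lebesgue_cons
  lebesgue_cons_sigma_finite.

End lebesgue_cons.

Fixpoint lebesgue_rV (R : realType) (d : nat) :
    {sigma_finite_measure set 'rV[R]_d -> \bar R} :=
  match d with
  | 0 => \d_(0 : 'rV[R]_0)
  | d'.+1 => lebesgue_cons (lebesgue_rV R d')
  end.

Section complex_integral.
Context d (T : measurableType d) (R : realType).
Implicit Types (mu : {measure set T -> \bar R}) (D : set T) (f : T -> R[i]).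

Definition cmeasurable_fun D f :=
  measurable_fun D (fun x => complex.Re (f x)) /\
  measurable_fun D (fun x => complex.Im (f x)).

Definition cintegrable mu D f :=
  mu.-integrable D (fun x => (complex.Re (f x))%:E) /\
  mu.-integrable D (fun x => (complex.Im (f x))%:E).

Definition cintegral mu D f : R[i] :=
  (\int[mu]_(x in D) complex.Re (f x)) +i*
  (\int[mu]_(x in D) complex.Im (f x)).

End complex_integral.

Section vectors.
Variable R : realType.

Definition dotp d (x y : 'rV[R]_d) : R := \sum_i x 0 i * y 0 i.

(* The norm of the library on 'rV[R]_d is the sup norm. *)
Definition enorm d (x : 'rV[R]_d) : R := Num.sqrt (dotp x x).

Definition sqnorm r (v : 'cV[R[i]]_r) : R :=
  \sum_j (complex.Re (v j 0) ^+ 2 + complex.Im (v j 0) ^+ 2).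

Definition outer r (a b : 'cV[R[i]]_r) : 'M[R[i]]_r :=
  \matrix_(i, j) (a i 0 * conjc (b j 0)).

Definition cis (t : R) : R[i] := cos t +i* sin t.

Definition vmeasurable_fun d (D : set 'rV[R]_d) r
    (v : 'rV[R]_d -> 'cV[R[i]]_r) :=
  forall j, cmeasurable_fun D (fun x => v x j 0).

End vectors.

Section smooth_functions.
Variables (R : realType) (d : nat).
Implicit Types (f : 'rV[R]_d -> R) (phi psi : 'rV[R]_d -> R[i]) (s : seq 'I_d).

(* pderivs [:: i1; ...; ik] f is d/dx_i1 ... d/dx_ik f. *)
Definition pderivs s f : 'rV[R]_d -> R :=
  foldr (fun i g => 'D_(delta_mx 0 i) g) f s.

Definition rsmooth f := forall s,
  continuous (pderivs s f) /\
  forall i x, derivable (pderivs s f) x (delta_mx 0 i).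

Definition smooth phi :=
  rsmooth (fun x => complex.Re (phi x)) /\
  rsmooth (fun x => complex.Im (phi x)).

Definition cpderivs s phi : 'rV[R]_d -> R[i] := fun x =>
  pderivs s (fun y => complex.Re (phi y)) x +i*
  pderivs s (fun y => complex.Im (phi y)) x.

Definition mderiv (alpha : 'I_d -> nat) phi : 'rV[R]_d -> R[i] :=
  cpderivs (flatten [seq nseq (alpha i) i | i <- enum 'I_d]) phi.

Definition vanishes_outside (K : set 'rV[R]_d) phi :=
  forall x, ~ K x -> phi x = 0.

Definition test_function (Omega : set 'rV[R]_d) phi :=
  smooth phi /\
  exists K, [/\ compact K, K `<=` Omega & vanishes_outside K phi].

Definition schwartz psi :=
  smooth psi /\
  forall (N : nat) s, exists M : R, forall x,
    ((1 + enorm x) ^+ N)%:C * `|cpderivs s psi x| <= M%:C.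

Definition fourier psi : 'rV[R]_d -> R[i] := fun xi =>
  cintegral (lebesgue_rV R d) setT
    (fun x => cis (- (2 * pi * dotp x xi)) * psi x).

Definition vfourier r (v : 'rV[R]_d -> 'cV[R[i]]_r) : 'rV[R]_d -> 'cV[R[i]]_r :=
  fun xi => \col_j fourier (fun x => v x j 0) xi.

End smooth_functions.

Section L2loc.
Variables (R : realType) (d r : nat) (Omega : set 'rV[R]_d).
Implicit Types (u v : 'rV[R]_d -> 'cV[R[i]]_r).
Local Notation leb := (lebesgue_rV R d).

Definition L2loc u :=
  vmeasurable_fun Omega u /\
  forall K, compact K -> K `<=` Omega ->
    (\int[leb]_(x in K) (sqnorm (u x))%:E < +oo)%E.

(* Weak convergence to 0; the dual of L2loc is the space of L2 functions that
   vanish outside a compact subset of Omega. *)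
Definition weak_cvg0 (u : nat -> 'rV[R]_d -> 'cV[R[i]]_r) :=
  forall K v, compact K -> K `<=` Omega -> vmeasurable_fun K v ->
    (\int[leb]_(x in K) (sqnorm (v x))%:E < +oo)%E ->
    cintegral leb K (fun x => \sum_j u n x j 0 * conjc (v x j 0))
      @[n --> \oo] --> (0 : R[i]).

End L2loc.

Section distributions.
Variables (R : realType) (d q : nat) (Omega : set 'rV[R]_d).
Local Notation leb := (lebesgue_rV R d).

(* C^q-valued distributions on Omega, acting bilinearly on test functions; the
   values of such a functional outside of test_function Omega are irrelevant. *)
Definition functional := ('rV[R]_d -> R[i]) -> 'cV[R[i]]_q.
Implicit Types (f : functional) (phi : 'rV[R]_d -> R[i]).

Definition is_distribution f :=
  (forall (a : R[i]) phi1 phi2,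
     test_function Omega phi1 -> test_function Omega phi2 ->
     f (fun x => a * phi1 x + phi2 x) = a *: f phi1 + f phi2) /\
  (forall K, compact K -> K `<=` Omega ->
     exists (C : R) (N : nat), forall phi (M : R),
       smooth phi -> vanishes_outside K phi ->
       (forall s x, (size s <= N)%N -> `|cpderivs s phi x| <= M%:C) ->
       forall j, `|f phi j 0| <= (C * M)%:C).

(* The function g is the Fourier transform of the tempered distribution phi f:
   <g, psi> = <phi f, fourier psi> for every Schwartz function psi. *)
Definition fourier_mul f phi (g : 'rV[R]_d -> 'cV[R[i]]_q) :=
  vmeasurable_fun setT g /\
  forall psi, schwartz psi -> forall j,
    cintegrable leb setT (fun xi => g xi j 0 * psi xi) /\
    f (fun x => phi x * fourier psi x) j 0 =
      cintegral leb setT (fun xi => g xi j 0 * psi xi).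

Definition Hloc_neg (m : nat) f :=
  is_distribution f /\
  forall phi, test_function Omega phi -> exists2 g, fourier_mul f phi g &
    (\int[leb]_xi (sqnorm (g xi) / (1 + enorm xi ^+ 2) ^+ m)%:E < +oo)%E.

End distributions.

(* Multi-indices with entries at most m; those of length at most m are all
   such. *)
Definition mindex (d m : nat) := {ffun 'I_d -> 'I_m.+1}.

Definition mlen d m (alpha : mindex d m) : nat := (\sum_i alpha i)%N.

Definition monom (R : realType) d m (alpha : mindex d m) (xi : 'rV[R]_d) : R :=
  \prod_i xi 0 i ^+ alpha i.

Section equation.
Variables (R : realType) (d q r l m : nat) (Omega : set 'rV[R]_d).

(* sum_alpha eps^(|alpha| - l) D_alpha (A_alpha u) = f in the sense of
   distributions on Omega. *)
Definition solves (eps : R) (A : mindex d m -> 'rV[R]_d -> 'M[R[i]]_(q, r))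
    (u : 'rV[R]_d -> 'cV[R[i]]_r) (f : functional R d q) :=
  forall phi, test_function Omega phi ->
    \sum_(alpha : mindex d m | (l <= mlen alpha <= m)%N)
      (eps ^+ (mlen alpha - l))%:C *:
      ((-1) ^+ mlen alpha *:
       \col_j cintegral (lebesgue_rV R d) Omega
         (fun x =>
            (A alpha x *m u x) j 0 * mderiv (fun i => alpha i) phi x)) = f phi.

Definition weight (eps : R) (xi : 'rV[R]_d) : R :=
  1 + \sum_(l <= s < m.+1) eps ^+ (s - l) * enorm xi ^+ s.

Definition twopii : R[i] := 0 +i* (2 * pi).

(* c stands for lim eps_n / omega_n; the case c = -oo does not occur. *)
Definition symbol (A : mindex d m -> 'rV[R]_d -> 'M[R[i]]_(q, r)) (c : \bar R)
    (z : 'rV[R]_d * 'rV[R]_d) : 'M[R[i]]_(q, r) :=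
  match c with
  | c'%:E =>
    if c' == 0 then
      \sum_(alpha : mindex d m | mlen alpha == l)
        (twopii ^+ l * (monom alpha z.2)%:C) *: A alpha z.1
    else
      \sum_(alpha : mindex d m | (l <= mlen alpha <= m)%N)
        ((twopii * c'%:C) ^+ mlen alpha * (monom alpha z.2)%:C) *: A alpha z.1
  | +oo%E =>
      \sum_(alpha : mindex d m | mlen alpha == m)
        (twopii ^+ m * (monom alpha z.2)%:C) *: A alpha z.1
  | -oo%E => 0
  end.

End equation.

(* A complex Radon measure is represented as (mu1 - mu2) + i (mu3 - mu4) with
   positive Borel measures mu1, ..., mu4 that are finite on compact sets (on an
   open subset of a Euclidean space such measures are regular). *)
Record cmeasure d (T : measurableType d) (R : realType) := CMeasure {
  re_pos : {measure set T -> \bar R};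
  re_neg : {measure set T -> \bar R};
  im_pos : {measure set T -> \bar R};
  im_neg : {measure set T -> \bar R} }.

Section cmeasure.
Context d (T : measurableType d) (R : realType).
Implicit Types (mu : cmeasure T R) (B : set T) (f : T -> R[i]).

Definition cm_conj mu :=
  CMeasure (re_pos mu) (re_neg mu) (im_neg mu) (im_pos mu).

Definition cm_val mu B : R[i] :=
  (fine (re_pos mu B) - fine (re_neg mu B)) +i*
  (fine (im_pos mu B) - fine (im_neg mu B)).

Definition cm_integrable mu B f :=
  [/\ cintegrable (re_pos mu) B f, cintegrable (re_neg mu) B f,
      cintegrable (im_pos mu) B f & cintegrable (im_neg mu) B f].

Definition cm_integral mu B f : R[i] :=
  cintegral (re_pos mu) B f - cintegral (re_neg mu) B f +
  (0 +i* 1) * (cintegral (im_pos mu) B f - cintegral (im_neg mu) B f).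

End cmeasure.

Section phase_space.
Variables (R : realType) (d : nat).
Local Notation E := ('rV[R]_d * 'rV[R]_d)%type.
Implicit Types (X B : set E).

Definition rel_compact X B :=
  measurable B /\ exists K : set E, [/\ compact K, K `<=` X & B `<=` K].

Definition radon X (mu : cmeasure E R) :=
  forall K : set E, compact K -> K `<=` X ->
    [/\ (re_pos mu K < +oo)%E, (re_neg mu K < +oo)%E,
        (im_pos mu K < +oo)%E & (im_neg mu K < +oo)%E].

Definition hermitian_nonneg r (M : 'M[R[i]]_r) :=
  (forall i j, M i j = conjc (M j i)) /\
  (forall v : 'cV[R[i]]_r, 0 <= \sum_i \sum_j conjc (v i 0) * M i j * v j 0).

Definition hermitian_radon X r (mu : 'M[cmeasure E R]_r) :=
  (forall i j, radon X (mu i j)) /\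
  (forall B, rel_compact X B ->
     hermitian_nonneg (\matrix_(i, j) cm_val (mu i j) B)).

(* The value on B of the product p mu of a matrix function and a matrix
   measure. *)
Definition mx_density q r s (p : E -> 'M[R[i]]_(q, r))
    (mu : 'M[cmeasure E R]_(r, s)) B : 'M[R[i]]_(q, s) :=
  \matrix_(i, j) \sum_k cm_integral (mu k j) B (fun z => p z i k).

(* mu is the semiclassical measure of the whole sequence u, with characteristic
   length omega. *)
Definition semiclassical_measure (Omega : set 'rV[R]_d) r
    (u : nat -> 'rV[R]_d -> 'cV[R[i]]_r) (omega : nat -> R)
    (mu : 'M[cmeasure E R]_r) :=
  hermitian_radon (Omega `*` setT) mu /\
  forall phi1 phi2 psi, test_function Omega phi1 -> test_function Omega phi2 ->
    schwartz psi -> forall i j,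
    let h := fun z : E => phi1 z.1 * conjc (phi2 z.1) * psi z.2 in
    cm_integrable (mu i j) (Omega `*` setT) h /\
    cintegral (lebesgue_rV R d) setT (fun xi =>
        outer (vfourier (fun x => phi1 x *: u n x) xi)
              (vfourier (fun x => phi2 x *: u n x) xi) i j *
        psi (omega n *: xi))
      @[n --> \oo] --> cm_integral (cm_conj (mu i j)) (Omega `*` setT) h.

End phase_space.

(* Main.v *)
Require Import Defs.
From HB Require Import structures.
From mathcomp Require Import all_boot all_order all_algebra.
From mathcomp Require Import all_classical all_reals all_analysis.
From mathcomp Require Import measurable_realfun ring lra.
From mathcomp.real_closed Require Import complex.

Set Implicit Arguments.
Unset Strict Implicit.
Unset Printing Implicit Defensive.

Import Order.TTheory GRing.Theory Num.Theory.
Import numFieldNormedType.Exports.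
Local Open Scope classical_set_scope.
Local Open Scope ring_scope.
Local Open Scope complex_scope.

(* The equation is tested against phi1 * W_n, where W_n is the Fourier
   transform of xi |-> conj(F(phi2 u_n)(xi)) psi(omega_n xi) and F is the Fourier
   transform. A derivative d/dx_i of W_n multiplies psi by -2 pi i xi_i / omega_n,
   while the terms in which it falls on phi1 lose a factor omega_n. Scaled by
   S_n = omega_n^l, or by omega_n^l (omega_n / eps_n)^(m - l) if eps_n / omega_n
   tends to infinity, the left-hand side therefore converges to the integral of
   phi1 conj(phi2) psi p against the conjugate measures; this uses that A_n can be
   replaced by a smooth function that is uniformly close to it on the support of
   phi1. The right-hand side tends to 0 by Cauchy-Schwarz, because S_n times the
   weight is bounded on the support of psi(omega_n .).

   Since psi is taken with compact support, Plancherel's theorem is only needed in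
   the form of the inequality int |F a|^2 exp(-omega |xi|) <= int |a|^2, which is
   Schur's test for the Poisson kernel. Letting the test functions increase to
   indicators of boxes, Dynkin's lemma gives the vanishing of the density of p
   against the conjugate measures on all Borel sets, and hermitian symmetry turns
   it into the claim. *)

(** * Complex-valued functions and their integrals *)

(** All bounds uniform in n come from the weak convergence alone: the uniform boundedness principle
    bounds u_n in L^2 of every compact subset of Omega.

    The compact support of psi is used twice more. It makes the function whose transform is W_n
    smooth and compactly supported, hence a Schwartz function against which phi1 f_n can be tested
    through its Fourier transform. It also makes the damping harmless: on the support of psi(omega_n
    .) the weight is bounded below by a constant that does not depend on n.

    A row of the symbol mixes all components of u_n, so only a sum over k of integrals against
    different measures vanishes. The passage to Borel sets therefore treats this sum as a single
    functional.

    The transposition in the claim comes from the conjugate in the definition of the semiclassical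
    measure. A complex measure is given by four positive ones that it does not determine, so
    hermitian symmetry equates only the values of the conjugate of mu_kk' and of mu_k'k on
    relatively compact sets; integrals have to be recovered from these values. *)

Notation normc := Normc.normc.

Section complex_modulus.
Variable R : realType.
Implicit Types z w : R[i].

Lemma normr_normc z : `|z| = (normc z)%:C.
Proof. by case: z. Qed.

Lemma normc_ge0 z : 0 <= normc z.
Proof. by case: z => a b; rewrite sqrtr_ge0. Qed.

Lemma normc_sqr z : normc z ^+ 2 = complex.Re z ^+ 2 + complex.Im z ^+ 2.
Proof. by case: z => a b /=; rewrite sqr_sqrtr// addr_ge0// sqr_ge0. Qed.

Lemma normc_conj z : normc (conjc z) = normc z.
Proof. by case: z => a b /=; rewrite sqrrN. Qed.

Lemma normc_real (x : R) : normc x%:C = `|x|.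
Proof. by rewrite /= expr0n addr0 sqrtr_sqr. Qed.

Lemma normc_cis (t : R) : normc (cis t) = 1.
Proof. by rewrite /cis /= cos2Dsin2 sqrtr1. Qed.

Lemma normc_Re z : `|complex.Re z| <= normc z.
Proof. by rewrite -(@ler_pXn2r _ 2) ?nnegrE ?normc_ge0// normc_sqr real_normK ?num_real// lerDl
  sqr_ge0. Qed.

Lemma normc_Im z : `|complex.Im z| <= normc z.
Proof. by rewrite -(@ler_pXn2r _ 2) ?nnegrE ?normc_ge0// normc_sqr real_normK ?num_real// lerDr
  sqr_ge0. Qed.

Lemma normc_le z : normc z <= `|complex.Re z| + `|complex.Im z|.
Proof.
rewrite -(@ler_pXn2r _ 2) ?nnegrE ?normc_ge0 ?addr_ge0// normc_sqr sqrrD.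
rewrite !real_normK ?num_real// -addrA [X in _ <= _ + X]addrC addrA lerDl.
by rewrite mulrn_wge0// mulr_ge0.
Qed.

Lemma cReM z w : complex.Re (z * w) =
  complex.Re z * complex.Re w - complex.Im z * complex.Im w.
Proof. by case: z; case: w. Qed.

Lemma cImM z w : complex.Im (z * w) =
  complex.Re z * complex.Im w + complex.Im z * complex.Re w.
Proof. by case: z; case: w. Qed.

Lemma cReD z w : complex.Re (z + w) = complex.Re z + complex.Re w.
Proof. by case: z; case: w. Qed.

Lemma cImD z w : complex.Im (z + w) = complex.Im z + complex.Im w.
Proof. by case: z; case: w. Qed.

Lemma cRe_conj z : complex.Re (conjc z) = complex.Re z.
Proof. by case: z. Qed.

Lemma cIm_conj z : complex.Im (conjc z) = - complex.Im z.
Proof. by case: z. Qed.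

Lemma complexP z w : complex.Re z = complex.Re w ->
  complex.Im z = complex.Im w -> z = w.
Proof. by case: z => a b; case: w => a' b' /= -> ->. Qed.

Lemma mulc_conj z : conjc z * z = (normc z ^+ 2)%:C.
Proof.
rewrite normc_sqr; case: z => a b; apply: complexP => //=; ring.
Qed.

Lemma cisD (s t : R) : cis (s + t) = cis s * cis t.
Proof. by apply: complexP; rewrite ?cReM ?cImM /cis/= ?cosD ?sinD// addrC. Qed.

Lemma conj_cis (t : R) : conjc (cis t) = cis (- t).
Proof. by rewrite /cis /= cosN sinN. Qed.

End complex_modulus.

Section complex_integrals.
Context dd (T : measurableType dd) (R : realType).
Variable mu : {measure set T -> \bar R}.
Implicit Types (D : set T) (f g : T -> R[i]) (h : T -> R).

Lemma eq_cmeasurable D g f : (forall x, f x = g x) ->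
  cmeasurable_fun D g -> cmeasurable_fun D f.
Proof. by move=> /funext ->. Qed.

Lemma eq_cintegrable D g f : (forall x, f x = g x) ->
  cintegrable mu D g -> cintegrable mu D f.
Proof. by move=> /funext ->. Qed.

Lemma eq_measurable D h' h : (forall x, h x = h' x) ->
  measurable_fun D (h' : T -> R) -> measurable_fun D h.
Proof. by move=> /funext ->. Qed.

Lemma cmeasurable_cst D (c : R[i]) : cmeasurable_fun D (fun=> c).
Proof. by split; exact: measurable_cst. Qed.

Lemma cmeasurableD D f g : cmeasurable_fun D f -> cmeasurable_fun D g ->
  cmeasurable_fun D (fun x => f x + g x).
Proof.
move=> [f1 f2] [g1 g2]; split.
  by under eq_fun do rewrite cReD; exact: measurable_funD.
by under eq_fun do rewrite cImD; exact: measurable_funD.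
Qed.

Lemma cmeasurableM D f g : cmeasurable_fun D f -> cmeasurable_fun D g ->
  cmeasurable_fun D (fun x => f x * g x).
Proof.
move=> [f1 f2] [g1 g2]; split.
  by under eq_fun do rewrite cReM; apply: measurable_funB; exact: measurable_funM.
by under eq_fun do rewrite cImM; apply: measurable_funD; exact: measurable_funM.
Qed.

Lemma cmeasurable_real D h : measurable_fun D h ->
  cmeasurable_fun D (fun x => (h x)%:C).
Proof. by move=> mh; split => //=; exact: measurable_cst. Qed.

Lemma cmeasurable_conj D f : cmeasurable_fun D f ->
  cmeasurable_fun D (fun x => conjc (f x)).
Proof.
move=> [f1 f2]; split; first by under eq_fun do rewrite cRe_conj.
by under eq_fun do rewrite cIm_conj; exact: measurable_funN.
Qed.

Lemma cmeasurable_sum D (I : Type) (s : seq I) (P : pred I) (F : I -> T -> R[i]) :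
  (forall i, cmeasurable_fun D (F i)) ->
  cmeasurable_fun D (fun x => \sum_(i <- s | P i) F i x).
Proof.
move=> mF; elim: s => [|i s ih].
  by under eq_fun do rewrite big_nil; exact: cmeasurable_cst.
under eq_fun do rewrite big_cons.
by case: (P i) => //; exact: cmeasurableD.
Qed.

Lemma cmeasurable_normc D f : cmeasurable_fun D f ->
  measurable_fun D (fun x => normc (f x)).
Proof.
move=> [f1 f2]; apply: (eq_measurable_fun
  (fun x => Num.sqrt (complex.Re (f x) ^+ 2 + complex.Im (f x) ^+ 2))).
  by move=> x _; rewrite -normc_sqr sqrtr_sqr ger0_norm ?normc_ge0.
apply: (@measurableT_comp _ _ _ _ _ _ (@Num.sqrt R)).
  by apply: continuous_measurable_fun; exact: sqrt_continuous.
by apply: measurable_funD; exact: measurable_funX.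
Qed.

Lemma cintegrable_meas D f : cintegrable mu D f -> cmeasurable_fun D f.
Proof. by move=> [/measurable_int/measurable_EFinP ? /measurable_int/measurable_EFinP]. Qed.

Lemma le_cintegrable D f h : measurable D -> cmeasurable_fun D f ->
  (forall x, D x -> normc (f x) <= h x) ->
  mu.-integrable D (EFin \o h) -> cintegrable mu D f.
Proof.
move=> mD [f1 f2] fh ih.
by split; apply: (le_integrable mD _ _ ih); try exact/measurable_EFinP;
  move=> x Dx; rewrite lee_fin (le_trans _ (le_trans (fh x Dx) (ler_norm _)))//;
  [exact: normc_Re|exact: normc_Im].
Qed.

Lemma cintegrable_normc D f : measurable D -> cintegrable mu D f ->
  mu.-integrable D (EFin \o (fun x => normc (f x))).
Proof.
move=> mD cf; have [f1 f2] := cf.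
apply: (@le_integrable _ _ _ _ _ mD _ (EFin \o (fun x =>
  `|complex.Re (f x)| + `|complex.Im (f x)|))).
- exact/measurable_EFinP/cmeasurable_normc/(cintegrable_meas cf).
- move=> x Dx; rewrite /= lee_fin (ger0_norm (normc_ge0 _)).
  exact: (le_trans (normc_le _) (ler_norm _)).
- have -> : EFin \o (fun x => `|complex.Re (f x)| + `|complex.Im (f x)|) =
    (fun x => (`|complex.Re (f x)|)%:E + (`|complex.Im (f x)|)%:E)%E by [].
  by apply: integrableD => //; exact: integrable_norm.
Qed.

Lemma cintegrableD D f g : measurable D -> cintegrable mu D f ->
  cintegrable mu D g -> cintegrable mu D (fun x => f x + g x).
Proof.
move=> mD [f1 f2] [g1 g2]; split.
  under eq_fun do rewrite cReD EFinD; exact: integrableD.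
under eq_fun do rewrite cImD EFinD; exact: integrableD.
Qed.

Lemma cintegrableZl D (c : R[i]) f : measurable D -> cintegrable mu D f ->
  cintegrable mu D (fun x => c * f x).
Proof.
move=> mD [f1 f2]; split.
  under eq_fun do rewrite cReM EFinB !EFinM.
  by apply: integrableB => //; exact: integrableZl.
under eq_fun do rewrite cImM EFinD !EFinM.
by apply: integrableD => //; exact: integrableZl.
Qed.

Lemma cintegralD D f g : measurable D -> cintegrable mu D f ->
  cintegrable mu D g ->
  cintegral mu D (fun x => f x + g x) = cintegral mu D f + cintegral mu D g.
Proof.
move=> mD [f1 f2] [g1 g2]; rewrite /cintegral.
under eq_Rintegral do rewrite cReD.
under [in X in _ +i* X]eq_Rintegral do rewrite cImD.
by rewrite !RintegralD.
Qed.

Lemma cintegralZl D (c : R[i]) f : measurable D -> cintegrable mu D f ->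
  cintegral mu D (fun x => c * f x) = c * cintegral mu D f.
Proof.
move=> mD [f1 f2]; apply: complexP; rewrite ?cReM ?cImM /cintegral/=.
  under eq_Rintegral do rewrite cReM.
  rewrite RintegralB//; first by rewrite !RintegralZl.
    exact: (integrableZl mD (complex.Re c) f1).
  exact: (integrableZl mD (complex.Im c) f2).
under eq_Rintegral do rewrite cImM.
rewrite RintegralD//; first by rewrite !RintegralZl.
  exact: (integrableZl mD (complex.Re c) f2).
exact: (integrableZl mD (complex.Im c) f1).
Qed.

Lemma eq_cintegral D f g : (forall x, D x -> f x = g x) ->
  cintegral mu D f = cintegral mu D g.
Proof.
by move=> fg; rewrite /cintegral; congr (_ +i* _); apply: eq_Rintegral => x;
  rewrite inE => Dx; rewrite fg.
Qed.

Lemma cintegral_mkcond D f :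
  cintegral mu D f = cintegral mu setT (fun x => if x \in D then f x else 0).
Proof.
rewrite /cintegral; congr (_ +i* _);
  by rewrite Rintegral_mkcond; apply: eq_Rintegral => x _; rewrite patchE; case: ifP.
Qed.

(** Multiplying [f] by the conjugate of its integral [z] turns the integral into the real number
    |z|^2, which is at most |z| times the integral of |f|. Dividing by |z| is why the case |z| = 0
    is split off. *)
Lemma cintegral_normc D f : measurable D -> cintegrable mu D f ->
  normc (cintegral mu D f) <= \int[mu]_(x in D) normc (f x).
Proof.
move=> mD cf; set z := cintegral mu D f.
have [->|z0] := eqVneq (normc z) 0.
  by apply: Rintegral_ge0 => x _; exact: normc_ge0.
have zp : 0 < normc z by rewrite lt_neqAle eq_sym z0 normc_ge0.
rewrite -(ler_pM2l zp) -expr2.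
have -> : normc z ^+ 2 = complex.Re (cintegral mu D (fun x => conjc z * f x)).
  by rewrite cintegralZl// -/z mulc_conj.
have ni := cintegrable_normc mD cf.
rewrite -RintegralZl// le_Rintegral//.
- by have [] := cintegrableZl (conjc z) mD cf.
- exact: (integrableZl mD (normc z) ni).
- move=> x Dx; rewrite (le_trans (ler_norm _))// (le_trans (normc_Re _))//.
  by rewrite Normc.normcM normc_conj.
Qed.

Lemma cintegral_sum D (I : Type) (s : seq I) (P : pred I) (F : I -> T -> R[i]) :
  measurable D -> (forall i, P i -> cintegrable mu D (F i)) ->
  cintegrable mu D (fun x => \sum_(i <- s | P i) F i x) /\
  cintegral mu D (fun x => \sum_(i <- s | P i) F i x) =
  \sum_(i <- s | P i) cintegral mu D (F i).
Proof.
move=> mD iF; elim: s => [|i s [ih1 ih2]].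
  rewrite big_nil; split.
    by under eq_fun do rewrite big_nil; split; exact: integrable0.
  under eq_cintegral do rewrite big_nil.
  by rewrite /cintegral !Rintegral_cst//= !mul0r.
rewrite big_cons; case: (boolP (P i)) => Pi; last first.
  split; first by under eq_fun do rewrite big_cons (negbTE Pi).
  by rewrite -ih2; apply: eq_cintegral => x _; rewrite big_cons (negbTE Pi).
split.
  by under eq_fun do rewrite big_cons Pi; apply: cintegrableD => //; exact: iF.
rewrite -ih2 -cintegralD//; last exact: iF.
by apply: eq_cintegral => x _; rewrite big_cons Pi.
Qed.

(** The disjunction is to be read as an implication from integrability, which is what allows the
    sign of the imaginary part to be taken out. *)
Lemma cintegral_conj f : cintegral mu setT (fun x => conjc (f x)) =
  conjc (cintegral mu setT f) \/ ~ cintegrable mu setT f.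
Proof.
have [cf|] := pselect (cintegrable mu setT f); [left|by right].
have [f1 f2] := cf.
rewrite /cintegral /=; congr (_ +i* _).
  by apply: eq_Rintegral => x _; rewrite cRe_conj.
under eq_Rintegral do rewrite cIm_conj -mulN1r.
by rewrite RintegralZl// mulN1r.
Qed.

End complex_integrals.

Section complex_fubini.
Context d1 d2 (T1 : measurableType d1) (T2 : measurableType d2) (R : realType).
Variables (m1 : {sigma_finite_measure set T1 -> \bar R})
          (m2 : {sigma_finite_measure set T2 -> \bar R}).

Lemma Rintegral_prod (f : T1 * T2 -> R) :
  (m1 \x m2)%E.-integrable setT (EFin \o f) ->
  (forall x, m2.-integrable setT (fun y => (f (x, y))%:E)) ->
  \int[(m1 \x m2)%E]_z f z = \int[m1]_x \int[m2]_y f (x, y).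
Proof.
move=> fi f1; rewrite /Rintegral -(integral12_prod_meas1 fi) /fubini_F.
congr fine; apply: eq_integral => x _ /=.
by rewrite fineK//; exact: integrable_fin_num.
Qed.

Lemma Rintegral_swap (f : T1 * T2 -> R) :
  (m1 \x m2)%E.-integrable setT (EFin \o f) ->
  (forall x, m2.-integrable setT (fun y => (f (x, y))%:E)) ->
  (forall y, m1.-integrable setT (fun x => (f (x, y))%:E)) ->
  \int[m1]_x \int[m2]_y f (x, y) = \int[m2]_y \int[m1]_x f (x, y).
Proof.
move=> fi f1 f2; rewrite -Rintegral_prod//.
rewrite /Rintegral -(integral21_prod_meas1 fi) /fubini_G.
congr fine; apply: eq_integral => x _ /=.
by rewrite fineK//; exact: integrable_fin_num.
Qed.

Lemma cintegral_prod (f : T1 * T2 -> R[i]) :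
  cintegrable (m1 \x m2)%E setT f ->
  (forall x, cintegrable m2 setT (fun y => f (x, y))) ->
  cintegral (m1 \x m2)%E setT f =
  cintegral m1 setT (fun x => cintegral m2 setT (fun y => f (x, y))).
Proof.
move=> [f1 f2] f12; rewrite /cintegral; congr (_ +i* _); rewrite Rintegral_prod// => x;
  by have [] := f12 x.
Qed.

Lemma cintegral_swap (f : T1 * T2 -> R[i]) :
  cintegrable (m1 \x m2)%E setT f ->
  (forall x, cintegrable m2 setT (fun y => f (x, y))) ->
  (forall y, cintegrable m1 setT (fun x => f (x, y))) ->
  cintegral m1 setT (fun x => cintegral m2 setT (fun y => f (x, y))) =
  cintegral m2 setT (fun y => cintegral m1 setT (fun x => f (x, y))).
Proof.
move=> [f1 f2] f12 f21; rewrite /cintegral; congr (_ +i* _);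
  rewrite (Rintegral_swap (f := fun z => _ (f z)))// => z;
  by [have [] := f12 z|have [] := f21 z].
Qed.

Lemma integrable_tensor (f : T1 -> R) (g : T2 -> R) :
  m1.-integrable setT (EFin \o f) -> m2.-integrable setT (EFin \o g) ->
  (m1 \x m2)%E.-integrable setT (EFin \o (fun z => f z.1 * g z.2)).
Proof.
move=> fi gi.
have mf : measurable_fun setT f by exact/measurable_EFinP/(measurable_int m1).
have mg : measurable_fun setT g by exact/measurable_EFinP/(measurable_int m2).
have mfg : measurable_fun setT (EFin \o (fun z : T1 * T2 => f z.1 * g z.2)).
  by apply/measurable_EFinP/measurable_funM; exact: measurableT_comp.
apply/(integrable12ltyP m1 m2 mfg).
have -> : (fun x => \int[m2]_y `|(EFin \o (fun z => f z.1 * g z.2)%R) (x, y)|)%E =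
   (fun x => (`|f x| * \int[m2]_y `|g y|)%:E).
  apply/funext => x /=.
  under eq_integral do rewrite normrM EFinM.
  rewrite integralZl//; last exact: integrable_norm.
  rewrite EFinM; congr (_ * _)%E; rewrite /Rintegral fineK//.
  by apply: integrable_fin_num => //; exact: integrable_norm.
apply: integrable_lty => //.
have := integrableZl measurableT (\int[m2]_y `|g y|) (integrable_norm fi).
by apply: eq_integrable => // x _ /=; rewrite mulrC EFinM.
Qed.

End complex_fubini.

(** * One-dimensional kernels *)

Section one_dimensional_integrals.
Variable R : realType.
Local Notation leb := (@lebesgue_measure R).
Implicit Types (f : R -> R) (w b t : R).

(** Brings integrals over the line to a half-line, where they are computed from an antiderivative
    and its limit at infinity. *)
Lemma ge0_integral_fold f : (forall x, 0 <= f x) -> continuous f ->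
  (\int[leb]_x (f x)%:E = \int[leb]_(x in `[0%R, +oo[) (f x + f (- x))%:E)%E.
Proof.
move=> f0 cf.
have mf : measurable_fun setT f by exact: continuous_measurable_fun.
have cfN : continuous (f \o -%R).
  by move=> x; apply: continuous_comp; [exact: opp_continuous|exact: cf].
have mfN : measurable_fun setT (f \o -%R) by exact: continuous_measurable_fun.
rewrite -(setUv `[0, +oo[%classic) ge0_integral_setU//=; last 4 first.
- exact: measurableC.
- by apply/measurable_EFinP; rewrite setUv.
- by move=> x _; rewrite lee_fin.
- exact/disj_setPCl.
under [RHS]eq_integral do rewrite EFinD.
rewrite ge0_integralD//=; last 4 first.
- by move=> x _; rewrite lee_fin.
- exact/measurable_EFinP/measurable_funTS.
- by move=> x _; rewrite lee_fin.
- exact/measurable_EFinP/measurable_funTS.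
congr (_ + _)%E; rewrite setCitvr.
rewrite integral_itv_bndo_bndc; last exact/measurable_EFinP/measurable_funTS.
rewrite -{1}oppr0 ge0_integration_by_substitutionNy//.
exact: continuous_subspaceT.
Qed.

Lemma cvg_expR_scale w : 0 < w -> expR (- (w * t)) @[t --> +oo] --> 0.
Proof.
move=> w0; apply: (@cvg_comp _ _ _ (fun t => w * t) (fun x => expR (- x)));
  last exact: cvgr_expR.
by apply: gt0_cvgMry => //; exact: cvg_id.
Qed.

(** An antiderivative of exp(-wt) (1 + cos(bt)). The added 1 makes the integrand nonnegative, as the
    fundamental theorem on an unbounded interval requires; it is subtracted again in
    [cintegral_expabs_cis]. *)
Let F w b t : R := - (expR (- (w * t)) / w) +
  expR (- (w * t)) * (b * sin (b * t) - w * cos (b * t)) / (w ^+ 2 + b ^+ 2).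

Let dF w b t : 0 < w ->
  is_derive t 1 (F w b) (expR (- (w * t)) * (1 + cos (b * t))).
Proof.
move=> w0; rewrite /F.
have wb : w ^+ 2 + b ^+ 2 != 0 by rewrite gt_eqF// ltr_pwDl ?exprn_gt0 ?sqr_ge0.
apply: is_derive_eq; rewrite /GRing.scale/=.
field; rewrite wb gt_eqF//.
Qed.

Let cvgF w b : 0 < w -> F w b t @[t --> +oo] --> (0 : R).
Proof.
move=> w0.
have wb : 0 < w ^+ 2 + b ^+ 2 by rewrite ltr_pwDl ?exprn_gt0 ?sqr_ge0.
pose C := w^-1 + (`|b| + w) / (w ^+ 2 + b ^+ 2).
apply: norm_cvg0; apply: (@squeeze_cvgr _ _ _ _ (fun=> 0) (fun t => expR (- (w * t)) * C)).
- near=> t; rewrite normr_ge0/= /F /C [leRHS]mulrDr.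
  apply: (le_trans (ler_normD _ _)); rewrite normrN.
  rewrite !normrM !(ger0_norm (expR_ge0 _)) !normfV (gtr0_norm w0) (gtr0_norm wb).
  rewrite lerD2l -mulrA ler_pM2l ?expR_gt0// ler_pM2r ?invr_gt0//.
  apply: (le_trans (ler_normB _ _)); rewrite !normrM (gtr0_norm w0).
  by apply: lerD; apply: ler_piMr => //; [|exact: ltW|];
    [rewrite ler_norml sin_geN1 sin_le1|rewrite ler_norml cos_geN1 cos_le1].
- exact: cvg_cst.
- by rewrite -[X in _ --> X](mul0r C); apply: cvgMl; exact: cvg_expR_scale.
Unshelve. all: by end_near. Qed.

Lemma integral0y_expR_cos w b : 0 < w ->
  (\int[leb]_(t in `[0%R, +oo[) (expR (- (w * t)) * (1 + cos (b * t)))%:E =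
  (w^-1 + w / (w ^+ 2 + b ^+ 2))%:E)%E.
Proof.
move=> w0.
have dFt t : derivable (F w b) t 1 by have [] := dF b t w0.
have cf : continuous (fun t => expR (- (w * t)) * (1 + cos (b * t))).
  move=> t; apply: differentiable_continuous; apply/derivable1_diffP.
  exact: ex_derive.
rewrite (@ge0_continuous_FTC2y _ _ (F w b) 0 0) //.
- rewrite -EFinB /F !mulr0 oppr0 expR0 sin0 cos0; congr EFin; ring.
- exact: continuous_subspaceT.
- exact: cvgF.
- apply: cvg_at_right_filter; apply: differentiable_continuous.
  exact/derivable1_diffP.
- by move=> t _; rewrite derive1E; have [_ ->] := dF b t w0.
Qed.

Let mexp w : measurable_fun (`[0, +oo[ : set R) (fun t => expR (- (w * t))).
Proof.
apply: measurable_funTS; apply: continuous_measurable_fun => t.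
apply: differentiable_continuous; apply/derivable1_diffP; exact: ex_derive.
Qed.

Let mexp_cos w b :
  measurable_fun (`[0, +oo[ : set R) (fun t => expR (- (w * t)) * (1 + cos (b * t))).
Proof.
apply: measurable_funTS; apply: continuous_measurable_fun => t.
apply: differentiable_continuous; apply/derivable1_diffP; exact: ex_derive.
Qed.

Lemma integral0y_expR w : 0 < w ->
  (\int[leb]_(t in `[0%R, +oo[) (expR (- (w * t)))%:E = (w^-1)%:E)%E.
Proof.
move=> w0; have := integral0y_expR_cos 0 w0.
under eq_integral do rewrite mul0r cos0 mulrC -[1+1]/(2%:R) EFinM.
rewrite ge0_integralZl//=; last first.
  by apply/measurable_EFinP; exact: mexp.
have -> : w^-1 + w / (w ^+ 2 + 0 ^+ 2) = 2 * w^-1.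
  by field; rewrite gt_eqF.
rewrite EFinM => /(congr1 (fun x => (2^-1 : R)%:E * x)%E).
by rewrite !muleA -!EFinM mulVf ?pnatr_eq0// ?mul1e ?mul1r => ->.
Qed.

Definition expabs w t : R := expR (- (w * `|t|)).

Lemma continuous_expabs w : continuous (expabs w).
Proof.
move=> t; apply: (@continuous_comp _ _ _ (fun t : R => `|t|) (fun t => expR (- (w * t)))).
  exact: norm_continuous.
apply: differentiable_continuous; apply/derivable1_diffP; exact: ex_derive.
Qed.

Lemma integral_expabs_fold w (g : R -> R) : 0 < w -> continuous g ->
  (forall t, 0 <= g t) ->
  (\int[leb]_t (expabs w t * g t)%:E =
   \int[leb]_(t in `[0%R, +oo[) (expR (- (w * t)) * (g t + g (- t)))%:E)%E.
Proof.
move=> w0 cg g0; rewrite ge0_integral_fold; last 2 first.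
- by move=> x; rewrite mulr_ge0// expR_ge0.
- by move=> x; apply: cvgM; [exact: continuous_expabs|exact: cg].
apply: eq_integral => t; rewrite inE/= in_itv/= andbT => t0.
by rewrite /expabs normrN ger0_norm// -mulrDr.
Qed.

Lemma integral_expabs w : 0 < w -> (\int[leb]_t (expabs w t)%:E = (2 / w)%:E)%E.
Proof.
move=> w0.
transitivity (\int[leb]_t (expabs w t * cst 1 t)%:E)%E.
  by apply: eq_integral => t _; rewrite mulr1.
rewrite integral_expabs_fold//; last exact: cst_continuous.
transitivity (\int[leb]_(t in `[0%R, +oo[) (2%:E * (expR (- (w * t)))%:E))%E.
  by apply: eq_integral => t _; rewrite -EFinM /=; congr EFin; ring.
rewrite ge0_integralZl ?integral0y_expR//=.
by apply/measurable_EFinP; exact: mexp.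
Qed.

Lemma integral_expabs_cos w b : 0 < w ->
  (\int[leb]_t (expabs w t * (1 + cos (b * t)))%:E = (2 / w + 2 * w / (w ^+ 2 + b ^+ 2))%:E)%E.
Proof.
move=> w0; rewrite integral_expabs_fold//; last first.
  move=> t; apply: differentiable_continuous; apply/derivable1_diffP.
  exact: ex_derive.
transitivity (\int[leb]_(t in `[0%R, +oo[) (2%:E * (expR (- (w * t)) * (1 + cos (b *
  t)))%:E))%E.
  by apply: eq_integral => t _; rewrite -EFinM mulrN cosN; congr EFin; ring.
rewrite ge0_integralZl//=; last first.
  by apply/measurable_EFinP; exact: mexp_cos.
by rewrite integral0y_expR_cos// -EFinM mulrDr mulrA.
Qed.

Lemma integral_expabs_sin w b : 0 < w ->
  (\int[leb]_t (expabs w t * (1 + sin (b * t)))%:E = (2 / w)%:E)%E.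
Proof.
move=> w0; rewrite integral_expabs_fold//; last first.
  move=> t; apply: differentiable_continuous; apply/derivable1_diffP.
  exact: ex_derive.
rewrite -integral_expabs//.
transitivity (\int[leb]_t (expabs w t * cst 1 t)%:E)%E; last first.
  by apply: eq_integral => t _; rewrite mulr1.
rewrite integral_expabs_fold//; last exact: cst_continuous.
apply: eq_integral => t _; congr ((_ * _)%:E); rewrite mulrN sinN /=; ring.
Qed.

Lemma integrable_expabs w (g : R -> R) : 0 < w -> continuous g ->
  (forall t, `|g t| <= 1) ->
  leb.-integrable setT (EFin \o (fun t => expabs w t * g t)).
Proof.
move=> w0 cg g1.
apply: (@le_integrable _ _ _ leb setT measurableT _ (EFin \o expabs w)).
- apply/measurable_EFinP; apply: continuous_measurable_fun => t.
  by apply: cvgM; [exact: continuous_expabs|exact: cg].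
- move=> t _; rewrite /= lee_fin normrM ger0_norm ?expR_ge0//.
  by apply: ler_piMr; rewrite ?expR_ge0.
- apply/integrableP; split.
    by apply/measurable_EFinP; apply: continuous_measurable_fun; exact: continuous_expabs.
  under eq_integral do rewrite /= ger0_norm ?expR_ge0//.
  by rewrite integral_expabs// ltry.
Qed.

Lemma cintegral_expabs_cis w b : 0 < w ->
  cintegrable leb setT (fun t => cis (b * t) * (expabs w t)%:C) /\
  cintegral leb setT (fun t => cis (b * t) * (expabs w t)%:C) =
  (2 * w / (w ^+ 2 + b ^+ 2))%:C.
Proof.
move=> w0.
have ccos : continuous (fun t => cos (b * t)).
  move=> t; apply: differentiable_continuous; apply/derivable1_diffP; exact: ex_derive.
have csin : continuous (fun t => sin (b * t)).
  move=> t; apply: differentiable_continuous; apply/derivable1_diffP; exact: ex_derive.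
have icos := integrable_expabs w0 ccos (fun t => eqbRL (ler_norml _ _) (introT andP (conj
  (cos_geN1 _) (cos_le1 _)))).
have isin := integrable_expabs w0 csin (fun t => eqbRL (ler_norml _ _) (introT andP (conj
  (sin_geN1 _) (sin_le1 _)))).
have i1 : leb.-integrable setT (EFin \o expabs w).
  have c1 : forall t : R, `|(cst 1 t : R)| <= 1 by move=> t; rewrite normr1.
  have := integrable_expabs w0 (@cst_continuous _ _ _) c1.
  by apply: eq_integrable => // t _; rewrite /= mulr1.
split.
  split.
    by apply: eq_integrable icos => // t _; rewrite /= mulr0 subr0 [in RHS]mulrC.
  by apply: eq_integrable isin => // t _; rewrite /= mulr0 add0r [in RHS]mulrC.
(* Undoes the shift by 1 that made the trigonometric integrands nonnegative. *)
have shift (h : R -> R) : leb.-integrable setT (EFin \o (fun t => expabs w t * h t)) ->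
    \int[leb]_t (expabs w t * h t) =
    fine (\int[leb]_t (expabs w t * (1 + h t))%:E)%E - fine (\int[leb]_t (expabs w t)%:E)%E.
  move=> ih; rewrite -[fine _]/(\int[leb]_t (expabs w t * (1 + h t))).
  under [X in X - _]eq_Rintegral do rewrite mulrDr mulr1.
  by rewrite RintegralD// addrC addrA addNr add0r.
apply: complexP => /=.
  under eq_Rintegral do rewrite mulr0 subr0 mulrC.
  by rewrite shift// integral_expabs_cos// integral_expabs//= addrC addKr.
under eq_Rintegral do rewrite mulr0 add0r mulrC.
by rewrite shift// integral_expabs_sin// integral_expabs//= subrr.
Qed.

(** The Fourier transform of [expabs w], that is, the value in [cintegral_expabs_cis] at [b] = 2 pi
    z up to sign: a Cauchy density, of total mass 1. *)
Definition poisson w z : R := 2 * w / (w ^+ 2 + (2 * pi * z) ^+ 2).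

Lemma poisson_ge0 w z : 0 < w -> 0 <= poisson w z.
Proof. by move=> w0; rewrite divr_ge0 ?mulr_ge0 ?addr_ge0 ?sqr_ge0// ltW. Qed.

Lemma continuous_poisson w : 0 < w -> continuous (poisson w).
Proof.
move=> w0 z; apply: differentiable_continuous; apply/derivable1_diffP.
have ? : w ^+ 2 + (2 * pi * z) ^+ 2 != 0 by rewrite gt_eqF// ltr_pwDl ?exprn_gt0 ?sqr_ge0.
apply: ex_derive.
Qed.

Lemma integral_poisson w z : 0 < w ->
  (\int[leb]_t (poisson w (t - z))%:E = 1%:E)%E.
Proof.
move=> w0.
transitivity (\int[leb]_t (poisson w t)%:E)%E.
  have dF1 (t : R) : is_derive t 1 (fun t => t - z) 1.
    by apply: is_derive_eq; rewrite subr0.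
  have dF2 : ((fun t => t - z)^`())%classic = cst 1.
    by apply/funext => t; rewrite derive1E; have [_ ->] := dF1 t.
  rewrite [RHS](@increasing_ge0_integration_by_substitutionT _ (fun t => t - z)).
  - by apply: eq_integral => t _; rewrite dF2/= fctE/= mulr1.
  - by move=> s t st; rewrite ltrD2r.
  - by rewrite dF2; exact: cst_continuous.
  - by rewrite dF2; exact: is_cvg_cst.
  - by rewrite dF2; exact: is_cvg_cst.
  - by move=> t; have [] := dF1 t.
  - exact: cvg_addrr_Ny.
  - exact: cvg_addrr.
  - exact: continuous_poisson.
  - by move=> t; exact: poisson_ge0.
rewrite ge0_integral_fold; last 2 first.
- by move=> t; exact: poisson_ge0.
- exact: continuous_poisson.
under eq_integral do rewrite {2}/poisson mulrN sqrrN -/(poisson w _).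
(* Folding the even kernel doubles it, so [G] is an antiderivative of twice the kernel; it rises
   from 0 to 1 on the half-line. *)
pose G t : R := 2 / pi * atan (2 * pi / w * t).
have dG t : is_derive t 1 G (poisson w t + poisson w t).
  rewrite /G; apply: is_derive_eq; rewrite /GRing.scale/= /poisson.
  have h1 : w ^+ 2 + (2 * pi * t) ^+ 2 != 0 by rewrite gt_eqF// ltr_pwDl ?exprn_gt0 ?sqr_ge0.
  have h2 : pi != 0 :> R by rewrite gt_eqF ?pi_gt0.
  have h3 : 1 + (2 * pi / w * t) ^+ 2 != 0 by rewrite gt_eqF// ltr_pwDl ?sqr_ge0.
  move: h1 h2 h3; move: (@pi R) => p h1 h2 h3.
  by field; rewrite ?h1 ?h2 ?h3 ?gt_eqF.
rewrite (@ge0_continuous_FTC2y _ _ G 0 1).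
- by rewrite /G mulr0 atan0 mulr0 sube0.
- by move=> x _; rewrite addr_ge0// poisson_ge0.
- apply: continuous_subspaceT => t.
  by apply: cvgD; exact: continuous_poisson.
- rewrite [X in _ --> X](_ : 1 = 2 / pi * (pi / 2)); last by rewrite mulrA divfK ?gt_eqF
  ?pi_gt0// divff.
  apply: cvgMr; apply: (@cvg_comp _ _ _ (fun t => 2 * pi / w * t) atan); last exact: cvgy_atan.
  by apply: gt0_cvgMry; [rewrite divr_gt0// mulr_gt0// pi_gt0|exact: cvg_id].
- by move=> t _; have [] := dG t.
- apply: cvg_at_right_filter; apply: differentiable_continuous.
  by apply/derivable1_diffP; have [] := dG 0.
- by move=> t _; rewrite derive1E; have [_ ->] := dG t.
Qed.

End one_dimensional_integrals.

(** * Lebesgue measure on R^d *)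

Section lebesgue_rV_theory.
Variable R : realType.
Local Notation leb := (@lebesgue_measure R).
Local Notation Leb d := (lebesgue_rV R d).

Lemma continuous_measurable_rVR d (f : 'rV[R]_d -> R) :
  continuous f -> measurable_fun setT f.
Proof.
move=> cf; apply: (measurability _ (RGenOpens.measurableE R)).
move=> _ [_ [a [b ->] <-]]; rewrite setTI; apply: open_measurable_rV.
by apply: open_comp => [v _|]; [exact: cf|exact: interval_open].
Qed.

Lemma measurable_coord d (i : 'I_d) :
  measurable_fun setT (fun x : 'rV[R]_d => x 0 i).
Proof. by apply: continuous_measurable_rVR; exact: coord_continuous. Qed.

Lemma compact_measurable_rV d (K : set 'rV[R]_d) : compact K -> measurable K.
Proof.
move=> /compact_closed-/(_ (@norm_hausdorff _ _)) cK.
by rewrite -[K]setCK; apply: measurableC; apply: open_measurable_rV; exact: closed_openC.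
Qed.

Lemma measurable_sumR dd (T : measurableType dd) (I : Type) (s : seq I)
    (F : I -> T -> R) : (forall i, measurable_fun setT (F i)) ->
  measurable_fun setT (fun x => \sum_(i <- s) F i x).
Proof.
move=> mF; elim: s => [|i s ih].
  by under eq_fun do rewrite big_nil; exact: measurable_cst.
by under eq_fun do rewrite big_cons; exact: measurable_funD.
Qed.

Lemma cmeasurable_prod dd (T : measurableType dd) (I : Type) (s : seq I)
    (F : I -> T -> R[i]) : (forall i, cmeasurable_fun setT (F i)) ->
  cmeasurable_fun setT (fun x => \prod_(i <- s) F i x).
Proof.
move=> mF; elim: s => [|i s ih].
  by under eq_fun do rewrite big_nil; exact: cmeasurable_cst.
by under eq_fun do rewrite big_cons; exact: cmeasurableM.
Qed.

Lemma cmeasurable_comp d1 d2 (T1 : measurableType d1) (T2 : measurableType d2)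
    (g : T1 -> T2) (f : T2 -> R[i]) : measurable_fun setT g ->
  cmeasurable_fun setT f -> cmeasurable_fun setT (fun x => f (g x)).
Proof.
by move=> mg [f1 f2]; split; [exact: (measurableT_comp f1 mg)|exact: (measurableT_comp f2 mg)].
Qed.

Lemma measurable_dotp d dd (T : measurableType dd) (f g : T -> 'rV[R]_d) :
  measurable_fun setT f -> measurable_fun setT g ->
  measurable_fun setT (fun x => dotp (f x) (g x)).
Proof.
move=> mf mg; apply: measurable_sumR => i.
by apply: measurable_funM; [exact: (measurableT_comp (measurable_coord i) mf)
  |exact: (measurableT_comp (measurable_coord i) mg)].
Qed.

Lemma cmeasurable_cis dd (T : measurableType dd) (h : T -> R) :
  measurable_fun setT h -> cmeasurable_fun setT (fun x => cis (h x)).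
Proof.
move=> mh; split => /=.
  apply: (@measurableT_comp _ _ _ _ _ _ (@cos R)) => //.
  exact: continuous_measurable_fun (@continuous_cos R).
apply: (@measurableT_comp _ _ _ _ _ _ (@sin R)) => //.
exact: continuous_measurable_fun (@continuous_sin R).
Qed.

Lemma cons_rV0 d (z : R * 'rV[R]_d) : cons_rV z 0 ord0 = z.1.
Proof. by rewrite /cons_rV mxE; case: splitP => k // _; rewrite [k]ord1 mxE. Qed.

Lemma cons_rV_lift d (z : R * 'rV[R]_d) i : cons_rV z 0 (lift ord0 i) = z.2 0 i.
Proof.
rewrite /cons_rV !mxE; case: splitP => [k|k]; first by rewrite ord1.
by rewrite /= /bump /= !add1n => -[ik]; congr (z.2 _ _); apply/val_inj.
Qed.

Lemma cintegral_cons d (f : 'rV[R]_d.+1 -> R[i]) :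
  cmeasurable_fun setT f ->
  cintegrable (leb \x Leb d)%E setT (fun z => f (cons_rV z)) ->
  cintegrable (Leb d.+1) setT f /\
  cintegral (Leb d.+1) setT f = cintegral (leb \x Leb d)%E setT (fun z => f (cons_rV z)).
Proof.
move=> [mf1 mf2] [f1 f2].
have mc := @cons_rV_measurable R d.
split.
  split; apply: (@integrable_pushforward _ _ _ _ _ _ mc (leb \x Leb d)%E setT) => //;
    exact/measurable_EFinP.
have E (g : 'rV[R]_d.+1 -> R) : measurable_fun setT g ->
    (leb \x Leb d)%E.-integrable setT (fun z => (g (cons_rV z))%:E) ->
    (\int[Leb d.+1]_x (g x)%:E = \int[(leb \x Leb d)%E]_z (g (cons_rV z))%:E)%E.
  move=> /measurable_EFinP mg ig.
  exact: (@integral_pushforward _ _ _ _ _ _ mc (leb \x Leb d)%E setT (EFin \o g)).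
by rewrite /cintegral /Rintegral (E _ mf1 f1) (E _ mf2 f2).
Qed.

Lemma cintegral_tensor d1 d2 (T1 : measurableType d1) (T2 : measurableType d2)
    (m1 : {sigma_finite_measure set T1 -> \bar R})
    (m2 : {sigma_finite_measure set T2 -> \bar R}) (f : T1 -> R[i]) (g : T2 -> R[i]) :
  cintegrable m1 setT f -> cintegrable m2 setT g ->
  cintegrable (m1 \x m2)%E setT (fun z => f z.1 * g z.2) /\
  cintegral (m1 \x m2)%E setT (fun z => f z.1 * g z.2) =
  cintegral m1 setT f * cintegral m2 setT g.
Proof.
move=> fi gi.
have mf := cintegrable_meas fi; have mg := cintegrable_meas gi.
have fgi : cintegrable (m1 \x m2)%E setT (fun z => f z.1 * g z.2).
  apply: (@le_cintegrable _ _ _ _ _ _ (fun z => normc (f z.1) * normc (g z.2))) => //.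
  - apply: cmeasurableM.
      by apply: (cmeasurable_comp (g := fst)).
    by apply: (cmeasurable_comp (g := snd)).
  - by move=> z _; rewrite Normc.normcM.
  - by apply: (@integrable_tensor _ _ _ _ _ m1 m2 (fun x => normc (f x)) (fun x =>
    normc (g x))); exact: cintegrable_normc.
split => //; rewrite cintegral_prod//=; last by move=> x; exact: cintegrableZl.
under eq_cintegral do rewrite cintegralZl// mulrC.
by rewrite cintegralZl// mulrC.
Qed.

(** Fubini's theorem, by induction on the dimension. In dimension 0 the measure is a Dirac mass and
    both sides are 1. *)
Lemma cintegral_prod_rV d (h : 'I_d -> R -> R[i]) :
  (forall i, cintegrable leb setT (h i)) ->
  cintegrable (Leb d) setT (fun x => \prod_i h i (x 0 i)) /\
  cintegral (Leb d) setT (fun x => \prod_i h i (x 0 i)) =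
  \prod_i cintegral leb setT (h i).
Proof.
elim: d h => [|d ih] h hi.
  have -> : (fun x : 'rV[R]_0 => \prod_i h i (x 0 i)) = (fun=> 1).
    by apply/funext => x; rewrite big_ord0.
  split.
    by split; exact: (finite_measure_integrable_cst (\d_(0 : 'rV[R]_0))).
  rewrite [RHS]big_ord0 /cintegral !Rintegral_cst//=.
  by rewrite /dirac indicE mem_set//= mulr1 mul0r.
have [i1 i2] := ih _ (fun i => hi (lift ord0 i)).
have [j1 j2] := cintegral_tensor (hi ord0) i1.
have E : (fun z : R * 'rV[R]_d => \prod_i h i (cons_rV z 0 i)) =
  (fun z => h ord0 z.1 * \prod_i h (lift ord0 i) (z.2 0 i)).
  apply/funext => z; rewrite big_ord_recl cons_rV0; congr (_ * _).
  by apply: eq_bigr => i _; rewrite cons_rV_lift.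
have m : cmeasurable_fun setT (fun x : 'rV[R]_d.+1 => \prod_i h i (x 0 i)).
  apply: cmeasurable_prod => i; apply: (cmeasurable_comp (measurable_coord i)).
  exact: (cintegrable_meas (hi i)).
have [] := cintegral_cons m; first by rewrite E.
by rewrite E big_ord_recl j2 i2.
Qed.

Definition cube d (M : R) : set 'rV[R]_d := [set x | forall i, `|x 0 i| <= M].

Lemma cube_closed d M : closed (@cube d M).
Proof.
rewrite (_ : cube M = \bigcap_(i in [set: 'I_d]) [set x : 'rV[R]_d | `|x 0 i| <= M]);
  last first.
  by apply/seteqP; split => x h i //=; exact: h.
apply: closed_bigI => i _.
apply: (@closed_comp _ _ (fun x : 'rV[R]_d => `|x 0 i|) [set y | y <= M]);
  last exact: closed_le.
move=> x _; apply: (@continuous_comp _ _ _ (fun x : 'rV[R]_d => x 0 i)).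
  exact: coord_continuous.
exact: norm_continuous.
Qed.

Lemma cube_measurable d M : measurable (@cube d M).
Proof. by rewrite -[cube M]setCK; apply: measurableC; apply: open_measurable_rV;
  exact: closed_openC (@cube_closed _ _). Qed.

Lemma cube_fin d M : (Leb d (cube M) < +oo)%E.
Proof.
(* The indicator of the cube is the product of these one-dimensional indicators, so its
   integrability is the finiteness of the volume. *)
pose h (i : 'I_d) (t : R) : R[i] := (\1_(`[- M, M] : set R) t)%:C.
have hi i : cintegrable leb setT (h i).
  split; last exact: integrable0.
  exact: integrable_indic_itv.
have [[/integrableP[_]]] := cintegral_prod_rV hi.
rewrite (_ : (fun x => _) = EFin \o (\1_(cube M) : 'rV[R]_d -> R)); last first.
  apply/funext => x /=; congr EFin.
  have -> : \prod_i h i (x 0 i) = (\prod_i (\1_(`[- M, M] : set R) (x 0 i) : R))%:C.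
    by rewrite rmorph_prod.
  rewrite /= indicE; have [xM|xM] := boolP (x \in _).
    move: xM; rewrite inE => xM.
    by rewrite big1 ?normr1// => i _; rewrite indicE mem_set// /= in_itv/= -ler_norml.
  apply/eqP; rewrite normr_eq0 prodf_seq_eq0; apply/hasP.
  move: xM; rewrite notin_setE => /existsNP[i iM]; exists i; rewrite ?mem_index_enum//=.
  by rewrite indicE memNset// /= in_itv/= -ler_norml.
by rewrite integral_indic ?setIT//; exact: cube_measurable.
Qed.

Lemma compact_sub_cube d (K : set 'rV[R]_d) : compact K -> exists M, 0 <= M /\ K `<=` cube M.
Proof.
move=> /compact_bounded[M [Mr KM]]; exists (`|M| + 1); split; first by rewrite addr_ge0.
move=> x Kx i; have := KM (`|M| + 1); rewrite (le_lt_trans (ler_norm _)) ?ltrDl//.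
move=> /(_ isT x Kx); apply: le_trans.
by rewrite [leRHS]/Num.norm/= mx_normrE; apply/bigmax_geP; right => /=; exists (0, i).
Qed.

End lebesgue_rV_theory.

(** * Fourier transforms and a damped Bessel inequality *)

Section fourier_theory.
Variables (R : realType) (d : nat).
Local Notation leb := (@lebesgue_measure R).
Local Notation Leb := (lebesgue_rV R d).
Local Notation L1 := (cintegrable Leb setT).
Implicit Types (F G a : 'rV[R]_d -> R[i]) (x xi : 'rV[R]_d) (w : R).

Lemma conjcM (z w : R[i]) : conjc (z * w) = conjc z * conjc w.
Proof. exact: rmorphM. Qed.

Lemma RcM (x y : R) : (x * y)%:C = x%:C * y%:C.
Proof. exact: rmorphM. Qed.

Lemma le_EFin_fine (x : \bar R) : (0 <= x -> (fine x)%:E <= x)%E.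
Proof. by case: x => [r| |] //= _; rewrite leey. Qed.

Lemma measurable_comp_coord (h : R -> R) (i : 'I_d) : continuous h ->
  measurable_fun setT (fun x : 'rV[R]_d => h (x 0 i)).
Proof.
move=> /continuous_measurable_fun mh.
exact: (measurableT_comp mh (measurable_coord i)).
Qed.

Lemma dotpC x xi : dotp x xi = dotp xi x.
Proof. by apply: eq_bigr => i _; rewrite mulrC. Qed.

Definition phase x xi : R[i] := cis (- (2 * pi * dotp x xi)).

Lemma phaseC x xi : phase x xi = phase xi x.
Proof. by rewrite /phase dotpC. Qed.

Lemma cmeasurable_phase :
  cmeasurable_fun setT (fun z : 'rV[R]_d * 'rV[R]_d => phase z.1 z.2).
Proof.
apply: cmeasurable_cis; apply: measurable_funN; apply: measurable_funM => //.
exact: measurable_dotp.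
Qed.

Lemma cmeasurable_phase1 xi : cmeasurable_fun setT (fun x => phase x xi).
Proof.
apply: cmeasurable_cis; apply: measurable_funN; apply: measurable_funM => //.
exact: measurable_dotp.
Qed.

Lemma L1_phase F xi : L1 F -> L1 (fun x => phase x xi * F x).
Proof.
move=> iF; apply: (@le_cintegrable _ _ _ _ _ _ (fun x => normc (F x))) => //.
- exact: cmeasurableM (cmeasurable_phase1 _) (cintegrable_meas iF).
- by move=> x _; rewrite Normc.normcM normc_cis mul1r.
- exact: cintegrable_normc.
Qed.

Lemma integrable_phase2 F G : L1 F -> L1 G ->
  cintegrable (Leb \x Leb)%E setT (fun z => phase z.1 z.2 * (F z.1 * G z.2)).
Proof.
move=> iF iG.
apply: (@le_cintegrable _ _ _ _ _ _ (fun z => normc (F z.1) * normc (G z.2))) => //.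
- apply: cmeasurableM cmeasurable_phase _; apply: cmeasurableM.
    by apply: (cmeasurable_comp (g := fst)) => //; exact: (cintegrable_meas iF).
  by apply: (cmeasurable_comp (g := snd)) => //; exact: (cintegrable_meas iG).
- by move=> z _; rewrite !Normc.normcM normc_cis mul1r.
- by apply: (@integrable_tensor _ _ _ _ _ Leb Leb (fun x => normc (F x)) (fun x =>
  normc (G x)));
    exact: cintegrable_normc.
Qed.

Lemma fourier_normc F xi : L1 F -> normc (fourier F xi) <= \int[Leb]_x normc (F x).
Proof.
move=> iF; apply: le_trans (cintegral_normc measurableT (L1_phase xi iF)) _.
rewrite le_eqVlt; apply/orP; left; apply/eqP; apply: eq_Rintegral => x _.
by rewrite Normc.normcM normc_cis mul1r.
Qed.

Lemma fourierZl (c : R[i]) F xi : L1 F ->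
  c * fourier F xi = cintegral Leb setT (fun x => phase x xi * (c * F x)).
Proof.
move=> iF; rewrite -(cintegralZl c measurableT (L1_phase xi iF)).
by apply: eq_cintegral => x _; rewrite mulrCA.
Qed.

(** The multiplication formula. The kernel has modulus 1 and is symmetric, so the double integrand
    is dominated by a tensor product and Fubini's theorem applies. *)
Lemma fourier_swap F G : L1 F -> L1 G ->
  cintegral Leb setT (fun xi => fourier F xi * G xi) =
  cintegral Leb setT (fun x => F x * fourier G x).
Proof.
move=> iF iG; have i2 := integrable_phase2 iF iG.
have i1 x : L1 (fun xi => phase x xi * (F x * G xi)).
  apply: (eq_cintegrable (g := fun xi => F x * (phase xi x * G xi))).
    by move=> xi; rewrite phaseC mulrCA.
  by apply: cintegrableZl => //; exact: L1_phase.
have i3 xi : L1 (fun x => phase x xi * (F x * G xi)).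
  apply: (eq_cintegrable (g := fun x => G xi * (phase x xi * F x))).
    by move=> x; rewrite [F _ * _]mulrC mulrCA.
  by apply: cintegrableZl => //; exact: L1_phase.
have E : cintegral Leb setT (fun x => cintegral Leb setT (fun xi =>
  phase x xi * (F x * G xi))) =
  cintegral Leb setT (fun xi => cintegral Leb setT (fun x =>
    phase x xi * (F x * G xi))) := cintegral_swap i2 i1 i3.
transitivity (cintegral Leb setT (fun xi => cintegral Leb setT (fun x =>
  phase x xi * (F x * G xi)))).
  apply: eq_cintegral => xi _.
  rewrite mulrC (fourierZl _ _ iF); apply: eq_cintegral => x _.
  by rewrite [F _ * _]mulrC.
apply: etrans (esym E) _; apply: eq_cintegral => x _; rewrite (fourierZl _ _ iG).
by apply: eq_cintegral => xi _; rewrite phaseC.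
Qed.

Definition expabsv w x : R := \prod_i expabs w (x 0 i).

Lemma expabsv_gt0 w x : 0 < expabsv w x.
Proof. by apply: prodr_gt0 => i _; exact: expR_gt0. Qed.

Definition poissonv w x : R := \prod_i poisson w (x 0 i).

Lemma poissonv_ge0 w x : 0 < w -> 0 <= poissonv w x.
Proof. by move=> w0; apply: prodr_ge0 => i _; exact: poisson_ge0. Qed.

Lemma cis_sum (I : Type) (s : seq I) (f : I -> R) :
  cis (\sum_(i <- s) f i) = \prod_(i <- s) cis (f i).
Proof.
elim: s => [|i s ih]; last by rewrite !big_cons cisD ih.
by rewrite !big_nil /cis cos0 sin0.
Qed.

Lemma fourier_expabsv w xi : 0 < w ->
  L1 (fun x => (expabsv w x)%:C) /\
  fourier (fun x => (expabsv w x)%:C) xi = (poissonv w xi)%:C.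
Proof.
move=> w0.
have E z : (fun x => phase x z * (expabsv w x)%:C) =
    (fun x => \prod_i (cis (- (2 * pi * z 0 i) * x 0 i) * (expabs w (x 0 i))%:C)).
  apply/funext => x; rewrite big_split/= -cis_sum /expabsv rmorph_prod/=.
  rewrite /phase /dotp mulr_sumr -sumrN; congr (cis _ * _).
  by apply: eq_bigr => i _; ring.
have hi (z : 'rV[R]_d) (i : 'I_d) := (cintegral_expabs_cis (- (2 * pi * z 0 i)) w0).1.
have hE (z : 'rV[R]_d) (i : 'I_d) := (cintegral_expabs_cis (- (2 * pi * z 0 i)) w0).2.
have main z := cintegral_prod_rV (hi z).
split.
  have := (main 0).1; rewrite -E; congr cintegrable; apply/funext => x.
  rewrite /phase (_ : dotp x 0 = 0) ?mulr0 ?oppr0 /cis ?cos0 ?sin0 ?mul1r//.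
  by rewrite /dotp big1// => i _; rewrite mxE mulr0.
rewrite /fourier -[X in cintegral _ _ X]/(fun x => phase x xi * (expabsv w x)%:C).
rewrite E (main xi).2 /poissonv rmorph_prod; apply: eq_bigr => i _.
by rewrite hE /poisson sqrrN.
Qed.

Lemma measurable_expabsv w : measurable_fun setT (expabsv w).
Proof.
apply: measurable_prod => i _; apply: measurable_comp_coord.
exact: continuous_expabs.
Qed.

(** Fubini's theorem gives measurability of partial integrals only for functions integrable on the
    product. The factor [expabsv 1] provides this integrability and is divided out afterwards, being
    positive. *)
Lemma fourier_cmeasurable G : L1 G -> cmeasurable_fun setT (fourier G).
Proof.
move=> iG.
have [ie _] := @fourier_expabsv 1 0 ltr01.
have [i1 i2] := integrable_phase2 ie iG.
have m1 := measurable_fubini_F i1; have m2 := measurable_fubini_F i2.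
have E x : cintegral Leb setT (fun xi => phase x xi * ((expabsv 1 x)%:C * G xi)) =
    (expabsv 1 x)%:C * fourier G x.
  by rewrite (fourierZl _ _ iG); apply: eq_cintegral => xi _; rewrite phaseC.
have -> : fourier G = (fun x => (expabsv 1 x)^-1%:C * cintegral Leb setT (fun xi =>
  phase x xi * ((expabsv 1 x)%:C * G xi))).
  apply/funext => x; rewrite E mulrA -rmorphM/= mulVf ?mul1r//.
  by rewrite gt_eqF// expabsv_gt0.
apply: cmeasurableM.
  apply: cmeasurable_real; apply: (eq_measurable_fun (fun x => \prod_i expR (`|x 0 i|))).
    by move=> x _; rewrite /expabsv -prodfV; apply: eq_bigr => i _;
      rewrite /expabs mul1r expRN invrK.
  apply: measurable_prod => i _; apply: (measurable_comp_coord (h := fun t => expR `|t|)) => t.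
  apply: (@continuous_comp _ _ _ (fun t : R => `|t|)); first exact: norm_continuous.
  exact: continuous_expR.
have mfine : measurable_fun setT (@fine R) by [].
by split; [exact: (measurableT_comp mfine m1)|exact: (measurableT_comp mfine m2)].
Qed.

(** Modulation becomes translation, so the Poisson kernel centred at any [x] is itself a Fourier
    transform and [fourier_swap] applies to it. *)
Lemma L1_shifted_expabsv w x : 0 < w ->
  let G := fun xi => phase (- x) xi * (expabsv w xi)%:C in
  L1 G /\ forall y, fourier G y = (poissonv w (y - x))%:C.
Proof.
move=> w0 G; have [ie _] := fourier_expabsv 0 w0; split.
  by apply: eq_cintegrable (L1_phase (- x) ie) => xi; rewrite /G phaseC.
move=> y; rewrite -(fourier_expabsv (y - x) w0).2; apply: eq_cintegral => xi _.
rewrite -[cis _]/(phase _ _) -[RHS]/(phase _ _ * _) /G mulrA; congr (_ * _).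
rewrite /phase -cisD; congr cis; rewrite -opprD -mulrDr; congr (- (_ * _)).
rewrite /dotp -big_split; apply: eq_bigr => i _ /=; rewrite !mxE; ring.
Qed.

Lemma integral_poissonv w y : 0 < w ->
  (\int[Leb]_x (poissonv w (x - y))%:E = 1)%E.
Proof.
move=> w0.
pose h (i : 'I_d) (t : R) : R[i] := (poisson w (t - y 0 i))%:C.
have cp z : continuous (fun t => poisson w (t - z)).
  move=> t; apply: (@continuous_comp _ _ _ (fun t => t - z)); last exact: continuous_poisson.
  by apply: cvgB; [exact: cvg_id|exact: cvg_cst].
have ip z : leb.-integrable setT (EFin \o (fun t => poisson w (t - z))).
  apply/integrableP; split.
    by apply/measurable_EFinP; apply: continuous_measurable_fun; exact: cp.
  under eq_integral do rewrite /= ger0_norm ?poisson_ge0//.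
  by rewrite integral_poisson// ltry.
have hi i : cintegrable leb setT (h i) by split; [exact: ip|exact: integrable0].
have hE i : cintegral leb setT (h i) = 1.
  rewrite /cintegral /h/= /Rintegral integral_poisson//=.
  by rewrite integral0.
have [[i1 _] /(congr1 (@complex.Re R))] := cintegral_prod_rV hi.
rewrite (eq_bigr (fun=> 1)) ?big1//= => <-.
have E : (fun x => complex.Re (\prod_i h i (x 0 i))) = (fun x => poissonv w (x - y)).
  apply/funext => x; rewrite /poissonv /h -rmorph_prod/=.
  by apply: eq_bigr => i _; rewrite !mxE.
have i2 : Leb.-integrable setT (EFin \o (fun x => poissonv w (x - y))).
  by rewrite -E.
rewrite E /Rintegral fineK; first by [].
by apply: integrable_fin_num => //; exact: i2.
Qed.

Lemma poissonvN w x : poissonv w (- x) = poissonv w x.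
Proof. by apply: eq_bigr => i _; rewrite !mxE /poisson mulrN sqrrN. Qed.

(* Schur's test for the kernel poissonv w, which is positive with integral 1. *)
Lemma bessel w a : 0 < w -> L1 a ->
  (\int[Leb]_xi (normc (fourier a xi) ^+ 2 * expabsv w xi)%:E <=
   \int[Leb]_x (normc (a x) ^+ 2)%:E)%E.
Proof.
move=> w0 ia.
have ma := cintegrable_meas ia; have mna := cmeasurable_normc ma.
have mfa := fourier_cmeasurable ia.
have [ie _] := fourier_expabsv 0 w0.
(* With this [h] the integrand on the left is [fourier a xi * h xi], and the multiplication formula
   turns its integral into that of [a x * fourier h x]. *)
pose h xi := (expabsv w xi)%:C * conjc (fourier a xi).
have ih : L1 h.
  apply: (@le_cintegrable _ _ _ _ _ _ (fun xi => (\int[Leb]_x normc (a x)) * expabsv w xi)) =>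
    //.
  - apply: cmeasurableM; last exact: cmeasurable_conj.
    by apply: cmeasurable_real; exact: measurable_expabsv.
  - move=> x _; rewrite Normc.normcM normc_conj normc_real gtr0_norm ?expabsv_gt0// mulrC.
    by rewrite ler_pM2r ?expabsv_gt0// fourier_normc.
  - by have := integrableZl measurableT (\int[Leb]_x normc (a x)) ie.1.
(* The conjugate of [fourier h x] is the integral of [fourier a] against the modulated exponential;
   moving the transform to the exponential gives a Poisson integral of [a]. *)
have hE x : normc (fourier h x) <= \int[Leb]_y (normc (a y) * poissonv w (y - x)).
  have [iG GE] := L1_shifted_expabsv x w0.
  have -> : normc (fourier h x) = normc (cintegral Leb setT (fun y =>
    a y * (poissonv w (y - x))%:C)).
    rewrite -normc_conj; congr normc.
    under [RHS]eq_cintegral do rewrite -GE.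
    rewrite -fourier_swap//; case: (cintegral_conj Leb (fun xi =>
      cis (- (2 * pi * dotp xi x)) * h xi)) => [<-|/(_ (L1_phase _ ih))//].
    apply: eq_cintegral => xi _; rewrite /h !conjcM conjcK conj_cis opprK conjc_real.
    rewrite [LHS]mulrA [LHS]mulrC; congr (_ * (_ * _)).
    rewrite /phase; congr cis; rewrite -mulrN; congr (_ * _).
    by rewrite /dotp -sumrN; apply: eq_bigr => i _; rewrite !mxE; ring.
  have [iG' GE'] := L1_shifted_expabsv x w0.
  have ig : L1 (fun y => a y * (poissonv w (y - x))%:C).
    have bd y : normc (poissonv w (y - x))%:C <= \int[Leb]_x (expabsv w x).
      rewrite -GE; apply: le_trans (fourier_normc _ iG) _.
      rewrite le_eqVlt; apply/orP; left; apply/eqP; apply: eq_Rintegral => xi _.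
      by rewrite Normc.normcM normc_cis mul1r normc_real gtr0_norm// expabsv_gt0.
    apply: (@le_cintegrable _ _ _ _ _ _ (fun y => (\int[Leb]_x expabsv w x) * normc (a y))) =>
      //.
    - apply: cmeasurableM => //; have := fourier_cmeasurable iG.
      by apply: eq_cmeasurable => y; rewrite GE.
    - move=> y _; rewrite Normc.normcM mulrC ler_wpM2r ?normc_ge0//.
    - by have := integrableZl measurableT (\int[Leb]_x expabsv w x) (cintegrable_normc
      measurableT ia).
  apply: le_trans (cintegral_normc measurableT ig) _.
  rewrite le_eqVlt; apply/orP; left; apply/eqP; apply: eq_Rintegral => y _.
  by rewrite Normc.normcM normc_real ger0_norm// poissonv_ge0.
have mp : measurable_fun setT (fun z : 'rV[R]_d * 'rV[R]_d => poissonv w (z.2 - z.1)).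
  rewrite /poissonv; apply: measurable_prod => i _.
  apply: (eq_measurable (h' := fun z : 'rV[R]_d * 'rV[R]_d => poisson w (z.2 0 i - z.1 0 i))).
    by move=> z; rewrite !mxE.
  apply: (@measurableT_comp _ _ _ _ _ _ (poisson w)).
    by apply: continuous_measurable_fun; exact: continuous_poisson.
  by apply: measurable_funB; apply: (measurableT_comp (measurable_coord i)).
have iah : L1 (fun x => a x * fourier h x).
  apply: (@le_cintegrable _ _ _ _ _ _ (fun y => (\int[Leb]_x normc (h x)) * normc (a y))) => //.
  - by apply: cmeasurableM; [exact: ma|exact: fourier_cmeasurable].
  - by move=> y _; rewrite Normc.normcM mulrC ler_wpM2r ?normc_ge0// fourier_normc.
  - by have := integrableZl measurableT (\int[Leb]_x normc (h x)) (cintegrable_normc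
    measurableT ia).
have ifah : L1 (fun xi => fourier a xi * h xi).
  apply: (@le_cintegrable _ _ _ _ _ _ (fun y => (\int[Leb]_x normc (a x)) * normc (h y))) => //.
  - by apply: cmeasurableM; [exact: mfa|exact: (cintegrable_meas ih)].
  - by move=> y _; rewrite Normc.normcM ler_wpM2r ?normc_ge0// fourier_normc.
  - by have := integrableZl measurableT (\int[Leb]_x normc (a x)) (cintegrable_normc
    measurableT ih).
have E1 : (fun xi => fourier a xi * h xi) = (fun xi => (normc (fourier a xi) ^+ 2 * expabsv w
  xi)%:C).
  by apply/funext => xi; rewrite /h RcM -mulc_conj mulrCA [RHS]mulrC [conjc _ * _]mulrC.
have L : (\int[Leb]_xi (normc (fourier a xi) ^+ 2 * expabsv w xi)%:E =
   (complex.Re (cintegral Leb setT (fun x => a x * fourier h x)))%:E)%E.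
  rewrite -fourier_swap// E1 /cintegral /= /Rintegral fineK//.
  by apply: integrable_fin_num => //; move: ifah; rewrite E1 => -[].
rewrite L.
apply: (@le_trans _ _ (\int[Leb]_x (normc (a x) * normc (fourier h x))%:E)%E).
  have := le_trans (le_trans (ler_norm _) (normc_Re _)) (cintegral_normc measurableT iah).
  rewrite -lee_fin => /le_trans; apply; rewrite /Rintegral fineK; last first.
    by apply: integrable_fin_num => //; exact: (cintegrable_normc measurableT iah).
  by under eq_integral do rewrite Normc.normcM.
have mh1 : measurable_fun setT (fun z : 'rV[R]_d * 'rV[R]_d =>
  (normc (a z.1) ^+ 2 / 2 * poissonv w (z.2 - z.1))%:E).
  apply/measurable_EFinP; apply: measurable_funM => //.
  apply: measurable_funM => //; apply: measurable_funX.
  exact: (measurableT_comp mna measurable_fst).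
have mh2 : measurable_fun setT (fun z : 'rV[R]_d * 'rV[R]_d =>
  (normc (a z.2) ^+ 2 / 2 * poissonv w (z.2 - z.1))%:E).
  apply/measurable_EFinP; apply: measurable_funM => //.
  apply: measurable_funM => //; apply: measurable_funX.
  exact: (measurableT_comp mna measurable_snd).
have p0 x y : 0 <= poissonv w (y - x) by exact: poissonv_ge0.
have n20 x : 0 <= normc (a x) ^+ 2 / 2 by rewrite divr_ge0// sqr_ge0.
have t1 (z : 'rV[R]_d * 'rV[R]_d) : (0 <= (normc (a z.1) ^+ 2 / 2 * poissonv w (z.2 -
  z.1))%:E)%E.
  by rewrite lee_fin mulr_ge0.
have t2 (z : 'rV[R]_d * 'rV[R]_d) : (0 <= (normc (a z.2) ^+ 2 / 2 * poissonv w (z.2 -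
  z.1))%:E)%E.
  by rewrite lee_fin mulr_ge0.
have mp2 x : measurable_fun setT (fun y : 'rV[R]_d => (poissonv w (y - x))%:E).
  apply/measurable_EFinP.
  exact: (measurableT_comp mp (measurable_pair1 x)).
have rp2 x : measurable_fun setT (fun y : 'rV[R]_d => poissonv w (y - x)).
  exact: (measurableT_comp mp (measurable_pair1 x)).
have mp1 x : measurable_fun setT (fun y : 'rV[R]_d => (poissonv w (x - y))%:E).
  apply/measurable_EFinP.
  exact: (measurableT_comp mp (measurable_pair2 x)).
(* Schur's test: |a(x)| |a(y)| is at most half the sum of the squares. Each half keeps one variable
   free, and the kernel integrates to 1 in the other. *)
apply: (@le_trans _ _ (\int[Leb]_x (\int[Leb]_y (normc (a x) ^+ 2 / 2 * poissonv w (y - x))%:E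
   + \int[Leb]_y (normc (a y) ^+ 2 / 2 * poissonv w (y - x))%:E))%E).
  apply: ge0_le_integral => //.
  - by move=> x _; rewrite lee_fin mulr_ge0 ?normc_ge0.
  - apply/measurable_EFinP; apply: measurable_funM => //.
    exact: cmeasurable_normc (fourier_cmeasurable ih).
  - apply: emeasurable_funD.
      exact: (measurable_fun_fubini_tonelli_F _ mh1 t1).
    exact: (measurable_fun_fubini_tonelli_F _ mh2 t2).
  - move=> x _.
    have my : measurable_fun setT (fun y : 'rV[R]_d => (normc (a y) ^+ 2 / 2 * poissonv w (y -
      x))%:E).
      exact: (measurableT_comp mh2 (measurable_pair1 x)).
    rewrite -ge0_integralD; last 5 first.
    - exact: measurableT.
    - by move=> y _; rewrite lee_fin mulr_ge0.
    - exact: (measurableT_comp mh1 (measurable_pair1 x)).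
    - by move=> y _; rewrite lee_fin mulr_ge0.
    - exact: my.
    apply: (@le_trans _ _ (normc (a x) * \int[Leb]_y (normc (a y) * poissonv w (y - x)))%:E).
      by rewrite lee_fin ler_wpM2l ?normc_ge0// hE.
    have i0 : (0 <= \int[Leb]_y (normc (a y) * poissonv w (y - x))%:E)%E.
      by apply: integral_ge0 => y _; rewrite lee_fin mulr_ge0 ?normc_ge0.
    rewrite EFinM; apply: (@le_trans _ _ ((normc (a x))%:E * \int[Leb]_y (normc (a y) *
      poissonv w (y - x))%:E)%E).
      apply: lee_wpmul2l; first by rewrite lee_fin normc_ge0.
      exact: le_EFin_fine.
    rewrite -ge0_integralZl_EFin//; last 3 first.
    - by move=> y _; rewrite lee_fin mulr_ge0 ?normc_ge0.
    - by apply/measurable_EFinP; apply: measurable_funM; [exact: mna|exact: rp2].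
    - exact: normc_ge0.
    apply: ge0_le_integral => //.
    - by move=> y _; rewrite -EFinM lee_fin !mulr_ge0 ?normc_ge0.
    - by apply: measurable_funeM; apply/measurable_EFinP; apply: measurable_funM;
      [exact: mna|exact: rp2].
    - apply: emeasurable_funD; last exact: my.
      exact: (measurableT_comp mh1 (measurable_pair1 x)).
    - move=> y _; rewrite -EFinD -EFinM lee_fin mulrA -mulrDl ler_wpM2r//.
      by have := sqr_ge0 (normc (a x) - normc (a y)); nra.
rewrite ge0_integralD; last 5 first.
- exact: measurableT.
- by move=> x _; apply: integral_ge0 => y _; rewrite lee_fin mulr_ge0.
- exact: (measurable_fun_fubini_tonelli_F _ mh1 t1).
- by move=> x _; apply: integral_ge0 => y _; rewrite lee_fin mulr_ge0.
- exact: (measurable_fun_fubini_tonelli_F _ mh2 t2).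
rewrite [X in (_ + X)%E](fubini_tonelli _ mh2 t2)/=.
have half : (\int[Leb]_x (normc (a x) ^+ 2 / 2)%:E = (2^-1 : R)%:E * \int[Leb]_x (normc (a x)
  ^+ 2)%:E)%E.
  rewrite -ge0_integralZl_EFin//.
  - by apply: eq_integral => x _; rewrite -EFinM mulrC.
  - by move=> x _; rewrite lee_fin sqr_ge0.
  - by apply/measurable_EFinP; apply: measurable_funX.
have -> : (\int[Leb]_x \int[Leb]_y (normc (a x) ^+ 2 / 2 * poissonv w (y - x))%:E =
  \int[Leb]_x (normc (a x) ^+ 2 / 2)%:E)%E.
  apply: eq_integral => x _; under eq_integral do rewrite EFinM.
  rewrite ge0_integralZl_EFin//; first by rewrite integral_poissonv// mule1.
  by move=> y _; rewrite lee_fin.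
have -> : (\int[Leb]_y \int[Leb]_x (normc (a y) ^+ 2 / 2 * poissonv w (y - x))%:E =
  \int[Leb]_x (normc (a x) ^+ 2 / 2)%:E)%E.
  apply: eq_integral => x _; under eq_integral do rewrite EFinM.
  rewrite ge0_integralZl_EFin//; last by move=> y _; rewrite lee_fin.
  under eq_integral do rewrite -poissonvN opprB.
  by rewrite integral_poissonv// mule1.
rewrite half -ge0_muleDl ?lee_fin//= -EFinD.
by rewrite (_ : 2^-1 + 2^-1 = 1 :> R) ?mul1e//; lra.
Qed.

End fourier_theory.

(** * Smooth functions *)

Section smooth_closure.
Variables (R : realType) (d : nat).
Local Notation V := ('rV[R]_d).
Implicit Types (f g : V -> R) (i : 'I_d).

Definition bvec i : V := delta_mx 0 i.

Let derive_line f (x v : V) :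
  'D_v f x = 'D_(1 : R) (fun h : R => f (h *: v + x)) (0 : R).
Proof.
have E : (fun h : R => h^-1 *: ((f \o shift x) (h *: v) - f x)) =
    (fun h : R => h^-1 *: (((fun h : R => f (h *: v + x)) \o shift (0 : R)) (h *: (1 : R)) - f
      (0 *: v + x))).
  by apply/funext => h /=; rewrite scale0r add0r addr0 /GRing.scale/= mulr1.
by rewrite /derive E.
Qed.

Lemma is_derive_line f (x v : V) (df : R) :
  is_derive (0 : R) (1 : R) (fun h : R => f (h *: v + x)) df -> is_derive x v f df.
Proof.
move=> [d1 d2]; split; first exact/derivable1P.
exact: etrans (derive_line _ _ _) d2.
Qed.

Lemma is_derive_line_inv f (x v : V) : derivable f x v ->
  is_derive (0 : R) (1 : R) (fun h : R => f (h *: v + x)) ('D_v f x).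
Proof.
move=> df; split; first exact: (derivable1P f x v).1 df.
exact: esym (derive_line _ _ _).
Qed.

(** A coinduction principle: a class of continuous functions that is stable under all partial
    derivatives consists of smooth functions, since every iterated derivative stays in it. *)
Lemma rsmooth_class (P : (V -> R) -> Prop) :
  (forall f, P f -> continuous f /\
     forall i, (forall x, derivable f x (bvec i)) /\ P ('D_(bvec i) f)) ->
  forall f, P f -> rsmooth f.
Proof.
move=> HP f Pf s; have Ps : P (pderivs s f).
  by elim: s => [//|i s ih]; have [_ /(_ i)[]] := HP _ ih.
by have [c dv] := HP _ Ps; split => // i x; have [] := dv i.
Qed.

Lemma rsmooth_derive f i : rsmooth f -> rsmooth ('D_(bvec i) f).
Proof.
by move=> sf s; have := sf (rcons s i); rewrite /pderivs -cats1 foldr_cat.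
Qed.

Lemma rsmooth_continuous f : rsmooth f -> continuous f.
Proof. by move=> /(_ [::])[]. Qed.

Lemma rsmooth_derivable f i x : rsmooth f -> derivable f x (bvec i).
Proof. by move=> /(_ [::])[_]; exact. Qed.

(** Smoothness in one variable, phrased with a class [Q] closed under derivatives so that no
    iterated derivative has to be named. *)
Definition smooth1 (h : R -> R) := exists2 Q : (R -> R) -> Prop, Q h &
  forall k, Q k -> exists2 k', Q k' & forall x : R, is_derive x (1 : R) k (k' x).

(** Differentiating a product or a composite yields sums of products that contain new composites.
    Stability under derivatives therefore holds only for the closure under all three operations at
    once, and [rsmooth_class] is applied to this closure. *)
Inductive gen : (V -> R) -> Prop :=
| gen_base f of rsmooth f : gen f
| gen_add f g of gen f & gen g : gen (f + g)
| gen_mul f g of gen f & gen g : gen (f * g)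
| gen_comp h f of smooth1 h & gen f : gen (h \o f).

Lemma gen_closed f : gen f -> continuous f /\
  forall i, (forall x, derivable f x (bvec i)) /\ gen ('D_(bvec i) f).
Proof.
elim=> {f} [f sf|f g gf [cf df] gg [cg dg]|f g gf [cf df] gg [cg dg]|h f [Q Qh HQ] gf [cf df]].
- split; first exact: rsmooth_continuous.
  move=> i; split; first by move=> x; exact: rsmooth_derivable.
  by apply: gen_base; exact: rsmooth_derive.
- split; first by move=> x; exact: (cvgD (cf x) (cg x)).
  move=> i; have [df1 df2] := df i; have [dg1 dg2] := dg i.
  split; first by move=> x; exact: derivableD.
  rewrite (_ : 'D_(bvec i) (f + g) = 'D_(bvec i) f + 'D_(bvec i) g); first exact: gen_add.
  by apply/funext => x; rewrite deriveD.
- split; first by move=> x; exact: (cvgM (cf x) (cg x)).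
  move=> i; have [df1 df2] := df i; have [dg1 dg2] := dg i.
  split; first by move=> x; exact: derivableM.
  rewrite (_ : 'D_(bvec i) (f * g) = f * 'D_(bvec i) g + g * 'D_(bvec i) f).
    by apply: gen_add; exact: gen_mul.
  by apply/funext => x; rewrite deriveM.
- have [h' Qh' dH] := HQ _ Qh; split.
    move=> x; apply: continuous_comp; first exact: cf.
    apply: differentiable_continuous; apply/derivable1_diffP.
    by have [] := dH (f x).
  move=> i; have [df1 df2] := df i.
  have D x : is_derive x (bvec i) (h \o f) (h' (f x) * 'D_(bvec i) f x).
    apply: is_derive_line; have := is_derive_line_inv (df1 x).
    set k := fun h : R => f _ => dk.
    have E : f x = k 0 by rewrite /k scale0r add0r.
    have dHk : is_derive (k 0) 1 (h) (h' (f x)) by rewrite -E.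
    rewrite -[fun _ => _]/(h \o k).
    exact: is_derive1_comp.
  split; first by move=> x; have [] := D x.
  rewrite (_ : 'D_(bvec i) _ = (h' \o f) * 'D_(bvec i) f).
    apply: gen_mul => //; apply: gen_comp gf; by exists Q.
  by apply/funext => x; have [_ ->] := D x.
Qed.

Lemma gen_rsmooth f : gen f -> rsmooth f.
Proof. by apply: rsmooth_class => {}f; exact: gen_closed. Qed.

Lemma rsmoothD f g : rsmooth f -> rsmooth g -> rsmooth (f + g).
Proof. by move=> sf sg; apply: gen_rsmooth; apply: gen_add; exact: gen_base. Qed.

Lemma rsmoothM f g : rsmooth f -> rsmooth g -> rsmooth (f * g).
Proof. by move=> sf sg; apply: gen_rsmooth; apply: gen_mul; exact: gen_base. Qed.

Lemma rsmooth_comp h f : smooth1 h -> rsmooth f -> rsmooth (h \o f).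
Proof. by move=> sf sg; apply: gen_rsmooth; apply: gen_comp => //; exact: gen_base. Qed.

Lemma rsmooth_cst (c : R) : rsmooth (fun _ : V => c).
Proof.
apply: (@rsmooth_class (fun f => exists c, f = (fun=> c))); last by exists c.
move=> _ [k ->]; split; first exact: cst_continuous.
move=> i; split; first by move=> x; exact: derivable_cst.
by exists 0; apply/funext => x; exact: derive_cst.
Qed.

Lemma rsmooth_coord i : rsmooth (fun x : V => x 0 i).
Proof.
have D j (x : V) : is_derive x (bvec j) (fun x : V => x 0 i) (bvec j 0 i).
  apply: is_derive_line; under eq_fun do rewrite !mxE.
  by apply: is_derive_eq; rewrite /GRing.scale/= !mxE; ring.
move=> s; apply: (@rsmooth_class (fun f => rsmooth f \/ f = (fun x : V => x 0 i)));
  last by right.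
move=> f [sf|->].
  split; first exact: rsmooth_continuous.
  move=> j; split; first by move=> x; exact: rsmooth_derivable.
  by left; exact: rsmooth_derive.
split; first exact: coord_continuous.
move=> j; split; first by move=> x; have [] := D j x.
left; rewrite (_ : 'D_(bvec j) _ = (fun=> bvec j 0 i)); first exact: rsmooth_cst.
by apply/funext => x; have [_ ->] := D j x.
Qed.

Lemma rsmoothN f : rsmooth f -> rsmooth (fun x => - f x).
Proof.
move=> sf; rewrite (_ : (fun x => _) = (fun=> -1) * f).
  by apply: rsmoothM sf; exact: rsmooth_cst.
by apply/funext => x; rewrite fctE mulN1r.
Qed.

Lemma rsmooth_prod (I : Type) (s : seq I) (F : I -> V -> R) :
  (forall k, rsmooth (F k)) -> rsmooth (fun x => \prod_(k <- s) F k x).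
Proof.
move=> sF; elim: s => [|k s ih].
  by rewrite (_ : (fun x => _) = (fun=> 1)); [exact: rsmooth_cst|apply/funext => x;
    rewrite big_nil].
rewrite (_ : (fun x => _) = F k * (fun x => \prod_(j <- s) F j x));
  first exact: rsmoothM (sF k) ih.
by apply/funext => x; rewrite big_cons.
Qed.

Implicit Types phi psi : V -> R[i].

Lemma smooth_ext phi psi : (forall x, phi x = psi x) -> smooth phi -> smooth psi.
Proof. by move=> /funext ->. Qed.

Lemma smoothD phi psi : smooth phi -> smooth psi -> smooth (fun x => phi x + psi x).
Proof.
move=> [p1 p2] [q1 q2]; split.
  rewrite (_ : (fun x => _) = (fun x => complex.Re (phi x)) + (fun x => complex.Re (psi x))).
    exact: rsmoothD.
  by apply/funext => x; rewrite cReD.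
rewrite (_ : (fun x => _) = (fun x => complex.Im (phi x)) + (fun x => complex.Im (psi x))).
  exact: rsmoothD.
by apply/funext => x; rewrite cImD.
Qed.

Lemma smoothM phi psi : smooth phi -> smooth psi -> smooth (fun x => phi x * psi x).
Proof.
move=> [p1 p2] [q1 q2]; split.
  rewrite (_ : (fun x => _) = (fun x => complex.Re (phi x)) * (fun x => complex.Re (psi x))
    + (fun x => - complex.Im (phi x)) * (fun x => complex.Im (psi x))).
    by apply: rsmoothD; [exact: rsmoothM|apply: rsmoothM q2; exact: rsmoothN].
  apply/funext => x. by rewrite cReM !fctE mulNr.
rewrite (_ : (fun x => _) = (fun x => complex.Re (phi x)) * (fun x => complex.Im (psi x))
    + (fun x => complex.Im (phi x)) * (fun x => complex.Re (psi x))).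
  by apply: rsmoothD; exact: rsmoothM.
by apply/funext => x; rewrite cImM !fctE.
Qed.

Lemma smooth_cst (c : R[i]) : smooth (fun _ : V => c).
Proof. by split; exact: rsmooth_cst. Qed.

Lemma smooth_real f : rsmooth f -> smooth (fun x => (f x)%:C).
Proof. by move=> sf; split; [exact: sf|exact: rsmooth_cst]. Qed.

Lemma smooth_conj phi : smooth phi -> smooth (fun x => conjc (phi x)).
Proof.
move=> [p1 p2]; split.
  by rewrite (_ : (fun x => _) = (fun x => complex.Re (phi x)))//; apply/funext => x;
    rewrite cRe_conj.
by rewrite (_ : (fun x => _) = (fun x => - complex.Im (phi x)));
  [exact: rsmoothN|apply/funext => x; rewrite cIm_conj].
Qed.

Definition cderive i phi : V -> R[i] := cpderivs [:: i] phi.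

Lemma smooth_derive i phi : smooth phi -> smooth (cderive i phi).
Proof. by move=> [p1 p2]; split; exact: rsmooth_derive. Qed.

(** The last index is the derivative taken first. Inductions on derivatives therefore remove the
    last index and generalize over the function. *)
Lemma cpderivs_rcons s i phi : cpderivs (rcons s i) phi = cpderivs s (cderive i phi).
Proof. by apply/funext => x; rewrite /cpderivs /pderivs -cats1 !foldr_cat. Qed.

Lemma smooth_cpderivs s phi : smooth phi -> smooth (cpderivs s phi).
Proof.
elim/last_ind: s phi => [|s i ih] phi sp.
  by apply: smooth_ext sp => x; apply: complexP.
by rewrite cpderivs_rcons; apply: ih; exact: smooth_derive.
Qed.

Lemma pderivsD s f g : rsmooth f -> rsmooth g ->
  pderivs s (fun x => f x + g x) = (fun x => pderivs s f x + pderivs s g x).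
Proof.
elim/last_ind: s f g => [//|s i ih] f g sf sg.
rewrite /pderivs -cats1 !foldr_cat /= -!/(pderivs s _) -ih; try exact: rsmooth_derive.
congr (pderivs s); apply/funext => x.
by rewrite deriveD//; exact: rsmooth_derivable.
Qed.

Lemma cpderivsD s phi psi : smooth phi -> smooth psi ->
  cpderivs s (fun x => phi x + psi x) = (fun x => cpderivs s phi x + cpderivs s psi x).
Proof.
move=> [p1 p2] [q1 q2]; apply/funext => x; apply: complexP; rewrite ?cReD ?cImD /cpderivs/=.
  rewrite (_ : (fun y => complex.Re (phi y + psi y)) = (fun y =>
    complex.Re (phi y) + complex.Re (psi y))).
    by rewrite pderivsD.
  by apply/funext => y; rewrite cReD.
rewrite (_ : (fun y => complex.Im (phi y + psi y)) = (fun y =>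
  complex.Im (phi y) + complex.Im (psi y))).
  by rewrite pderivsD.
by apply/funext => y; rewrite cImD.
Qed.

Let rderiveM f g i x : rsmooth f -> rsmooth g ->
  'D_(bvec i) (fun y => f y * g y) x = 'D_(bvec i) f x * g x + f x * 'D_(bvec i) g x.
Proof.
move=> sf sg; have := deriveM (@rsmooth_derivable f i x sf) (@rsmooth_derivable g i x sg).
by rewrite /GRing.scale /= => ->; rewrite addrC [_ * g x]mulrC.
Qed.

Let rderiveD f g i x : rsmooth f -> rsmooth g ->
  'D_(bvec i) (fun y => f y + g y) x = 'D_(bvec i) f x + 'D_(bvec i) g x.
Proof.
move=> sf sg; exact: deriveD (@rsmooth_derivable f i x sf) (@rsmooth_derivable g i x sg).
Qed.

Let rderiveB f g i x : rsmooth f -> rsmooth g ->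
  'D_(bvec i) (fun y => f y - g y) x = 'D_(bvec i) f x - 'D_(bvec i) g x.
Proof.
move=> sf sg; exact: deriveB (@rsmooth_derivable f i x sf) (@rsmooth_derivable g i x sg).
Qed.

Lemma cderiveM i phi psi : smooth phi -> smooth psi ->
  cderive i (fun x => phi x * psi x) =
  (fun x => cderive i phi x * psi x + phi x * cderive i psi x).
Proof.
move=> [p1 p2] [q1 q2]; apply/funext => x.
have E1 : (fun y => complex.Re (phi y * psi y)) =
  (fun y => complex.Re (phi y) * complex.Re (psi y) - complex.Im (phi y) * complex.Im (psi y)).
  by apply/funext => y; rewrite cReM.
have E2 : (fun y => complex.Im (phi y * psi y)) =
  (fun y => complex.Re (phi y) * complex.Im (psi y) + complex.Im (phi y) * complex.Re (psi y)).
  by apply/funext => y; rewrite cImM.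
have s11 := rsmoothM p1 q1; have s22 := rsmoothM p2 q2.
have s12 := rsmoothM p1 q2; have s21 := rsmoothM p2 q1.
apply: complexP; rewrite ?cReD ?cImD ?cReM ?cImM /cderive /cpderivs/pderivs [foldr _ _ _]/= ?E1
  ?E2.
  rewrite [LHS](rderiveB _ _ s11 s22) (rderiveM _ _ p1 q1) (rderiveM _ _ p2 q2) /=.
  by rewrite !opprD !addrA; congr (_ - _); rewrite addrAC.
rewrite [LHS](rderiveD _ _ s12 s21) (rderiveM _ _ p1 q2) (rderiveM _ _ p2 q1) /=.
by rewrite addrACA.
Qed.

Lemma smooth_cmeasurable phi : smooth phi -> cmeasurable_fun setT phi.
Proof.
move=> [p1 p2].
split; [exact: continuous_measurable_rVR (rsmooth_continuous p1)|
        exact: continuous_measurable_rVR (rsmooth_continuous p2)].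
Qed.

Lemma vanishes_cderive i phi (K : set V) : closed K -> vanishes_outside K phi ->
  vanishes_outside K (cderive i phi).
Proof.
move=> cK vK x nKx.
have nb : \forall y \near x, ~ K y.
  by apply: open_nbhs_nbhs; split => //; exact: closed_openC.
have D (f : V -> R) : (forall y, ~ K y -> f y = 0) -> 'D_(bvec i) f x = 0.
  move=> f0; rewrite (@near_eq_derive _ _ _ f (cst 0)) ?derive_cst//.
  by near=> y; apply: f0; near: y.
by apply: complexP => /=; apply: D => y /vK ->.
Unshelve. all: by end_near. Qed.

End smooth_closure.

(** * Differentiability of Fourier transforms of compactly supported functions *)

Section fourier_smooth.
Variables (R : realType) (d : nat).
Local Notation V := ('rV[R]_d).
Local Notation leb := (@lebesgue_measure R).
Local Notation Leb := (lebesgue_rV R d).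
Local Notation L1 := (cintegrable Leb setT).
Implicit Types (F : V -> R[i]) (i : 'I_d) (x xi : V).

(** With bounded support the class is stable under multiplication by coordinates, hence under the
    operation that a derivative of the transform induces. *)
Definition L1c F := L1 F /\ exists M, 0 <= M /\ vanishes_outside (cube M) F.

(* The multiplier of d/dx_i under the Fourier transform. *)
Definition dmul i x : R[i] := 0 -i* (2 * pi * x 0 i).

Lemma normc_dmul i x : normc (dmul i x) = 2 * pi * `|x 0 i|.
Proof.
rewrite /dmul /= expr0n add0r sqrrN sqrtr_sqr !normrM ger0_norm// (ger0_norm (pi_ge0 _)).
by [].
Qed.

Lemma cmeasurable_dmul i : cmeasurable_fun setT (dmul i).
Proof.
split; first exact: measurable_cst.
apply: measurable_funN; apply: measurable_funM; first exact: measurable_cst.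
exact: measurable_coord.
Qed.

Lemma L1c_bounded_mul F (h : V -> R[i]) (C : R -> R) : L1c F ->
  cmeasurable_fun setT h ->
  (forall M x, 0 <= M -> cube M x -> normc (h x) <= C M) ->
  L1c (fun x => h x * F x).
Proof.
move=> [iF [M [M0 vF]]] mh hC; split; last by exists M; split => // x /vF ->; rewrite mulr0.
apply: (@le_cintegrable _ _ _ Leb setT _ (fun x => C M * normc (F x))).
- exact: measurableT.
- by apply: cmeasurableM; [exact: mh|exact: cintegrable_meas iF].
- move=> x _; rewrite Normc.normcM.
  have [Mx|nMx] := pselect (cube M x); last by rewrite vF// Normc.normc0 !mulr0.
  by apply: ler_wpM2r; [exact: normc_ge0|exact: hC].
- exact: (integrableZl measurableT (C M) (cintegrable_normc measurableT iF)).
Qed.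

Lemma L1c_dmul i F : L1c F -> L1c (fun x => dmul i x * F x).
Proof.
move=> lF; apply: (@L1c_bounded_mul _ _ (fun M => 2 * pi * M)) => //.
  exact: cmeasurable_dmul.
move=> M x M0 /(_ i) h; rewrite normc_dmul ler_wpM2l// mulr_ge0//; exact: pi_ge0.
Qed.

Lemma dotp_line i x xi (t : R) : dotp x (t *: bvec R i + xi) = t * x 0 i + dotp x xi.
Proof.
rewrite /dotp (bigD1 i)//= [in RHS](bigD1 i)//= !mxE !eqxx addrA; congr (_ + _).
  by rewrite mulr1 mulrDr [x 0 i * t]mulrC.
by apply: eq_bigr => j ji; rewrite !mxE (negbTE ji) mulr0 add0r.
Qed.

(** Differentiation under the integral sign along the line through [xi], dominated by 2 pi M |F|.
    Real parts suffice: by [Im_fourier] the imaginary part of a transform is the real part of the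
    transform of -i F. *)
Lemma fourier_derive_Re F i xi : L1c F ->
  is_derive xi (bvec R i) (fun xi => complex.Re (fourier F xi))
    (complex.Re (fourier (fun x => dmul i x * F x) xi)).
Proof.
move=> lF; have [iF [M [M0 vF]]] := lF.
apply: is_derive_line.
pose f (t : R) x : R := complex.Re (phase x (t *: bvec R i + xi) * F x).
pose f' (t : R) x : R := complex.Re (phase x (t *: bvec R i + xi) * (dmul i x * F x)).
have df t x : is_derive t (1 : R) (f ^~ x) (f' t x).
  have -> : f ^~ x = (fun t => cos (- (2 * pi * (t * x 0 i + dotp x xi))) * complex.Re (F x) -
      sin (- (2 * pi * (t * x 0 i + dotp x xi))) * complex.Im (F x)).
    by apply/funext => s; rewrite /f cReM /phase /= dotp_line.
  apply: is_derive_eq; rewrite /f' !cReM !cImM /phase /= dotp_line /GRing.scale/=.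
  ring.
have intf t : Leb.-integrable setT (EFin \o f t).
  by have [] := L1_phase (t *: bvec R i + xi) iF.
pose G x := 2 * pi * M * normc (F x).
have G0 x : 0 <= G x.
  by rewrite mulr_ge0 ?normc_ge0// mulr_ge0// mulr_ge0//; exact: pi_ge0.
have intG : Leb.-integrable setT (EFin \o G).
  exact: (integrableZl measurableT (2 * pi * M) (cintegrable_normc measurableT iF)).
have E t x : partial1of2 f t x = f' t x.
  by rewrite partial1of2E; have [_ ->] := df t x.
have Gub t x : `|partial1of2 f t x| <= G x.
  rewrite E (le_trans (normc_Re _))// Normc.normcM normc_cis mul1r Normc.normcM normc_dmul /G.
  have [Mx|nMx] := pselect (cube M x); last by rewrite vF// Normc.normc0 !mulr0.
  apply: ler_wpM2r; first exact: normc_ge0.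
  by rewrite ler_wpM2l// ?mulr_ge0//; exact: pi_ge0.
have I0 : (`](-1 : R), 1[%classic : set R) 0 by rewrite /= in_itv/= ltr01 andbT oppr_lt0.
have D1 := @derivable_under_integral R _ _ Leb f setT measurableT 0 (-1) 1 I0
  (fun t _ => intf t) (fun t x _ _ => @ex_derive _ _ _ _ _ _ _ (df t x)) G G0 intG (fun t x _ _
    => Gub t x).
have D2 := @differentiation_under_integral R _ _ Leb f setT measurableT 0 (-1) 1 I0
  (fun t _ => intf t) (fun t x _ _ => @ex_derive _ _ _ _ _ _ _ (df t x)) G G0 intG (fun t x _ _
    => Gub t x).
split; first exact: D1.
apply: etrans; first by rewrite -derive1E; exact: D2.
rewrite /fourier /=; apply: eq_Rintegral => x _; rewrite E /f'.
by rewrite scale0r add0r.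
Qed.

Lemma Im_fourier F xi : L1 F ->
  complex.Im (fourier F xi) = complex.Re (fourier (fun x => (0 -i* 1) * F x) xi).
Proof.
move=> iF.
have <- : (0 -i* 1) * fourier F xi = fourier (fun x => (0 -i* 1) * F x) xi := fourierZl _ _ iF.
by rewrite cReM [complex.Re (0 -i* 1)]/= [complex.Im (0 -i* 1)]/= mul0r sub0r mulN1r opprK.
Qed.

Lemma L1c_Zl c F : L1c F -> L1c (fun x => c * F x).
Proof.
by move=> lF; apply: (@L1c_bounded_mul _ (fun=> c) (fun M => normc c)).
Qed.

Let lip_trig (f f' : R -> R) (s t : R) : (forall x : R, is_derive x (1 : R) f (f' x)) ->
  (forall y, `|f' y| <= 1) -> `|f s - f t| <= `|s - t|.
Proof.
move=> df f1; wlog st : s t / s <= t.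
  move=> H; have [/H//|/ltW/H] := leP s t.
  by rewrite distrC [leRHS]distrC.
have [|c _ E] := MVT_segment st (fun y _ => df y).
  apply: continuous_subspaceT => x; apply: differentiable_continuous.
  by apply/derivable1_diffP; have [] := df x.
by rewrite distrC E normrM [leRHS]distrC ler_piMl.
Qed.

Lemma normc_cisB (s t : R) : normc (cis s - cis t) <= 2 * `|s - t|.
Proof.
apply: le_trans (normc_le _) _; rewrite mulr_natl mulr2n.
rewrite -[complex.Re _]/(cos s - cos t) -[complex.Im _]/(sin s - sin t); apply: lerD.
  apply: (@lip_trig cos (fun y => - sin y)) => y.
  by rewrite normrN ler_norml sin_geN1 sin_le1.
apply: (@lip_trig sin cos) => y.
by rewrite ler_norml cos_geN1 cos_le1.
Qed.

Lemma rV_norm_coord (x : V) i : `|x 0 i| <= `|x|.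
Proof.
by rewrite [leRHS]/Num.norm/= mx_normrE; apply/bigmax_geP; right => /=; exists (0, i).
Qed.

Lemma fourier_continuous_Re F : L1c F -> continuous (fun xi => complex.Re (fourier F xi)).
Proof.
move=> lF xi; have [iF [M [M0 vF]]] := lF.
pose I := \int[Leb]_x normc (F x).
have I0 : 0 <= I by apply: Rintegral_ge0 => x _; exact: normc_ge0.
(* A Lipschitz constant: on the cube the scalar product with xi - eta is at most d M times the sup
   norm of xi - eta, and the leading 2 comes from [normc_cisB]. *)
pose C := 2 * (2 * pi * (d%:R * M)) * I.
have C0 : 0 <= C by rewrite !mulr_ge0//; exact: pi_ge0.
have L eta : `|complex.Re (fourier F xi) - complex.Re (fourier F eta)| <= C * `|xi - eta|.
  have iD : L1 (fun x => phase x xi * F x + (-1) * (phase x eta * F x)).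
    apply: cintegrableD => //; first exact: L1_phase.
    by apply: cintegrableZl => //; exact: L1_phase.
  have -> : complex.Re (fourier F xi) - complex.Re (fourier F eta) =
      complex.Re (cintegral Leb setT (fun x => phase x xi * F x + (-1) * (phase x eta * F x))).
    rewrite (cintegralD measurableT (L1_phase _ iF) (cintegrableZl _ measurableT (L1_phase _
      iF))).
    rewrite (cintegralZl _ measurableT (L1_phase _ iF)) mulN1r cReD.
    by congr (_ + _); case: (cintegral _ _ _).
  apply: le_trans (normc_Re _) _; apply: le_trans (cintegral_normc measurableT iD) _.
  rewrite /C mulrAC /I -RintegralZl//; last exact: cintegrable_normc.
  apply: le_Rintegral => //.
  - exact: cintegrable_normc.
  - exact: (integrableZl measurableT _ (cintegrable_normc measurableT iF)).
  move=> x _; rewrite mulN1r -mulrBl Normc.normcM.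
  have [Mx|nMx] := pselect (cube M x); last by rewrite vF// Normc.normc0 !mulr0.
  apply: ler_wpM2r; first exact: normc_ge0.
  apply: le_trans (normc_cisB _ _) _; rewrite -[leRHS]mulrA ler_wpM2l//.
  rewrite opprK addrC -mulrBr normrM [`|2 * pi|]ger0_norm; last by rewrite mulr_ge0//;
    exact: pi_ge0.
  rewrite -[leRHS]mulrA ler_wpM2l//; first by rewrite mulr_ge0//; exact: pi_ge0.
  rewrite /dotp -sumrB; apply: le_trans (ler_norm_sum _ _ _) _.
  apply: (@le_trans _ _ (\sum_(i < d) M * `|xi - eta|)); last first.
    by rewrite sumr_const card_ord -[leLHS]mulr_natl -[leRHS]mulrA.
  apply: ler_sum => i _; rewrite -mulrBr normrM ler_pM//.
  by rewrite distrC; have := rV_norm_coord (xi - eta) i; rewrite !mxE.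
have C1 : 0 < C + 1 by rewrite ltr_wpDl.
move=> B /nbhs_ballP[e /= e0 eB]; apply/nbhs_ballP; exists (e / (C + 1)).
  by rewrite /= divr_gt0.
move=> eta; rewrite mx_norm_ball /ball_/= ltr_pdivlMr// => h; apply: eB.
rewrite -ball_normE /=; apply: le_lt_trans (L eta) _; apply: le_lt_trans h.
by rewrite mulrC ler_wpM2l// lerDl.
Qed.

Lemma rsmooth_fourier_Re F : L1c F -> rsmooth (fun xi => complex.Re (fourier F xi)).
Proof.
move=> lF; apply: (@rsmooth_class _ _ (fun f => exists2 F,
  L1c F & f = fun xi => complex.Re (fourier F xi))); last by exists F.
move=> _ [{lF}F lF ->]; split; first exact: fourier_continuous_Re.
move=> i; split; first by move=> x; have [] := fourier_derive_Re i x lF.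
exists (fun x => dmul i x * F x); first exact: L1c_dmul.
by apply/funext => x; have [_ ->] := fourier_derive_Re i x lF.
Qed.

Lemma Im_fourier_fun F : L1c F -> (fun xi => complex.Im (fourier F xi)) =
  (fun xi => complex.Re (fourier (fun x => (0 -i* 1) * F x) xi)).
Proof. by move=> [iF _]; apply/funext => xi; exact: Im_fourier. Qed.

Lemma smooth_fourier F : L1c F -> smooth (fourier F).
Proof.
move=> lF; split; first exact: rsmooth_fourier_Re.
by rewrite Im_fourier_fun//; apply: rsmooth_fourier_Re; exact: L1c_Zl.
Qed.

Lemma cderive_fourier i F : L1c F ->
  cderive i (fourier F) = fourier (fun x => dmul i x * F x).
Proof.
move=> lF; apply/funext => xi; apply: complexP => /=.
  by have [_ ->] := fourier_derive_Re i xi lF.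
rewrite Im_fourier_fun//.
have [_ ->] := fourier_derive_Re i xi (L1c_Zl (0 -i* 1) lF).
apply: etrans (esym (Im_fourier xi (L1c_dmul i lF).1)).
apply: (congr1 (fun h => complex.Re (fourier h xi))); apply/funext => x; exact: mulrCA.
Qed.

End fourier_smooth.

(** * Square integrable functions *)

Section square_integrable.
Context dd (T : measurableType dd) (R : realType).
Variable mu : {measure set T -> \bar R}.
Implicit Types (f g : T -> R) (c : nat -> T -> R).

Definition L2 f := measurable_fun setT f /\
  mu.-integrable setT (EFin \o (fun x => f x ^+ 2)).

Definition sqn f : R := \int[mu]_x (f x ^+ 2).

Lemma sqn_ge0 f : 0 <= sqn f.
Proof. by apply: Rintegral_ge0 => x _; exact: sqr_ge0. Qed.

(** The optimal [t] is sqrt Y / sqrt X, for which both terms on the right of the hypothesis equal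
    sqrt X sqrt Y. *)
Lemma amgm_sqrt (z X Y : R) : 0 <= X -> 0 <= Y ->
  (forall t : R, 0 < t -> 2 * z <= t * X + Y / t) -> z <= Num.sqrt X * Num.sqrt Y.
Proof.
move=> X0 Y0 H; apply/ler_addgt0Pl => e e0.
pose a := Num.sqrt X; pose b := Num.sqrt Y.
have a0 : 0 <= a by exact: sqrtr_ge0.
have b0 : 0 <= b by exact: sqrtr_ge0.
have aX : a ^+ 2 = X by rewrite sqr_sqrtr.
have bY : b ^+ 2 = Y by rewrite sqr_sqrtr.
(* perturbing both square roots by s > 0 covers the degenerate cases *)
pose s := Num.min 1 (e / (a + b + 1)).
have ab1 : 0 < a + b + 1 by rewrite ltr_wpDl// addr_ge0.
have s0 : 0 < s by rewrite lt_min ltr01 divr_gt0.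
have s1 : s <= 1 by rewrite ge_min lexx.
have se : s * (a + b + 1) <= e by rewrite -ler_pdivlMr// ge_min lexx orbT.
have as0 : 0 < a + s by rewrite ltr_wpDl.
have bs0 : 0 < b + s by rewrite ltr_wpDl.
have := H ((b + s) / (a + s)) (divr_gt0 bs0 as0).
have h1 : (b + s) / (a + s) * X <= (b + s) * (a + s).
  rewrite -aX mulrAC ler_pdivrMr// -mulrA ler_pM2l// expr2.
  by apply: ler_pM => //; rewrite lerDl ltW.
have h2 : Y / ((b + s) / (a + s)) <= (b + s) * (a + s).
  rewrite -bY invf_div mulrA ler_pdivrMr// [leRHS]mulrAC ler_pM2r// expr2.
  by apply: ler_pM => //; rewrite lerDl ltW.
move=> h; have : 2 * z <= 2 * ((b + s) * (a + s)) by lra.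
rewrite ler_pM2l// => h3; apply: le_trans h3 _.
rewrite -/a -/b mulrDl !mulrDr.
have : s * s <= s * 1 by rewrite ler_pM2l.
move: se; rewrite !mulrDr mulr1; lra.
Qed.

Lemma L2_mul f g : L2 f -> L2 g -> mu.-integrable setT (EFin \o (fun x => f x * g x)).
Proof.
move=> [mf f2] [mg g2].
apply: (@le_integrable _ _ _ mu setT measurableT _ (EFin \o (fun x => f x ^+ 2 + g x ^+ 2))).
- by apply/measurable_EFinP; exact: measurable_funM.
- move=> x _; rewrite /= lee_fin [leRHS]ger0_norm ?addr_ge0 ?sqr_ge0//.
  rewrite normrM -[f x ^+ 2]real_normK ?num_real// -[g x ^+ 2]real_normK ?num_real//.
  have := sqr_ge0 (`|f x| - `|g x|); have := sqr_ge0 (`|f x| + `|g x|); nra.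
- exact: (integrableD measurableT f2 g2).
Qed.

Lemma L2D f g : L2 f -> L2 g -> L2 (fun x => f x + g x).
Proof.
move=> lf lg; have [mf f2] := lf; have [mg g2] := lg; split; first exact: measurable_funD.
have fg := integrableZl measurableT 2 (L2_mul lf lg).
have := integrableD measurableT (integrableD measurableT f2 fg) g2.
apply: eq_integrable => // x _ /=; rewrite -!EFinM -!EFinD; congr EFin; ring.
Qed.

Lemma L2Z (k : R) f : L2 f -> L2 (fun x => k * f x).
Proof.
move=> [mf f2]; split; first by apply: measurable_funM.
apply: eq_integrable (integrableZl measurableT (k ^+ 2) f2) => // x _ /=.
by rewrite -EFinM exprMn.
Qed.

Lemma sqnZ (k : R) f : L2 f -> sqn (fun x => k * f x) = k ^+ 2 * sqn f.
Proof.
move=> [mf f2]; rewrite /sqn -RintegralZl//.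
by apply: eq_Rintegral => x _; rewrite exprMn.
Qed.

Lemma cauchy_schwarz f g : L2 f -> L2 g ->
  `|\int[mu]_x (f x * g x)| <= Num.sqrt (sqn f) * Num.sqrt (sqn g).
Proof.
move=> lf lg; have [mf f2] := lf; have [mg g2] := lg.
apply: amgm_sqrt; [exact: sqn_ge0|exact: sqn_ge0|move=> t t0].
have fg := L2_mul lf lg.
apply: (@le_trans _ _ (2 * \int[mu]_x `|f x * g x|)).
  by rewrite ler_pM2l// le_normr_Rintegral.
have i1 := integrableZl measurableT t f2.
have i2 := integrableZr measurableT t^-1 g2.
rewrite /sqn -(RintegralZl 2 measurableT (integrable_norm fg)).
rewrite -(RintegralZl t measurableT f2) -(RintegralZr t^-1 measurableT g2) -RintegralD//.
apply: le_Rintegral => //.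
- exact: (integrableZl measurableT 2 (integrable_norm fg)).
- exact: (integrableD measurableT i1 i2).
move=> x _ /=; rewrite normrM -[f x ^+ 2]real_normK ?num_real// -[g x ^+ 2]real_normK
  ?num_real//.
rewrite -subr_ge0 (_ : _ - _ = t * (`|f x| - `|g x| / t) ^+ 2);
  first by rewrite mulr_ge0 ?sqr_ge0// ltW.
by field; rewrite gt_eqF.
Qed.

Lemma minkowski2 f g : L2 f -> L2 g ->
  Num.sqrt (sqn (fun x => f x + g x)) <= Num.sqrt (sqn f) + Num.sqrt (sqn g).
Proof.
move=> lf lg; have [mf f2] := lf; have [mg g2] := lg.
have fg := L2_mul lf lg.
rewrite -(@ler_pXn2r _ 2) ?nnegrE ?addr_ge0 ?sqrtr_ge0// sqrrD !sqr_sqrtr ?sqn_ge0//.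
have -> : sqn (fun x => f x + g x) = sqn f + 2 * \int[mu]_x (f x * g x) + sqn g.
  rewrite /sqn -RintegralZl// -RintegralD//; last exact: (integrableZl measurableT 2 fg).
  rewrite -RintegralD//; last first.
    exact: (integrableD measurableT f2 (integrableZl measurableT 2 fg)).
  by apply: eq_Rintegral => x _; ring.
rewrite lerD2r lerD2l mulr_natl lerMn2r/=.
exact: le_trans (ler_norm _) (cauchy_schwarz lf lg).
Qed.

(** The ratio is tied to the gliding hump in [weakly_bounded]: after the k-th term the series with
    ratio 1/3 has remainder 3/2 h^(k+1) = h^k / 2, so that half of the k-th term survives. *)
Let h : R := 3^-1.

Let geom_sum k n : \sum_(k <= j < k + n) h ^+ j = 3 / 2 * h ^+ k * (1 - h ^+ n).
Proof.
elim: n => [|n ih]; first by rewrite addn0 big_geq// expr0 subrr mulr0.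
rewrite addnS big_nat_recr ?leq_addr//= ih exprD exprS; move: (h ^+ k) (h ^+ n) => y z;
  rewrite /h; lra.
Qed.

Section L2_series.
Variable c : nat -> T -> R.
Hypothesis cL2 : forall j, L2 (c j).
Hypothesis cn : forall j, Num.sqrt (sqn (c j)) <= h ^+ j.

Let h0 : 0 < h. Proof. by rewrite invr_gt0. Qed.

Let S k x := \sum_(j < k) c j x.

Let L2S k : L2 (S k).
Proof.
elim: k => [|k ih].
  rewrite /S; split; first by apply: (eq_measurable (h' := cst 0)) => [x|//]; rewrite big_ord0.
  by apply: eq_integrable (integrable0 mu setT) => // x _ /=; rewrite big_ord0 expr0n.
rewrite (_ : S k.+1 = fun x => S k x + c k x); first exact: L2D.
by apply/funext => x; rewrite /S big_ord_recr.
Qed.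

Let L2B f g : L2 f -> L2 g -> L2 (fun x => f x - g x).
Proof.
move=> lf lg; rewrite (_ : (fun x => _) = (fun x => f x + (-1) * g x)).
  by apply: L2D => //; exact: L2Z.
by apply/funext => x; rewrite mulN1r.
Qed.

Let tail_le k m : Num.sqrt (sqn (fun x => S (k + m) x - S k x)) <= 3 / 2 * h ^+ k.
Proof.
apply: (@le_trans _ _ (\sum_(k <= j < k + m) h ^+ j)); last first.
  rewrite geom_sum; apply: ler_piMr; first by rewrite mulr_ge0// exprn_ge0// ltW.
  by rewrite gerBl exprn_ge0// ltW.
elim: m => [|m ih].
  rewrite addn0 big_geq//; rewrite /sqn; under eq_Rintegral do rewrite subrr expr0n.
  by rewrite Rintegral_cst// mul0r sqrtr0.
rewrite addnS big_nat_recr ?leq_addr//=.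
rewrite (_ : (fun x => _) = (fun x => (S (k + m) x - S k x) + c (k + m)%N x)).
  apply: le_trans (minkowski2 _ (cL2 _)) _; first exact: L2B.
  exact: lerD.
by apply/funext => x; rewrite /S big_ord_recr addrAC.
Qed.

Lemma L2_series : exists v, L2 v /\
  forall k, Num.sqrt (sqn (fun x => v x - \sum_(j < k) c j x)) <= 3 / 2 * h ^+ k.
Proof.
(* By the inequality of the means 2 |c_j| is at most h^j + c_j^2 / h^j, and the second summand has
   integral at most h^j. So the sum [G] of these is finite almost everywhere, and where it is finite
   the series converges absolutely. *)
pose a j x := ((c j x ^+ 2) / h ^+ j)%:E.
have a0 j x : (0 <= a j x)%E by rewrite lee_fin divr_ge0 ?sqr_ge0// exprn_ge0// ltW.
have ma j : measurable_fun setT (a j).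
  apply/measurable_EFinP; apply: measurable_funM => //; apply: measurable_funX.
  exact: (cL2 j).1.
pose G x := (\sum_(j <oo) a j x)%E.
have mG : measurable_fun setT G.
  exact: (ge0_emeasurable_sum (P := xpredT) (fun k x _ _ => a0 k x) (fun k _ => ma k)).
have G0 x : (0 <= G x)%E by apply: nneseries_ge0 => n _ _; exact: a0.
have aI j : (\int[mu]_x a j x <= (h ^+ j)%:E)%E.
  have [mc c2] := cL2 j.
  have -> : (\int[mu]_x a j x = (h ^+ j)^-1%:E * (sqn (c j))%:E)%E.
    rewrite /sqn /Rintegral fineK; last exact: (integrable_fin_num measurableT c2).
    rewrite -(integralZl measurableT c2); apply: eq_integral => x _.
    by rewrite /a mulrC EFinM.
  rewrite -EFinM lee_fin mulrC ler_pdivrMr ?exprn_gt0// -expr2.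
  rewrite -[sqn _]sqr_sqrtr ?sqn_ge0// ler_pXn2r ?nnegrE ?sqrtr_ge0//.
  by rewrite exprn_ge0// ltW.
have Gint : mu.-integrable setT G.
  apply/integrableP; split => //.
  under eq_integral do rewrite gee0_abs//.
  rewrite integral_nneseries//.
  apply: (@le_lt_trans _ _ (3 / 2)%:E); last by rewrite ltry.
  apply: lime_le; first by apply: is_cvg_nneseries => n _ _; exact: integral_ge0.
  near=> n; apply: (@le_trans _ _ (\sum_(0 <= j < n) (h ^+ j)%:E)%E).
    by apply: lee_sum => j _.
  rewrite sumEFin lee_fin; have := geom_sum 0 n; rewrite add0n expr0 mulr1 => ->.
  by rewrite ler_piMr// gerBl exprn_ge0// ltW.
pose Zc := [set x | G x \is a fin_num].
have mZc : measurable Zc by have := emeasurable_fin_num measurableT mG; rewrite setTI.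
have muZ : mu (~` Zc) = 0.
  have [N [mN N0 sN]] := integrable_ae measurableT Gint.
  apply/eqP; rewrite -measure_le0 -N0; apply: le_measure; rewrite ?inE//.
    exact: measurableC.
  by move=> x nx; apply: sN => /= /(_ I).
have cvgS x : Zc x -> cvgn (fun k => S k x).
  move=> Zx.
  have E : (fun k => S k x) = series (fun j => c j x).
    by apply/funext => k; rewrite /S /series/= big_mkord.
  rewrite E; apply: normed_cvg; apply: nondecreasing_is_cvgn.
    by apply: (@nondecreasing_series _ _ xpredT) => j _ _; exact: normr_ge0.
  exists ((3 / 2 + fine (G x)) / 2) => _ [n _ <-] /=.
  apply: (@le_trans _ _ ((\sum_(0 <= j < n) h ^+ j + \sum_(0 <=
    j < n) c j x ^+ 2 / h ^+ j) / 2)).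
    rewrite -big_split/= mulr_suml; apply: ler_sum => j _.
    have hj : 0 < h ^+ j by rewrite exprn_gt0.
    rewrite ler_pdivlMr// -[c j x ^+ 2]real_normK ?num_real//.
    rewrite -subr_ge0 (_ : _ - _ = (h ^+ j - `|c j x|) ^+ 2 / h ^+ j);
      first by rewrite divr_ge0 ?sqr_ge0// ltW.
    by field; rewrite gt_eqF.
  rewrite ler_pM2r ?invr_gt0//; apply: lerD.
    have := geom_sum 0 n; rewrite add0n expr0 mulr1 => ->.
    by rewrite ler_piMr// gerBl exprn_ge0// ltW.
  rewrite -lee_fin fineK//; apply: le_trans (nneseries_lim_ge n _); last first.
    by move=> k _ _; exact: a0.
  by rewrite sumEFin.
(* The indicator makes the sequence converge everywhere, so that the limit is measurable; it only
   changes the sums on a null set. *)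
pose v x := limn (fun k => S k x * \1_Zc x).
have cvgv x : (fun k => S k x * \1_Zc x) @ \oo --> v x.
  have [Zx|nZx] := pselect (Zc x).
    rewrite /v indicE mem_set//; under eq_fun do rewrite mulr1; exact: cvgS.
  rewrite /v indicE memNset//; under eq_fun do rewrite mulr0; exact: is_cvg_cst.
have cvgv1 x : Zc x -> (fun k => S k x) @ \oo --> v x.
  move=> Zx; have := cvgv x; rewrite indicE mem_set//.
  by under eq_fun do rewrite mulr1.
have mv : measurable_fun setT v.
  apply: (@measurable_fun_cvg _ _ _ setT (fun k x => S k x * \1_Zc x)).
    by move=> k; apply: measurable_funM => //; exact: (L2S k).1.
  by move=> x _; exact: cvgv.
(* Fatou's lemma applied to the squares of S_(k+m) - S_k as m grows, whose integrals [tail_le]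
   bounds uniformly in m. *)
have main k : (\int[mu]_x ((v x - S k x) ^+ 2)%:E <= ((3 / 2 * h ^+ k) ^+ 2)%:E)%E.
  have mvS : measurable_fun setT (fun x => ((v x - S k x) ^+ 2)%:E).
    apply/measurable_EFinP; apply: measurable_funX; apply: measurable_funB => //.
    exact: (L2S k).1.
  rewrite (ge0_negligible_integral (N := ~` Zc))//; last 2 first.
  - exact: measurableC.
  - by move=> x _; rewrite lee_fin sqr_ge0.
  rewrite setDE setCK setTI.
  have mD m : measurable_fun setT (fun x => ((S (k + m)%N x - S k x) ^+ 2)%:E).
    by apply/measurable_EFinP; apply: measurable_funX; exact: (L2B (L2S _) (L2S _)).1.
  rewrite (eq_integral (fun x => limn_einf (fun m => ((S (k + m)%N x - S k x) ^+ 2)%:E)));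
    last first.
    move=> x; rewrite inE => Zx.
    have cv : (fun m => ((S (k + m)%N x - S k x) ^+ 2)%:E) @ \oo --> ((v x - S k x) ^+ 2)%:E.
      apply: cvg_EFin; first exact: nearW.
      have cS : (fun m => S (k + m)%N x - S k x) @ \oo --> v x - S k x.
        apply: cvgB; last exact: cvg_cst.
        rewrite (_ : (fun m => S (k + m)%N x) = (fun m => S (m + k)%N x)).
          by have := cvgv1 _ Zx; rewrite -(cvg_shiftn k).
        by apply/funext => m; rewrite addnC.
      exact: (cvgM cS cS).
    rewrite is_cvg_limn_einfE; last by apply: cvgP cv.
    by apply/esym/cvg_lim.
  apply: le_trans (fatou mu mZc _ _) _.
  - by move=> m; exact: measurable_funTS.
  - by move=> m x _; rewrite lee_fin sqr_ge0.
  rewrite limn_einf_lim; apply: lime_le; first exact: is_cvg_einfs.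
  near=> m; apply: (@le_trans _ _ (\int[mu]_(x in Zc) ((S (k + m)%N x - S k x) ^+ 2)%:E)%E).
    by apply: ereal_inf_lbound; exists m => //=.
  apply: (@le_trans _ _ (\int[mu]_x ((S (k + m)%N x - S k x) ^+ 2)%:E)%E).
    apply: ge0_subset_integral => //.
    by move=> x _; rewrite lee_fin sqr_ge0.
  have [_ /(integrable_fin_num measurableT) fn] := L2B (L2S (k + m)%N) (L2S k).
  rewrite -(fineK fn) lee_fin -[fine _]/(sqn (fun x => S (k + m)%N x - S k x)).
  rewrite -[leLHS]sqr_sqrtr ?sqn_ge0// ler_pXn2r ?nnegrE ?sqrtr_ge0 ?tail_le//.
  by rewrite mulr_ge0// exprn_ge0// ltW.
have vS k : L2 (fun x => v x - S k x).
  split; first by apply: measurable_funB => //; exact: (L2S k).1.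
  apply/integrableP; split.
    apply/measurable_EFinP; apply: measurable_funX; apply: measurable_funB => //.
    exact: (L2S k).1.
  under eq_integral do rewrite /= ger0_norm ?sqr_ge0//.
  by apply: le_lt_trans (main k) _; rewrite ltry.
exists v; split.
  rewrite (_ : v = fun x => (v x - S 0%N x) + S 0%N x); first exact: L2D.
  by apply/funext => x; rewrite subrK.
move=> k; rewrite -(@ler_pXn2r _ 2) ?nnegrE ?sqrtr_ge0//; last first.
  by rewrite mulr_ge0// exprn_ge0// ltW.
rewrite sqr_sqrtr ?sqn_ge0// -lee_fin.
have [_ /(integrable_fin_num measurableT) fn] := vS k.
by rewrite /sqn /Rintegral fineK//; exact: main.
Unshelve. all: by end_near. Qed.

End L2_series.

(* Sokal's proof of the uniform boundedness principle *)
Lemma weakly_bounded (f : nat -> T -> R) : (forall n, L2 (f n)) ->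
  (forall g, L2 g -> exists M, forall n, `|\int[mu]_x (f n x * g x)| <= M) ->
  exists C, forall n, sqn (f n) <= C.
Proof.
move=> fL2 wb; apply: contrapT => nb.
pose nm n := Num.sqrt (sqn (f n)).
have h0 : 0 < h by rewrite invr_gt0.
have big (C : R) : exists n, C < nm n.
  apply: contrapT => /forallNP nC; apply: nb; exists (C ^+ 2) => n.
  have := nC n; move=> /negP; rewrite -leNgt => le.
  have C0 : 0 <= C by apply: le_trans le; exact: sqrtr_ge0.
  by rewrite -[sqn _]sqr_sqrtr ?sqn_ge0// ler_pXn2r ?nnegrE ?sqrtr_ge0.
(* The norms must beat the loss 2 * 3^k of the construction by the unbounded factor k + 1. *)
have [N HN] := choice (fun k : nat => big (2 * k.+1%:R * h ^- k)).
have nm0 k : 0 < nm (N k).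
  apply: le_lt_trans (HN k); apply: mulr_ge0; first by rewrite mulr_ge0.
  by rewrite invr_ge0 exprn_ge0// ltW.
pose e k x := h ^+ k / nm (N k) * f (N k) x.
have eL2 k : L2 (e k).
  exact: L2Z.
have en k : Num.sqrt (sqn (e k)) = h ^+ k.
  rewrite /e sqnZ// sqrtrM ?sqr_ge0// sqrtr_sqr ger0_norm; last first.
    by rewrite divr_ge0 ?exprn_ge0// ltW.
  by rewrite -/(nm _) divfK// gt_eqF.
pose ip g k := \int[mu]_x (f (N k) x * g x).
(* The k-th hump is added with the sign that its inner product with f_(N k) shares with that of the
   partial sum so far, so the two contributions cannot cancel. *)
pose sgn k (g : T -> R) : R := if 0 <= ip g k then 1 else -1.
pose step k (g : T -> R) : T -> R := fun x => g x + sgn k g * e k x.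
pose V := fix V k : T -> R := if k is k'.+1 then step k' (V k') else (fun=> 0).
pose c k x := sgn k (V k) * e k x.
have sgn2 k g : sgn k g ^+ 2 = 1 by rewrite /sgn; case: ifP; rewrite ?sqrrN expr1n.
have cL2 k : L2 (c k) by exact: L2Z.
have cn k : Num.sqrt (sqn (c k)) <= h ^+ k by rewrite /c sqnZ// sgn2 mul1r en.
have VE k x : V k x = \sum_(j < k) c j x.
  elim: k => [|k ih]; first by rewrite big_ord0.
  by rewrite big_ord_recr/= -ih.
have VL2 k : L2 (V k).
  elim: k => [|k ih]; last exact: (L2D ih (cL2 k)).
  split; first exact: measurable_cst.
  by apply: eq_integrable (integrable0 mu setT) => // x _ /=; rewrite expr0n.
have [v [vL2 vt]] := L2_series cL2 cn.
have [M HM] := wb _ vL2.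
have ipV k : h ^+ k * nm (N k) <= `|ip (V k.+1) k|.
  have -> : ip (V k.+1) k = ip (V k) k + sgn k (V k) * (h ^+ k * nm (N k)).
    have -> : sgn k (V k) * (h ^+ k * nm (N k)) = sgn k (V k) * (h ^+ k / nm (N k)) * sqn (f (N
      k)).
      rewrite -[sqn _]sqr_sqrtr ?sqn_ge0// -/(nm _); field.
      by rewrite gt_eqF.
    rewrite /ip /sqn -RintegralZl//; last exact: (fL2 _).2.
    rewrite -RintegralD//; [|exact: L2_mul|exact: (integrableZl measurableT _ (fL2 _).2)].
    by apply: eq_Rintegral => x _; rewrite /= /step /e; ring.
  have p0 : 0 <= h ^+ k * nm (N k) by rewrite mulr_ge0 ?exprn_ge0// ltW.
  rewrite /sgn; case: ifPn => [i0|]; first by rewrite mul1r ger0_norm ?addr_ge0// lerDr.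
  rewrite -ltNge => i0; rewrite mulN1r ltr0_norm; last by rewrite ltr_wnDr// oppr_le0.
  by rewrite opprD opprK lerDr oppr_ge0 ltW.
(* The humps after the k-th one have total norm at most h^k / 2 and can destroy at most half of what
   [ipV] gives. *)
have ipv k : h ^+ k * nm (N k) / 2 <= `|ip v k|.
  have vVL2 : L2 (fun x => v x - V k.+1 x).
    rewrite (_ : (fun x => _) = (fun x => v x + (-1) * V k.+1 x)).
      by apply: L2D => //; exact: L2Z.
    by apply/funext => x; rewrite mulN1r.
  have E : ip v k = ip (V k.+1) k + ip (fun x => v x - V k.+1 x) k.
    rewrite /ip -RintegralD//; [|exact: L2_mul|exact: L2_mul].
    by apply: eq_Rintegral => x _; rewrite -mulrDr addrC subrK.
  have t : `|ip (fun x => v x - V k.+1 x) k| <= h ^+ k * nm (N k) / 2.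
    apply: le_trans (cauchy_schwarz (fL2 _) vVL2) _; rewrite -/(nm _).
    have := vt k.+1; rewrite (_ : (fun x => v x - \sum_(j < k.+1) c j x) =
      (fun x => v x - V k.+1 x)); last first.
      by apply/funext => x; rewrite VE.
    move=> /(ler_wpM2l (ltW (nm0 k))) /le_trans; apply.
    by rewrite exprS /h le_eqVlt; apply/orP; left; apply/eqP; field.
  have := ipV k; rewrite E => p.
  have := ler_normB (ip (V k.+1) k + ip (fun x => v x - V k.+1 x) k) (ip (fun x =>
    v x - V k.+1 x) k).
  rewrite addrK => q; lra.
have contra k : k.+1%:R <= M.
  apply: le_trans (HM (N k)); apply: le_trans (ipv k).
  have := HN k; rewrite ltr_pdivrMr ?exprn_gt0// => q.
  by rewrite ler_pdivlMr// mulrC [leRHS]mulrC ltW.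
have [k Mk] : exists k : nat, M < k%:R.
  by exists (Num.truncn `|M|).+1; apply: le_lt_trans (ler_norm _) (truncnS_gt _).
by have := contra k; rewrite leNgt (lt_trans Mk)// ltr_nat.
Qed.

End square_integrable.

(** * Test functions *)

Section flat_functions.
Variable R : realType.
Implicit Types (s t : R) (k : nat).

(** The powers of 1/t are included because differentiation produces them: by [is_derive_flat] the
    linear combinations of these functions are stable under derivatives. *)
Definition flat k t : R := if 0 < t then t^-1 ^+ k * expR (- t^-1) else 0.

(** With s = 1/t this is s^(k+2) <= (k+2)! exp s, one term of the exponential series. A quadratic
    bound at 0 gives derivative 0 there. *)
Lemma flat_le k t : `|flat k t| <= (k.+2)`!%:R * t ^+ 2.
Proof.
rewrite /flat; case: ifPn => t0; last by rewrite normr0 mulr_ge0// sqr_ge0.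
rewrite ger0_norm; last by rewrite mulr_ge0 ?expR_ge0// exprn_ge0// invr_ge0 ltW.
set s := t^-1; have s0 : 0 < s by rewrite invr_gt0.
have E : s ^+ k.+2 <= (k.+2)`!%:R * expR s.
  rewrite mulrC -ler_pdivrMr ?ltr0n ?fact_gt0//.
  by have := expR_ge1Dxn k.+1 (ltW s0); apply: le_trans; rewrite lerDr.
rewrite expRN ler_pdivrMr ?expR_gt0// mulrAC -ler_pdivrMr ?exprn_gt0//.
by rewrite -exprVn -/s -exprD addn2.
Qed.

Lemma flat_ge0 k t : 0 <= flat k t.
Proof.
rewrite /flat; case: ifPn => // t0.
by rewrite mulr_ge0 ?expR_ge0// exprn_ge0// invr_ge0 ltW.
Qed.

Lemma is_derive_flat k t :
  is_derive t (1 : R) (flat k) (flat k.+2 t - k%:R * flat k.+1 t).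
Proof.
have [t0|t0|->] := ltgtP t 0.
- rewrite [X in is_derive _ _ _ X](_ : _ = 0); last first.
    by rewrite /flat ltNge ltW//= mulr0 subrr.
  apply: (@near_eq_is_derive _ _ _ (cst 0)).
  near=> y; rewrite /flat ifF//; apply/negbTE; rewrite -leNgt; near: y.
  exact: lt_le_nbhsl.
- have tn0 : t != 0 by rewrite gt_eqF.
  apply: (@near_eq_is_derive _ _ _ (fun t => t^-1 ^+ k * expR (- t^-1))).
    near=> y; rewrite /flat ifT//; near: y; exact: lt_nbhsr.
  have dV : is_derive t (1 : R) (fun t => t^-1) (- t ^- 2).
    have di := @derivable_id _ _ t (1 : R).
    split; first exact: (@derivableV _ _ id t 1 tn0 di).
    by rewrite (@deriveV _ _ id t 1 tn0 di) derive_id /GRing.scale/= mulr1.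
  have dX := @is_deriveX _ _ (fun t => t^-1) k t 1 _ dV.
  have dE := @is_derive1_comp _ expR (fun t => - t^-1) t _ _ (is_derive_expR _) (is_deriveN dV).
  have dM := is_deriveM dX dE.
  rewrite (_ : (fun t => _) = (fun t => t^-1) ^+ k * (expR \o (fun t => - t^-1))); last first.
    by apply/funext => y; rewrite !fctE.
  apply: (is_derive_eq dM).
  rewrite /flat t0 /GRing.scale/=.
  rewrite !fctE; case: k {dX dM} => [|k]; first by rewrite !expr0 mul0r /=; field.
  by rewrite /= !exprS; field.
- have F0 n : flat n 0 = 0 by rewrite /flat ltxx.
  rewrite !F0 mulr0 subr0.
  have C : (fun h => h^-1 *: ((flat k \o shift 0) (h *: (1 : R)) - flat k 0)) @ 0^' --> (0 : R).
    apply: norm_cvg0; apply: (@squeeze_cvgr _ _ _ _ (fun=> 0) (fun h => (k.+2)`!%:R * `|h|)).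
    - near=> h; rewrite normr_ge0/= F0 subr0 addr0 /GRing.scale/= mulr1 normrM normfV.
      have h0 : h != 0 by near: h; exact: nbhs_dnbhs_neq.
      rewrite mulrC ler_pdivrMr ?normr_gt0// -mulrA -expr2 real_normK ?num_real//.
      exact: flat_le.
    - exact: cvg_cst.
    - rewrite -[X in _ --> X](mulr0 (k.+2)`!%:R); apply: cvgMr.
      rewrite -{2}(@normr0 _ R); apply: cvg_norm; exact: nbhs_dnbhs.
  split; first by apply/cvg_ex; exists 0.
  exact: cvg_lim C.
Unshelve. all: by end_near. Qed.

Inductive flat_comb : (R -> R) -> Prop :=
| flat_base k : flat_comb (flat k)
| flat_lin f g (c : R) of flat_comb f & flat_comb g : flat_comb (fun t => f t + c * g t).

Lemma smooth1_flat : smooth1 (flat 0).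
Proof.
exists flat_comb; first exact: flat_base.
move=> f; elim=> [k|{}f g c _ [f' cf' df] _ [g' cg' dg]].
  exists (fun t => flat k.+2 t + (- k%:R) * flat k.+1 t).
    by apply: flat_lin; exact: flat_base.
  by move=> t; rewrite mulNr; exact: is_derive_flat.
exists (fun t => f' t + c * g' t); first exact: flat_lin.
by move=> t; apply: is_derive_eq.
Qed.

Lemma flat0E t : flat 0 t = if 0 < t then expR (- t^-1) else 0.
Proof. by rewrite /flat expr0 mul1r. Qed.

Lemma flat0_le1 t : flat 0 t <= 1.
Proof.
by rewrite flat0E; case: ifP => // t0; rewrite expR_le1 oppr_le0 invr_ge0 ltW.
Qed.

Lemma flat0_mono s t : s <= t -> flat 0 s <= flat 0 t.
Proof.
move=> st; rewrite !flat0E; case: ifP => s0; last by case: ifP => _ //; exact: expR_ge0.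
rewrite (lt_le_trans s0 st) ler_expR lerN2 lef_pV2 ?posrE//.
exact: lt_le_trans st.
Qed.

Let c : R := flat 0 1.

(** A smooth step obtained by composing [flat 0] with itself, so that no quotient of functions has
    to be differentiated. Since c = [flat 0 1], the inner difference is c for t <= 0 and is not
    positive for t >= 1. *)
Definition ramp t : R := 1 - (flat 0 c)^-1 * flat 0 (c - flat 0 t).

Let c0 : 0 < c.
Proof. by rewrite /c flat0E ltr01 expR_gt0. Qed.

Let fc0 : 0 < flat 0 c.
Proof. by rewrite flat0E c0 expR_gt0. Qed.

Lemma ramp0 t : t <= 0 -> ramp t = 0.
Proof.
by move=> t0; rewrite /ramp [flat 0 t]flat0E ltNge t0 subr0 mulVf ?subrr// gt_eqF.
Qed.

Lemma ramp1 t : 1 <= t -> ramp t = 1.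
Proof.
move=> t1; rewrite /ramp [flat 0 (_ - _)]flat0E ifF ?mulr0 ?subr0//.
by apply/negbTE; rewrite -leNgt subr_le0; exact: flat0_mono.
Qed.

Lemma ramp_ge0 t : 0 <= ramp t.
Proof.
rewrite /ramp subr_ge0 mulrC ler_pdivrMr// mul1r flat0_mono//.
by rewrite gerBl flat_ge0.
Qed.

Lemma ramp_le1 t : ramp t <= 1.
Proof. by rewrite gerBl mulr_ge0 ?flat_ge0// invr_ge0 ltW. Qed.

End flat_functions.

Section bumps.
Variables (R : realType) (d : nat).
Local Notation V := ('rV[R]_d).
Implicit Types (x y : V) (f : V -> R).

Lemma rsmooth_scal (k : R) f : rsmooth f -> rsmooth (fun x => k * f x).
Proof. by move=> sf; apply: rsmoothM sf; exact: rsmooth_cst. Qed.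

Lemma rsmooth_flat f : rsmooth f -> rsmooth (fun x => flat 0 (f x)).
Proof. by move=> sf; apply: rsmooth_comp sf; exact: smooth1_flat. Qed.

Lemma rsmooth_ramp f : rsmooth f -> rsmooth (fun x => ramp (f x)).
Proof.
move=> sf; apply: (@rsmoothD _ _ (fun=> 1) (fun x => - _)); first exact: rsmooth_cst.
apply: rsmoothN; apply: rsmooth_scal; apply: rsmooth_flat.
apply: (@rsmoothD _ _ (fun=> _) (fun x => - _)); first exact: rsmooth_cst.
by apply: rsmoothN; exact: rsmooth_flat.
Qed.

Lemma rsmooth_affine (k e : R) i : rsmooth (fun x => k * (x 0 i - e)).
Proof.
apply: rsmooth_scal; apply: (@rsmoothD _ _ (fun x => x 0 i) (fun x => - e)).
  exact: rsmooth_coord.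
exact: rsmooth_cst.
Qed.

(* As N grows this increases to the indicator of the open box ]a, b[. *)
Definition box_bump (N : R) (a b : V) x : R :=
  \prod_(i < d) (flat 0 (N * (x 0 i - a 0 i)) * flat 0 (- N * (x 0 i - b 0 i))).

Lemma rsmooth_box_bump N a b : rsmooth (box_bump N a b).
Proof.
apply: rsmooth_prod => i.
by apply: rsmoothM; apply: rsmooth_flat; exact: rsmooth_affine.
Qed.

Definition obox (a b : V) : set V := [set x | forall i, a 0 i < x 0 i < b 0 i].
Definition cbox (a b : V) : set V := [set x | forall i, a 0 i <= x 0 i <= b 0 i].

Lemma box_bump_out N a b x : 0 < N -> ~ obox a b x -> box_bump N a b x = 0.
Proof.
move=> N0 /existsNP[i /negP]; rewrite negb_and -!leNgt => h.
apply/eqP; rewrite prodf_seq_eq0; apply/hasP; exists i; rewrite ?mem_index_enum//=.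
rewrite mulf_eq0 !flat0E; case/orP: h => h.
  by rewrite pmulr_rgt0// subr_gt0 ltNge h eqxx.
suff -> : (0 < - N * (x 0 i - b 0 i)) = false by rewrite eqxx orbT.
by rewrite mulNr -mulrN opprB pmulr_rgt0// subr_gt0 ltNge h.
Qed.

Lemma box_bump_ge0 N a b x : 0 <= box_bump N a b x.
Proof. by apply: prodr_ge0 => i _; rewrite mulr_ge0 ?flat_ge0. Qed.

Lemma box_bump_le1 N a b x : box_bump N a b x <= 1.
Proof.
apply: prodr_ile1 => i _; rewrite mulr_ge0 ?flat_ge0//=.
by rewrite mulr_ile1 ?flat_ge0// flat0_le1.
Qed.

Lemma cvg_flat_scale (s : R) : 0 < s -> (fun n : nat => flat 0 (n.+1%:R * s)) @ \oo --> (1 : R).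
Proof.
move=> s0.
have E : (fun n : nat => flat 0 (n.+1%:R * s)) = (fun n => expR (- (s^-1 * harmonic n))).
  apply/funext => n; rewrite flat0E pmulr_rgt0// s0 invfM /harmonic.
  by rewrite mulrC.
have cu : (fun n => - (s^-1 * harmonic n)) @ \oo --> (0 : R).
  rewrite -[X in _ --> X]oppr0; apply: cvgN; rewrite -[X in _ --> X](mulr0 s^-1); apply: cvgMr.
  exact: cvg_harmonic.
by rewrite E -[X in _ --> X]expR0; exact: (cvg_comp _ _ cu (@continuous_expR R 0)).
Qed.

Lemma cvg_box_bump a b x :
  (fun n : nat => box_bump n.+1%:R a b x) @ \oo --> (\1_(obox a b) x : R).
Proof.
have [xab|nx] := pselect (obox a b x); last first.
  rewrite indicE memNset// (_ : (fun n => _) = fun=> 0); first exact: cvg_cst.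
  by apply/funext => n; rewrite box_bump_out.
rewrite indicE mem_set//.
have H (s : seq 'I_d) : (fun n : nat => \prod_(i <- s) (flat 0 (n.+1%:R * (x 0 i - a 0 i)) *
    flat 0 (- n.+1%:R * (x 0 i - b 0 i)))) @ \oo --> (1 : R).
  elim: s => [|i s ih].
    by under eq_fun do rewrite big_nil; exact: cvg_cst.
  under eq_fun do rewrite big_cons.
  have /andP[h1 h2] := xab i.
  have c1 : (fun n : nat => flat 0 (n.+1%:R * (x 0 i - a 0 i))) @ \oo --> (1 : R).
    by apply: cvg_flat_scale; rewrite subr_gt0.
  have c2 : (fun n : nat => flat 0 (- n.+1%:R * (x 0 i - b 0 i))) @ \oo --> (1 : R).
    by under eq_fun do rewrite mulNr -mulrN opprB; apply: cvg_flat_scale; rewrite subr_gt0.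
  have L := cvgM (cvgM c1 c2) ih; rewrite !mulr1 in L; exact: L.
exact: (H (index_enum 'I_d)).
Qed.

Lemma cbox_compact a b : compact (cbox a b).
Proof.
rewrite (_ : cbox a b = [set v : V | forall i, `[a 0 i, b 0 i]%classic (v 0 i)]).
  by apply: (@rV_compact _ _ (fun i => `[a 0 i, b 0 i]%classic)) => i; exact: segment_compact.
by apply/seteqP; split => x h i; have := h i; rewrite /= in_itv.
Qed.

Lemma obox_sub_cbox a b : obox a b `<=` cbox a b.
Proof. by move=> x h i; have /andP[h1 h2] := h i; rewrite !ltW. Qed.

Lemma test_box_bump (Omega : set V) N a b : 0 < N -> cbox a b `<=` Omega ->
  test_function Omega (fun x => (box_bump N a b x)%:C).
Proof.
move=> N0 sub; split; first by apply: smooth_real; exact: rsmooth_box_bump.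
exists (cbox a b); split => //; first exact: cbox_compact.
move=> x nx; rewrite box_bump_out// => /obox_sub_cbox; exact: nx.
Qed.

(* Equal to 1 on the cube of radius rho around y, supported in the cube of radius 2 rho. *)
Definition plateau (rho : R) y x : R :=
  \prod_(i < d) (ramp (rho^-1 * (x 0 i - (y 0 i - 2 * rho))) *
    ramp (- rho^-1 * (x 0 i - (y 0 i + 2 * rho)))).

Lemma rsmooth_plateau rho y : rsmooth (plateau rho y).
Proof.
by apply: rsmooth_prod => i; apply: rsmoothM; apply: rsmooth_ramp; exact: rsmooth_affine.
Qed.

Lemma plateau_ge0 rho y x : 0 <= plateau rho y x.
Proof. by apply: prodr_ge0 => i _; rewrite mulr_ge0 ?ramp_ge0. Qed.

Lemma plateau_le1 rho y x : plateau rho y x <= 1.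
Proof.
apply: prodr_ile1 => i _; rewrite mulr_ge0 ?ramp_ge0//=.
by rewrite mulr_ile1 ?ramp_ge0// ramp_le1.
Qed.

Lemma plateau1 rho y x : 0 < rho -> (forall i, `|x 0 i - y 0 i| <= rho) -> plateau rho y x = 1.
Proof.
move=> r0 h; apply: big1 => i _; have := h i; rewrite ler_norml => /andP[h1 h2].
by rewrite !ramp1 ?mulr1// ?mulNr -?mulrN ?opprB mulrC ler_pdivlMr// mul1r; lra.
Qed.

Lemma plateau0 rho y x : 0 < rho -> (exists i, 2 * rho <= `|x 0 i - y 0 i|) ->
  plateau rho y x = 0.
Proof.
move=> r0 [j]; rewrite ler_normr => h.
apply/eqP; rewrite prodf_seq_eq0; apply/hasP; exists j; rewrite ?mem_index_enum//=.
rewrite mulf_eq0; case/orP: h => h; apply/orP; [right|left]; rewrite ramp0//.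
  by rewrite mulNr oppr_le0; apply: mulr_ge0; [rewrite invr_ge0 ltW|lra].
by rewrite pmulr_rle0 ?invr_gt0//; lra.
Qed.

(** The class used carries a scalar factor, because each derivative of a dilated function brings out
    a factor [w]. *)
Lemma rsmooth_dilate (w : R) f : rsmooth f -> rsmooth (fun x => f (w *: x)).
Proof.
move=> sf; apply: (@rsmooth_class _ _ (fun g => exists k f,
  rsmooth f /\ g = fun x => k * f (w *: x))); last first.
  by exists 1, f; split => //; apply/funext => x; rewrite mul1r.
move=> _ [k [{}f [{}sf ->]]].
have D i x : is_derive x (bvec R i) (fun x => k * f (w *: x)) (k * (w * 'D_(bvec R i) f (w *:
  x))).
  apply: is_derive_line.
  have dl := is_derive_line_inv (@rsmooth_derivable _ _ f i (w *: x) sf).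
  set g := (fun h : R => f (h *: bvec R i + w *: x)) in dl.
  have -> : (fun h : R => k * f (w *: (h *: bvec R i + x))) =
    (fun h => k * (g \o (fun h => w * h)) h).
    by apply/funext => h; rewrite /g /= scalerDr scalerA.
  have dw : is_derive (0 : R) (1 : R) (fun h : R => w * h) w.
    by apply: is_derive_eq; rewrite /GRing.scale/= mulr1.
  have dg : is_derive ((fun h : R => w * h) 0) (1 : R) g ('D_(bvec R i) f (w *: x)) by rewrite
    mulr0.
  have dgw := is_derive1_comp dg dw.
  by apply: is_derive_eq; rewrite /GRing.scale/= [w * _]mulrC.
split.
  move=> x.
  have cf : {for x, continuous (fun x => f (w *: x))}.
    by apply: continuous_comp; [exact: scaler_continuous|exact: rsmooth_continuous].
  exact: (cvgM (cvg_cst k) cf).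
move=> i; split; first by move=> x; have [] := D i x.
exists (k * w), ('D_(bvec R i) f); split; first exact: rsmooth_derive.
by apply/funext => x; have [_ ->] := D i x; rewrite mulrA.
Qed.

Lemma smooth_dilate (w : R) (phi : V -> R[i]) : smooth phi -> smooth (fun x => phi (w *: x)).
Proof. by move=> [p1 p2]; split; [exact: rsmooth_dilate p1|exact: rsmooth_dilate p2]. Qed.

Lemma compact_ubound (K : set V) f : compact K -> continuous f -> exists M, 0 <= M /\ forall x,
  K x -> `|f x| <= M.
Proof.
move=> cK cf.
have /compact_bounded[M [_ HM]] : compact (f @` K).
  by apply: continuous_compact => //; apply: continuous_subspaceT.
exists (`|M| + 1); split; first by rewrite addr_ge0.
move=> x Kx; apply: (HM (`|M| + 1)); last by exists x.
by rewrite (le_lt_trans (ler_norm _))// ltrDl.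
Qed.

Lemma smooth_bounded (K : set V) (phi : V -> R[i]) : smooth phi -> compact K ->
  exists M, 0 <= M /\ forall x, K x -> normc (phi x) <= M.
Proof.
move=> [p1 p2] cK.
have [M1 [M10 H1]] := compact_ubound cK (rsmooth_continuous p1).
have [M2 [M20 H2]] := compact_ubound cK (rsmooth_continuous p2).
exists (M1 + M2); split; first by rewrite addr_ge0.
by move=> x Kx; apply: le_trans (normc_le _) _; apply: lerD; [exact: H1|exact: H2].
Qed.

Lemma schwartz_compact (K : set V) (psi : V -> R[i]) : smooth psi -> compact K ->
  vanishes_outside K psi -> schwartz psi.
Proof.
move=> sp cK vK; split => // N s.
have cl : closed K by exact: compact_closed (@norm_hausdorff _ _) cK.
have vs : vanishes_outside K (cpderivs s psi).
  elim/last_ind: s psi {sp} vK => [|s i ih] psi vK.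
    by move=> x nx; apply: complexP => /=; rewrite vK.
  by rewrite cpderivs_rcons; apply: ih; exact: vanishes_cderive.
have [M1 [M10 H1]] := smooth_bounded (smooth_cpderivs s sp) cK.
have [L [L0 HL]] := compact_sub_cube cK.
exists ((1 + Num.sqrt (d%:R * L ^+ 2)) ^+ N * M1) => x.
rewrite normr_normc -RcM lecR.
have e0 : 0 <= 1 + enorm x by rewrite addr_ge0// sqrtr_ge0.
have [Kx|nKx] := pselect (K x); last first.
  by rewrite vs// Normc.normc0 mulr0 mulr_ge0// exprn_ge0// addr_ge0// sqrtr_ge0.
apply: ler_pM; [exact: exprn_ge0|exact: normc_ge0| |exact: H1].
apply: lerXn2r; rewrite ?nnegrE ?addr_ge0 ?sqrtr_ge0//.
rewrite lerD2l ler_wsqrtr// /dotp.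
apply: (@le_trans _ _ (\sum_(i < d) L ^+ 2)); last by rewrite sumr_const card_ord mulr_natl.
apply: ler_sum => i _; rewrite -expr2 -[x 0 i ^+ 2]real_normK ?num_real//.
by apply: lerXn2r; rewrite ?nnegrE// HL.
Qed.

End bumps.

(** * Pairings at the scale w *)

Section pairing.
Variables (R : realType) (d : nat).
Local Notation V := ('rV[R]_d).
Local Notation Leb := (lebesgue_rV R d).
Local Notation L1 := (cintegrable Leb setT).
Implicit Types (a b phi psi F : V -> R[i]) (w : R) (x xi eta : V).

(** Square integrable functions of bounded support, the form in which localized sequences such as
    phi u_n enter the pairings. *)
Definition L2c a := [/\ cmeasurable_fun setT a,
  exists M, 0 <= M /\ vanishes_outside (cube M) a &
  Leb.-integrable setT (EFin \o (fun x => normc (a x) ^+ 2))].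

Definition N2 a : R := \int[Leb]_x (normc (a x) ^+ 2).

Lemma integrable_cube (M : R) : Leb.-integrable setT (EFin \o (\1_(@cube R d M) : V -> R)).
Proof.
apply/integrableP; split.
  by apply/measurable_EFinP; apply: measurable_indic; exact: cube_measurable.
rewrite (eq_integral (EFin \o \1_(cube M))).
  by rewrite integral_indic ?setIT//; [exact: cube_fin|exact: cube_measurable].
by move=> x _ /=; rewrite ger0_norm// indicE.
Qed.

(** On the cube, which has finite volume, |a| is at most 1 + |a|^2. *)
Lemma L2c_L1c a : L2c a -> L1c a.
Proof.
move=> [ma [M [M0 vM]] a2]; split; last by exists M.
apply: (@le_cintegrable _ _ _ Leb setT a (fun x => \1_(@cube R d M) x + normc (a x) ^+ 2)).
- exact: measurableT.
- exact: ma.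
- move=> x _; have [Mx|nMx] := pselect (cube M x).
    rewrite indicE mem_set//=; have := sqr_ge0 (normc (a x) - 1); have := normc_ge0 (a x); nra.
  by rewrite vM// Normc.normc0 expr0n addr0 indicE.
- exact: (integrableD measurableT (integrable_cube M) a2).
Qed.

Lemma expabsv_scale w x : 0 < w -> expabsv w x = expabsv 1 (w *: x).
Proof.
by move=> w0; apply: eq_bigr => i _; rewrite /expabs !mxE mul1r normrM gtr0_norm.
Qed.

(** The damping is split into two square roots, one for each factor of [pair], so that the
    Cauchy-Schwarz inequality applies. *)
Lemma bessel_L2 a w : 0 < w -> L2c a ->
  let f := fun xi => normc (fourier a xi) * Num.sqrt (expabsv w xi) in
  L2 Leb f /\ sqn Leb f <= N2 a.
Proof.
move=> w0 la f; have [ia _] := L2c_L1c la; have [ma _ a2] := la.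
have B := bessel w0 ia.
have fE xi : f xi ^+ 2 = normc (fourier a xi) ^+ 2 * expabsv w xi.
  by rewrite /f exprMn (sqr_sqrtr (ltW (expabsv_gt0 _ _))).
have mf : measurable_fun setT f.
  apply: measurable_funM; first by apply: cmeasurable_normc; exact: fourier_cmeasurable.
  have ms : measurable_fun setT (@Num.sqrt R) by apply: continuous_measurable_fun;
    exact: sqrt_continuous.
  exact: (measurableT_comp ms (measurable_expabsv w)).
have N2E : (\int[Leb]_x (normc (a x) ^+ 2)%:E = (N2 a)%:E)%E.
  by rewrite /N2 /Rintegral fineK//; exact: (integrable_fin_num measurableT a2).
have f2 : Leb.-integrable setT (EFin \o (fun x => f x ^+ 2)).
  apply/integrableP; split; first by apply/measurable_EFinP; exact: measurable_funX.
  rewrite (eq_integral (fun xi => (normc (fourier a xi) ^+ 2 * expabsv w xi)%:E)).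
    by apply: le_lt_trans B _; rewrite N2E ltry.
  by move=> xi _ /=; rewrite ger0_norm ?sqr_ge0// fE.
split => //.
rewrite -lee_fin -N2E; apply: le_trans B; rewrite /sqn /Rintegral fineK.
  by under eq_integral do rewrite fE.
exact: (integrable_fin_num measurableT f2).
Qed.

Definition TF psi := smooth psi /\ exists M, 0 <= M /\ vanishes_outside (@cube R d M) psi.

Lemma cube_compact (M : R) : compact (@cube R d M).
Proof.
rewrite (_ : cube M = [set v : V | forall i, `[- M, M]%classic (v 0 i)]).
  by apply: (@rV_compact _ _ (fun=> `[- M, M]%classic)) => i; exact: segment_compact.
by apply/seteqP; split => x h i; have := h i; rewrite /= in_itv/= -ler_norml.
Qed.

(** On the cube each of the d factors of [expabsv 1] is at least exp(-M). After dilation, psi(w xi)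
    is dominated by [expabsv w xi] with a constant that does not depend on [w]. *)
Lemma TF_expabsv psi : TF psi ->
  exists C, 0 <= C /\ forall eta, normc (psi eta) <= C * expabsv 1 eta.
Proof.
move=> [sp [M [M0 vM]]].
have [B [B0 HB]] := smooth_bounded sp (@cube_compact M).
exists (B * expR M ^+ d); split; first by rewrite mulr_ge0// exprn_ge0// expR_ge0.
move=> eta; have [Me|nMe] := pselect (cube M eta); last first.
  by rewrite vM// Normc.normc0 mulr_ge0 ?(ltW (expabsv_gt0 _ _))// mulr_ge0// exprn_ge0//
    expR_ge0.
rewrite -mulrA -[leLHS]mulr1; apply: ler_pM => //; [exact: normc_ge0|exact: HB|].
have -> : expR M ^+ d = \prod_(i < d) expR M by rewrite prodr_const card_ord.
rewrite /expabsv -big_split/=; apply: (big_ind (fun t : R => 1 <= t)) => //.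
  by move=> s t s1 t1; rewrite -[1]mulr1 ler_pM.
move=> i _; rewrite /expabs mul1r -expRD -[1]expR0 ler_expR subr_ge0.
exact: Me.
Qed.

Lemma TF_measurable psi : TF psi -> cmeasurable_fun setT psi.
Proof. by move=> [sp _]; exact: smooth_cmeasurable. Qed.

Definition pair a b psi w : R[i] :=
  cintegral Leb setT (fun xi => fourier a xi * conjc (fourier b xi) * psi (w *: xi)).

Lemma scale_measurable w : measurable_fun setT (fun x : V => w *: x).
Proof. by apply: continuous_measurable_rV; exact: scaler_continuous. Qed.

Lemma cmeasurable_dilate psi w : TF psi -> cmeasurable_fun setT (fun xi => psi (w *: xi)).
Proof.
by move=> /TF_measurable mp; exact: (cmeasurable_comp (scale_measurable w) mp).
Qed.

Section pair_bound.
Variables (a b psi : V -> R[i]) (w C : R).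
Hypotheses (w0 : 0 < w) (la : L2c a) (lb : L2c b) (tp : TF psi).
Hypotheses (C0 : 0 <= C) (pC : forall eta, normc (psi eta) <= C * expabsv 1 eta).

Let f xi := normc (fourier a xi) * Num.sqrt (expabsv w xi).
Let g xi := normc (fourier b xi) * Num.sqrt (expabsv w xi).

Let le_fg xi : normc (fourier a xi * conjc (fourier b xi) * psi (w *: xi)) <= C * (f xi * g xi).
Proof.
rewrite !Normc.normcM normc_conj /f /g mulrACA -expr2 (sqr_sqrtr (ltW (expabsv_gt0 _ _))).
rewrite mulrCA ler_wpM2l ?mulr_ge0 ?normc_ge0//.
by rewrite expabsv_scale.
Qed.

Let mpair : cmeasurable_fun setT (fun xi => fourier a xi * conjc (fourier b xi) * psi (w *:
  xi)).
Proof.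
apply: cmeasurableM; last exact: cmeasurable_dilate.
apply: cmeasurableM; first exact: fourier_cmeasurable (L2c_L1c la).1.
exact: cmeasurable_conj (fourier_cmeasurable (L2c_L1c lb).1).
Qed.

Lemma pair_integrable : L1 (fun xi => fourier a xi * conjc (fourier b xi) * psi (w *: xi)).
Proof.
have [lf _] := bessel_L2 w0 la; have [lg _] := bessel_L2 w0 lb.
apply: (@le_cintegrable _ _ _ Leb setT _ (fun xi => C * (f xi * g xi))).
- exact: measurableT.
- exact: mpair.
- by move=> xi _; exact: le_fg.
exact: (integrableZl measurableT C (L2_mul lf lg)).
Qed.

Lemma pair_bound : normc (pair a b psi w) <= C * (Num.sqrt (N2 a) * Num.sqrt (N2 b)).
Proof.
have [lf sf] := bessel_L2 w0 la; have [lg sg] := bessel_L2 w0 lb.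
apply: le_trans (cintegral_normc measurableT pair_integrable) _.
apply: (@le_trans _ _ (C * \int[Leb]_xi (f xi * g xi))).
  rewrite -(RintegralZl C measurableT (L2_mul lf lg)); apply: le_Rintegral.
  - exact: measurableT.
  - exact: cintegrable_normc pair_integrable.
  - exact: (integrableZl measurableT C (L2_mul lf lg)).
  - by move=> xi _; exact: le_fg.
rewrite ler_wpM2l//; apply: le_trans (ler_norm _) _; apply: le_trans (cauchy_schwarz lf lg) _.
by apply: ler_pM; rewrite ?sqrtr_ge0// ler_wsqrtr.
Qed.

End pair_bound.

(** The function W_n of the overview. By [pairE], integrating [a] against it in space is the pairing
    of [a] and [b] in frequency. *)
Definition dualw b psi w : V -> R[i] :=
  fourier (fun xi => conjc (fourier b xi) * psi (w *: xi)).

Lemma L1c_dual b psi w : 0 < w -> L1 b -> TF psi ->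
  L1c (fun xi => conjc (fourier b xi) * psi (w *: xi)).
Proof.
move=> w0 ib tp; have [C [C0 pC]] := TF_expabsv tp.
have mb := cmeasurable_conj (fourier_cmeasurable ib).
have [ie _] := fourier_expabsv (0 : V) w0.
split; last first.
  have [_ [M [M0 vM]]] := tp; exists (M / w); split; first by rewrite divr_ge0// ltW.
  move=> x nx; rewrite vM ?mulr0// => h; apply: nx => i.
  by have := h i; rewrite mxE normrM gtr0_norm// ler_pdivlMr// mulrC.
apply: (@le_cintegrable _ _ _ Leb setT _ (fun xi => (\int[Leb]_x normc (b x)) * C * expabsv w
  xi)).
- exact: measurableT.
- by apply: cmeasurableM; [exact: mb|exact: cmeasurable_dilate].
- move=> xi _; rewrite Normc.normcM normc_conj -mulrA; apply: ler_pM; rewrite ?normc_ge0//.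
    exact: fourier_normc.
  by rewrite expabsv_scale.
- exact: (integrableZl measurableT _ ie.1).
Qed.

Lemma pairE a b psi w : 0 < w -> L1 a -> L1 b -> TF psi ->
  cintegral Leb setT (fun x => a x * dualw b psi w x) = pair a b psi w.
Proof.
move=> w0 ia ib tp; apply: etrans (esym (fourier_swap ia (L1c_dual w0 ib tp).1)) _.
by apply: eq_cintegral => xi _; rewrite mulrA.
Qed.

Lemma smooth_dualw b psi w : 0 < w -> L1 b -> TF psi -> smooth (dualw b psi w).
Proof. by move=> w0 ib tp; apply: smooth_fourier; exact: L1c_dual. Qed.

Lemma smooth_dmul i : smooth (@dmul R d i).
Proof.
split; first exact: rsmooth_cst.
by apply: rsmoothN; apply: rsmooth_scal; exact: rsmooth_coord.
Qed.

Lemma TF_mul (h : V -> R[i]) psi : smooth h -> TF psi -> TF (fun x => h x * psi x).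
Proof.
move=> sh [sp [M [M0 vM]]]; split; first exact: smoothM.
by exists M; split => // x nx; rewrite vM// mulr0.
Qed.

(** The derivative multiplies by a constant times xi_i, and w xi_i is the i-th coordinate of w xi.
    The factor [w] is thus absorbed into the argument of [psi]. *)
Lemma cderive_dualw i b psi w : 0 < w -> L1 b -> TF psi ->
  (fun x => w%:C * cderive i (dualw b psi w) x) = dualw b (fun eta => dmul i eta * psi eta) w.
Proof.
move=> w0 ib tp; have lc := L1c_dual w0 ib tp; apply/funext => x.
rewrite /dualw (cderive_fourier i lc) (fourierZl _ _ (L1c_dmul i lc).1).
apply: eq_cintegral => xi _; congr (_ * _).
rewrite mulrA [LHS]mulrCA; congr (_ * (_ * _)).
by apply: complexP; rewrite ?cReM ?cImM /= ?mxE; move: (@pi R) => p; ring.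
Qed.

Definition dmuls (s : seq 'I_d) psi : V -> R[i] :=
  fun eta => (\prod_(i <- s) dmul i eta) * psi eta.

Lemma dmuls_rcons s i psi : dmuls (rcons s i) psi = dmuls s (fun eta => dmul i eta * psi eta).
Proof. by apply/funext => eta; rewrite /dmuls big_rcons mulrA. Qed.

Lemma TF_dmuls s psi : TF psi -> TF (dmuls s psi).
Proof.
move=> tp; apply: TF_mul => //; elim: s => [|i s ih].
  by apply: smooth_ext (smooth_cst _ 1) => x; rewrite big_nil.
by apply: smooth_ext (smoothM (smooth_dmul i) ih) => x; rewrite big_cons.
Qed.

Lemma cpderivs_nil phi : cpderivs [::] phi = phi.
Proof. by apply/funext => x; apply: complexP. Qed.

Lemma cpderivsZ s (c : R[i]) phi : smooth phi ->
  cpderivs s (fun x => c * phi x) = (fun x => c * cpderivs s phi x).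
Proof.
elim/last_ind: s phi => [|s i ih] phi sp.
  by rewrite !cpderivs_nil.
rewrite !cpderivs_rcons -ih; last exact: smooth_derive.
congr cpderivs; rewrite (cderiveM i (smooth_cst _ c) sp); apply/funext => x.
rewrite (_ : cderive i _ x = 0) ?mul0r ?add0r//.
by apply: complexP; rewrite /cderive /cpderivs/= derive_cst.
Qed.

Lemma test_function_cderive (Omega : set V) i phi :
  test_function Omega phi -> test_function Omega (cderive i phi).
Proof.
move=> [sp [K [cK KO vK]]]; split; first exact: smooth_derive.
exists K; split => //; apply: vanishes_cderive vK.
exact: compact_closed (@norm_hausdorff _ _) cK.
Qed.

Lemma test_function_cpderivs (Omega : set V) s phi :
  test_function Omega phi -> test_function Omega (cpderivs s phi).
Proof.
elim/last_ind: s phi => [|s i ih] phi tp.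
  by rewrite cpderivs_nil.
by rewrite cpderivs_rcons; apply: ih; exact: test_function_cderive.
Qed.

Lemma test_function_mul (Omega : set V) phi (h : V -> R[i]) :
  test_function Omega phi -> smooth h -> test_function Omega (fun x => phi x * h x).
Proof.
move=> [sp [K [cK KO vK]]] sh; split; first exact: smoothM.
by exists K; split => // x nx; rewrite vK// mul0r.
Qed.

End pairing.

(** * Null sequences of complex numbers *)

Section tends_to_zero.
Variable R : realType.
Implicit Types (y z : nat -> R[i]).

Definition tends0 z := (fun n => normc (z n)) @ \oo --> (0 : R).

Lemma tends0_le z (r : nat -> R) : (forall n, normc (z n) <= r n) ->
  r @ \oo --> (0 : R) -> tends0 z.
Proof.
move=> zr r0; apply: (@squeeze_cvgr _ _ _ _ (fun=> 0) r) => //; last exact: cvg_cst.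
by near=> n; rewrite normc_ge0 zr.
Unshelve. all: by end_near. Qed.

Lemma tends0D y z : tends0 y -> tends0 z -> tends0 (fun n => y n + z n).
Proof.
move=> y0 z0; apply: (@tends0_le _ (fun n => normc (y n) + normc (z n))).
  by move=> n; exact: le_normcD.
have H := cvgD y0 z0; rewrite addr0 in H; exact: H.
Qed.

Lemma tends0M y z (C : R) : (forall n, normc (y n) <= C) -> tends0 z ->
  tends0 (fun n => y n * z n).
Proof.
move=> yC z0; apply: (@tends0_le _ (fun n => C * normc (z n))).
  by move=> n; rewrite Normc.normcM ler_wpM2r ?normc_ge0.
have H := cvgM (cvg_cst C) z0; rewrite mulr0 in H; exact: H.
Qed.

Lemma tends0_ext y z : (forall n, y n = z n) -> tends0 y -> tends0 z.
Proof. by move=> /funext ->. Qed.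

Lemma tends0_cst0 : tends0 (fun=> 0).
Proof.
apply: (@tends0_le _ (fun=> 0)); last exact: cvg_cst.
by move=> n; rewrite Normc.normc0.
Qed.

Lemma tends0_sum (I : Type) (s : seq I) (P : pred I) (z : I -> nat -> R[i]) :
  (forall i, P i -> tends0 (z i)) -> tends0 (fun n => \sum_(i <- s | P i) z i n).
Proof.
move=> H; elim: s => [|i s ih].
  by apply: tends0_ext tends0_cst0 => n; rewrite big_nil.
case: (boolP (P i)) => Pi.
  by apply: tends0_ext (tends0D (H i Pi) ih) => n; rewrite big_cons Pi.
by apply: tends0_ext ih => n; rewrite big_cons (negbTE Pi).
Qed.

Lemma tends0_real (r : nat -> R) : r @ \oo --> (0 : R) -> tends0 (fun n => (r n)%:C).
Proof.
move=> r0; apply: (@tends0_le _ (fun n => `|r n|)) => [n|]; first by rewrite normc_real.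
by rewrite -(@normr0 _ R); exact: cvg_norm.
Qed.

Lemma tends0_bounded z : tends0 z -> exists C, forall n, normc (z n) <= C.
Proof.
move=> z0; have /cvg_seq_bounded[M [_ HM]] : cvgn (fun n => normc (z n)) by apply: cvgP z0.
exists (`|M| + 1) => n; have := HM (`|M| + 1).
rewrite (le_lt_trans (ler_norm _)) ?ltrDl// => /(_ isT n I).
exact: le_trans (ler_norm _).
Qed.

Lemma cvg_tends0 z (l : R[i]) : z @ \oo --> l -> tends0 (fun n => z n - l).
Proof.
move=> zl; apply/cvgrPdist_lt => e e0.
have ec : 0 < e%:C :> R[i] by rewrite ltcR.
have := (@cvgr_dist_lt _ _ _ _ _ z l) zl _ ec.
move=> [N _ HN]; exists N => // n /HN /=.
by rewrite distrC normr_normc ltcR sub0r normrN ger0_norm ?normc_ge0.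
Qed.

End tends_to_zero.

Section key_induction.
Variables (R : realType) (d : nat) (Omega : set 'rV[R]_d).
Local Notation V := ('rV[R]_d).
Local Notation Leb := (lebesgue_rV R d).
Variables (F b : nat -> V -> R[i]) (w : nat -> R).
Hypothesis F2 : forall phi, test_function Omega phi ->
  (forall n, L2c (fun x => phi x * F n x)) /\
  exists C, forall n, N2 (fun x => phi x * F n x) <= C.
Hypothesis b2 : forall n, L2c (b n).
Hypothesis bC : exists C, forall n, N2 (b n) <= C.
Hypothesis w_gt0 : forall n, 0 < w n.
Hypothesis w_cvg0 : w @ \oo --> (0 : R).

Let b1 n : cintegrable Leb setT (b n). Proof. exact: (L2c_L1c (b2 n)).1. Qed.

Lemma pair_seq_bounded (a : nat -> V -> R[i]) psi : TF psi ->
  (forall n, L2c (a n)) -> (exists C, forall n, N2 (a n) <= C) ->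
  exists C, forall n, normc (pair (a n) (b n) psi (w n)) <= C.
Proof.
move=> tp la [Ca HCa]; have [Cb HCb] := bC; have [C [C0 pC]] := TF_expabsv tp.
exists (C * (Num.sqrt Ca * Num.sqrt Cb)) => n.
apply: le_trans (pair_bound (w_gt0 n) (la n) (b2 n) tp C0 pC) _.
by rewrite ler_wpM2l//; apply: ler_pM; rewrite ?sqrtr_ge0// ler_wsqrtr.
Qed.

Lemma integrable_test n phi : test_function Omega phi ->
  cintegrable Leb setT (fun x => F n x * phi x).
Proof.
move=> tp; have [l _] := F2 tp; apply: eq_cintegrable (L2c_L1c (l n)).1 => x.
exact: mulrC.
Qed.

(* Moving a derivative from the product to the dual function multiplies the symbol; the terms
   where it falls on phi gain a factor w n. *)
Lemma key_induction s phi psi : test_function Omega phi -> TF psi ->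
  tends0 (fun n => (w n ^+ size s)%:C *
      cintegral Leb setT (fun x => F n x * cpderivs s (fun y =>
        phi y * dualw (b n) psi (w n) y) x)
    - pair (fun x => phi x * F n x) (b n) (dmuls s psi) (w n)).
Proof.
elim/last_ind: s phi psi => [|s i ih] phi psi tphi tpsi.
  apply: (@tends0_ext _ (fun=> 0)); last exact: tends0_cst0.
  move=> n.
  have [l _] := F2 tphi.
  rewrite expr0 mul1r -(pairE (w_gt0 n) (L2c_L1c (l n)).1 (b1 n) (TF_dmuls [::] tpsi)).
  apply/esym/eqP; rewrite subr_eq0; apply/eqP/eq_cintegral => x _.
  have -> : dmuls [::] psi = psi.
    by apply/funext => eta; rewrite /dmuls big_nil mul1r.
  rewrite cpderivs_nil.
  by rewrite mulrCA mulrA.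
have td := test_function_cderive i tphi.
have tdm : TF (fun eta => dmul i eta * psi eta) by apply: TF_mul tpsi; exact: smooth_dmul.
have H1 := ih _ _ td tpsi; have H2 := ih _ _ tphi tdm.
have [ld [Cd HCd]] := F2 td.
have [Cp HCp] := pair_seq_bounded (TF_dmuls s tpsi) ld (ex_intro _ Cd HCd).
have wc : tends0 (fun n => (w n)%:C) by exact: tends0_real.
have [Cw HCw] := tends0_bounded wc.
(* By [H1] the term with the derivative on [phi] is close to a pairing that [HCp] bounds, so one
   further factor [w n] sends it to 0. [H2] treats the term with the derivative on the dual
   function. *)
have H3 := tends0D (tends0D (tends0M HCw H1) (tends0M HCp wc)) H2.
apply: tends0_ext H3 => n.
rewrite dmuls_rcons size_rcons cpderivs_rcons.
have sphi := tphi.1; have sd := smooth_dualw (w_gt0 n) (b1 n) tpsi.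
rewrite (cderiveM i sphi sd).
have td1 := test_function_mul td sd.
have td2 := test_function_mul tphi (smooth_derive i sd).
rewrite (cpderivsD s td1.1 td2.1).
have i1 := integrable_test n (test_function_cpderivs s td1).
have i2 := integrable_test n (test_function_cpderivs s td2).
set I1 := cintegral Leb setT (fun x => F n x * cpderivs s (fun y =>
  cderive i phi y * dualw (b n) psi (w n) y) x).
have -> : cintegral Leb setT (fun x => F n x * cpderivs s (fun y =>
  phi y * dualw (b n) (fun eta => dmul i eta * psi eta) (w n) y) x) =
  (w n)%:C * cintegral Leb setT (fun x => F n x * cpderivs s (fun y =>
    phi y * cderive i (dualw (b n) psi (w n)) y) x).
  rewrite -(cintegralZl _ measurableT i2); apply: eq_cintegral => x _.
  rewrite -(cderive_dualw i (w_gt0 n) (b1 n) tpsi).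
  have -> : (fun y => phi y * ((w n)%:C * cderive i (dualw (b n) psi (w n)) y)) =
    (fun y => (w n)%:C * (phi y * cderive i (dualw (b n) psi (w n)) y)).
    by apply/funext => y; rewrite mulrCA.
  rewrite cpderivsZ; last exact: td2.1.
  by rewrite mulrCA.
set I2 := cintegral Leb setT (fun x => F n x * cpderivs s (fun y => phi y * cderive i _ y) x).
have -> : cintegral Leb setT (fun x => F n x * (cpderivs s (fun y =>
  cderive i phi y * dualw (b n) psi (w n) y) x + cpderivs s (fun y =>
  phi y * cderive i (dualw (b n) psi (w n)) y) x)) = I1 + I2.
  rewrite -(cintegralD measurableT i1 i2); apply: eq_cintegral => x _.
  exact: mulrDr.
rewrite exprSr RcM; move: (_ ^+ _)%:C (w n)%:C I1 I2 (pair _ _ _ _) (pair _ _ _ _) =>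
  X Y J1 J2 Q1 Q2.
ring.
Qed.

End key_induction.

(** * Local convergence of the coefficients *)

Lemma normc_opp (R : realType) (z : R[i]) : normc (- z) = normc z.
Proof. by case: z => a b /=; rewrite !sqrrN. Qed.

Section local_convergence.
Variables (R : realType) (d : nat) (Omega : set 'rV[R]_d).
Hypothesis oO : open Omega.
Local Notation V := ('rV[R]_d).
Local Notation Leb := (lebesgue_rV R d).
Implicit Types (a phi F : V -> R[i]) (K : set V) (x y : V) (e : R).

(* Since Omega is open, rho can be chosen so small that x lies in Omega. *)
Definition cont_on a := forall y, Omega y -> forall e, 0 < e ->
  exists rho, 0 < rho /\
    forall x, (forall i, `|x 0 i - y 0 i| < rho) -> normc (a x - a y) < e.

Definition loc_unif (a_ : nat -> V -> R[i]) a := forall K, compact K -> K `<=` Omega ->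
  forall e, 0 < e -> exists N, forall n, (N <= n)%N -> forall x,
    K x -> normc (a_ n x - a x) < e.

Lemma within_cont_on q r (A : V -> 'M[R[i]]_(q, r)) j k :
  {within Omega, continuous A} -> cont_on (fun x => A x j k).
Proof.
rewrite (continuous_open_subspace _ oO) => cA y Oy e e0.
have ec : 0 < e%:C :> R[i] by rewrite ltcR.
have nA : nbhs (A y) (ball (A y) e%:C) by exact: nbhsx_ballx.
have := cA y (mem_set Oy) _ nA; rewrite nbhs_filterE => /nbhs_ballP[rho rho0 H].
exists rho; split => // x xy.
have [|_ /(_ j k)] := H x.
  by split => // i0 i; rewrite ord1 -ball_normE /= distrC.
by rewrite -ball_normE /ball_ /= distrC normr_normc ltcR.
Qed.

Lemma uniform_loc_unif q r (A : nat -> V -> 'M[R[i]]_(q, r)) Ainf j k :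
  (forall K, compact K -> K `<=` Omega -> {uniform K, A @ \oo --> Ainf}) ->
  loc_unif (fun n x => A n x j k) (fun x => Ainf x j k).
Proof.
move=> H K cK KO e e0.
have ec : 0 < e%:C :> R[i] by rewrite ltcR.
have [|N _ HN] := H K cK KO [set g | forall y, K y -> ball (Ainf y) (e%:C) (g y)].
  by apply/uniform_nbhs; exists [set z | ball z.1 (e%:C) z.2]; split => //;
    exact: (entourage_ball _ (PosNum ec)).
exists N => n /HN Hn x Kx; have [_ /(_ j k)] := Hn x Kx.
by rewrite -ball_normE /ball_ /= distrC normr_normc ltcR.
Qed.

Let openI_interior (U : set V) : U `<=` U^° -> open U.
Proof. by rewrite openE. Qed.

Lemma cont_on_measurable a : cont_on a -> cmeasurable_fun Omega a.
Proof.
move=> ca.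
suff H (h : V -> R) : (forall x y, `|h x - h y| <= normc (a x - a y)) -> measurable_fun Omega h.
  split; apply: H => x y; first by apply: le_trans (normc_Re _); rewrite cReD raddfN.
  by apply: le_trans (normc_Im _); rewrite cImD raddfN.
move=> hle; apply: (measurability _ (RGenOpens.measurableE R)).
move=> _ [_ [s [t ->] <-]]; apply: open_measurable_rV.
apply: openI_interior.
move=> y [Oy]; rewrite /= in_itv /= => /andP[sy yt].
have e0 : 0 < Num.min (h y - s) (t - h y) by rewrite lt_min !subr_gt0 sy.
have [rho [rho0 H]] := ca y Oy _ e0.
have /nbhs_ballP[e1 e10 HO] : nbhs y Omega by exact: open_nbhs_nbhs.
apply/nbhs_ballP; exists (Num.min e1 rho); first by rewrite /= lt_min e10.
move=> x bx; split.
  by apply: HO; apply: le_ball bx; rewrite ge_min lexx.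
have xy i : `|x 0 i - y 0 i| < rho.
  have [_ /(_ 0 i)] := bx.
  by rewrite -ball_normE /ball_ /= distrC lt_min => /andP[].
have := le_lt_trans (hle x y) (H x xy).
by rewrite lt_min !ltr_norml /= in_itv /= => /andP[]; lra.
Qed.

Lemma compact_cover_box K (rho : V -> R) : compact K -> (forall y, K y -> 0 < rho y) ->
  exists s : seq V, (forall y, y \in s -> K y) /\
    forall x, K x -> exists2 y, y \in s & forall i, `|x 0 i - y 0 i| < rho y.
Proof.
rewrite compact_cover => cK r0.
have [||D DK HK] := cK _ K (fun y => ball y (rho y)).
- by move=> y Ky; exact: ball_open.
- by move=> x Kx; exists x => //; apply: ballxx; exact: r0.
exists (finmap.enum_fset D); split.
  by move=> y yD; apply: set_mem; exact: DK.
move=> x /HK[y yD [_ xy]]; exists y => // i.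
by have := xy 0 i; rewrite -ball_normE /ball_ /= distrC.
Qed.

(** Takes the place of a partition of unity: going through a finite cover, each step blends the
    previous function with the constant [a y] by a plateau. A convex combination of two values
    within [e] of [a x] is again within [e]. *)
Lemma smooth_approx a K e : cont_on a -> compact K -> K `<=` Omega -> 0 < e ->
  exists h, smooth h /\ forall x, K x -> normc (a x - h x) <= e.
Proof.
move=> ca cK KO e0.
have /choice[rho Hrho] : forall y, exists rho, Omega y -> 0 < rho /\
    forall x, (forall i, `|x 0 i - y 0 i| < 2 * rho) -> normc (a x - a y) < e.
  move=> y; have [Oy|nOy] := pselect (Omega y); last by exists 0.
  have [rho [rho0 H]] := ca y Oy e e0.
  (* Half the radius of continuity, since the plateau of radius rho is supported up to distance 2
     rho. *)
  exists (rho / 2) => _; split; first by rewrite divr_gt0.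
  by rewrite mulrC divfK.
have [s [sK cov]] := compact_cover_box cK (fun y Ky => (Hrho y (KO y Ky)).1).
(* The estimate is restricted to points covered by the list, which makes an induction on the list
   possible. *)
suff [h [sh H]] : exists h, smooth h /\ forall x y, K x -> y \in s ->
    (forall i, `|x 0 i - y 0 i| < rho y) -> normc (a x - h x) <= e.
  by exists h; split => // x Kx; have [y ys xy] := cov x Kx; exact: H ys xy.
elim: s sK {cov} => [_|y s ih sK].
  by exists (fun=> 0); split; [exact: smooth_cst|].
have [|h [sh Hh]] := ih; first by move=> z zs; apply: sK; rewrite inE zs orbT.
have Ky : K y by apply: sK; rewrite mem_head.
have [r0 Hr] := Hrho y (KO y Ky).
exists (fun x => (plateau (rho y) y x)%:C * a y + (1 - plateau (rho y) y x)%:C * h x); split.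
  apply: smoothD; [apply: smoothM|apply: (smoothM _ sh)].
  - by apply: smooth_real; exact: rsmooth_plateau.
  - exact: smooth_cst.
  - apply: smooth_real; apply: rsmoothD; first exact: rsmooth_cst.
    by apply: rsmoothN; exact: rsmooth_plateau.
move=> x z Kx; rewrite inE => zs xz.
have [near_y|far_y] := pselect (forall i, `|x 0 i - y 0 i| < rho y).
  rewrite plateau1 => [|//|i]; last exact: ltW.
  rewrite subrr mul0r addr0 mul1r; apply/ltW/Hr => i.
  by apply: lt_trans (near_y i) _; rewrite ltr_pMl// ltr1n.
have {zs} zs : z \in s.
  by case/orP: zs => // /eqP zy; rewrite zy in xz.
have hx := Hh x z Kx zs xz.
have p0 := plateau_ge0 (rho y) y x; have p1 := plateau_le1 (rho y) y x.
have [mid|] := pselect (forall i, `|x 0 i - y 0 i| < 2 * rho y); last first.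
  move=> /existsNP[i /negP]; rewrite -leNgt => far.
  by rewrite plateau0 ?subr0 ?mul0r ?mul1r ?add0r//; exists i.
have hy := Hr x mid.
move: (plateau _ _ _) p0 p1 => p p0 p1.
have -> : a x - (p%:C * a y + (1 - p)%:C * h x) = p%:C * (a x - a y) + (1 - p)%:C * (a x - h x).
  by rewrite (rmorphB (real_complex R)) rmorph1; ring.
apply: le_trans (le_normcD _ _) _; rewrite !Normc.normcM !normc_real.
rewrite !ger0_norm ?subr_ge0//; nra.
Qed.

Lemma cont_on_bounded a K : cont_on a -> compact K -> K `<=` Omega ->
  exists M, 0 <= M /\ forall x, K x -> normc (a x) <= M.
Proof.
move=> ca cK KO; have [h [sh H]] := smooth_approx ca cK KO ltr01.
have [M [M0 HM]] := smooth_bounded sh cK.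
exists (1 + M); split; first by rewrite addr_ge0.
move=> x Kx; rewrite -[a x](subrK (h x)); apply: le_trans (le_normcD _ _) _.
by apply: lerD; [exact: H|exact: HM].
Qed.

Lemma loc_unif_bounded (a_ : nat -> V -> R[i]) a K : (forall n,
  cont_on (a_ n)) -> loc_unif a_ a ->
  compact K -> K `<=` Omega -> exists M, 0 <= M /\
    (forall x, K x -> normc (a x) <= M) /\ forall (n : nat) x, K x -> normc (a_ n x) <= M.
Proof.
move=> ca au cK KO; have [N HN] := au K cK KO 1 ltr01.
have /choice[M HM] := fun n => cont_on_bounded (ca n) cK KO.
have aM x : K x -> normc (a x) <= M N + 1.
  move=> Kx; rewrite -[a x](subrK (a_ N x)) addrC; apply: le_trans (le_normcD _ _) _.
  apply: lerD; first exact: (HM N).2.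
  by rewrite -normc_opp opprB; apply/ltW/HN.
have M0 n : 0 <= M n by exact: (HM n).1.
(* Before rank [N] the terms are bounded one by one through the sum; from [N] on they are within 1
   of the limit, which [M N + 1] bounds. *)
exists (M N + 2 + \sum_(n < N) M n); split.
  by rewrite !addr_ge0// sumr_ge0.
have S0 : 0 <= \sum_(n < N) M n by rewrite sumr_ge0.
split=> [x Kx|n x Kx]; first by apply: le_trans (aM x Kx) _; lra.
have [nN|Nn] := ltnP n N.
  apply: le_trans ((HM n).2 x Kx) _; rewrite (bigD1 (Ordinal nN))//=.
  by rewrite addrCA lerDl !addr_ge0// sumr_ge0.
rewrite -[a_ n x](subrK (a x)); apply: le_trans (le_normcD _ _) _.
apply: (@le_trans _ _ (1 + (M N + 1))); last lra.
by apply: lerD; [apply/ltW/HN|exact: aM].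
Qed.

Lemma loc_unif_cont (a_ : nat -> V -> R[i]) a : (forall n,
  cont_on (a_ n)) -> loc_unif a_ a -> cont_on a.
Proof.
move=> ca au y Oy e e0.
have e3 : 0 < e / 3 by rewrite divr_gt0.
have /nbhs_ballP[e1 /= e10 HO] : nbhs y Omega by exact: open_nbhs_nbhs.
(* Uniform convergence is only known on compact subsets of Omega, so the argument is confined to a
   closed box around [y] inside Omega. *)
pose K : set V := [set x | forall i, `[y 0 i - e1 / 2, y 0 i + e1 / 2]%classic (x 0 i)].
have cK : compact K.
  by apply: (@rV_compact _ _ (fun i => `[y 0 i - e1 / 2, y 0 i + e1 / 2]%classic)) => i;
    exact: segment_compact.
have KO : K `<=` Omega.
  move=> x Kx; apply: HO; split => // i0 i; rewrite ord1 -ball_normE /ball_ /=.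
  by have := Kx i; rewrite /= in_itv /= ltr_norml; lra.
have [N HN] := au K cK KO _ e3.
have [rho [rho0 Hr]] := ca N y Oy _ e3.
exists (Num.min rho (e1 / 2)); split; first by rewrite lt_min rho0 divr_gt0.
move=> x xy.
have Kx : K x.
  by move=> i; have := xy i; rewrite lt_min /= in_itv /= => /andP[_]; rewrite ltr_norml; lra.
have Ky : K y by move=> i; rewrite /= in_itv /=; lra.
have H1 := HN N (leqnn N) x Kx; have H2 := HN N (leqnn N) y Ky.
have {}Hr : normc (a_ N x - a_ N y) < e / 3.
  by apply: Hr => i; have := xy i; rewrite lt_min => /andP[].
have -> : a x - a y = (a_ N x - a_ N y) + ((a_ N y - a y) - (a_ N x - a x)) by ring.
apply: le_lt_trans (le_normcD _ _) _.
have := le_normcD (a_ N y - a y) (- (a_ N x - a x)).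
rewrite normc_opp; lra.
Qed.

End local_convergence.

(** * Local boundedness of the weakly convergent sequence *)

Section local_square_integrable.
Variables (R : realType) (d r : nat) (Omega : set 'rV[R]_d).
Hypothesis oO : open Omega.
Local Notation V := ('rV[R]_d).
Local Notation Leb := (lebesgue_rV R d).
Implicit Types (a phi F : V -> R[i]) (K : set V) (x y : V) (e : R) (v : V -> 'cV[R[i]]_r).

Lemma sqnorm_ge0 k (v : 'cV[R[i]]_k) : 0 <= sqnorm v.
Proof. by apply: sumr_ge0 => j _; rewrite addr_ge0// sqr_ge0. Qed.

Lemma normc_le_sqnorm k (v : 'cV[R[i]]_k) j : normc (v j 0) ^+ 2 <= sqnorm v.
Proof.
rewrite normc_sqr /sqnorm (bigD1 j)//= lerDl sumr_ge0// => i _.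
by rewrite addr_ge0// sqr_ge0.
Qed.

Lemma cmeasurable_extend K F : measurable K -> cmeasurable_fun K F ->
  vanishes_outside K F -> cmeasurable_fun setT F.
Proof.
move=> mK [m1 m2] vF.
have E (g : R[i] -> R) : g 0 = 0 -> (fun x => g (F x)) \_ K = (fun x => g (F x)).
  move=> g0; apply/funext => x; rewrite patchE; case: ifPn => // /negP nx.
  by rewrite vF ?g0// => Kx; apply: nx; rewrite inE.
by split; [rewrite -(E (@complex.Re R))//|rewrite -(E (@complex.Im R))//];
  apply/(measurable_restrict _ mK measurableT); rewrite setTI.
Qed.

Lemma L2c_dominated K F (g : V -> R) : compact K -> K `<=` Omega ->
  cmeasurable_fun Omega F -> vanishes_outside K F ->
  (forall x, K x -> normc (F x) ^+ 2 <= g x) -> Leb.-integrable K (EFin \o g) ->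
  L2c F /\ N2 F <= \int[Leb]_(x in K) g x.
Proof.
move=> cK KO [m1 m2] vF Fg ig.
have mK := compact_measurable_rV cK.
have mO := open_measurable_rV oO.
have mF : cmeasurable_fun setT F.
  by apply: (cmeasurable_extend mK) => //; split; exact: measurable_funS mO KO _.
have mF2 : measurable_fun setT (fun x => normc (F x) ^+ 2).
  by apply: measurable_funX; exact: cmeasurable_normc.
have iF : Leb.-integrable K (EFin \o (fun x => normc (F x) ^+ 2)).
  apply: (le_integrable mK _ _ ig).
    by apply/measurable_EFinP; exact: measurable_funS measurableT _ mF2.
  move=> x Kx; rewrite /comp !abse_EFin lee_fin ger0_norm ?sqr_ge0//.
  by apply: le_trans (Fg x Kx) _; exact: ler_norm.
have E : (fun x => normc (F x) ^+ 2) \_ K = (fun x => normc (F x) ^+ 2).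
  apply/funext => x; rewrite patchE; case: ifPn => // /negP nx.
  by rewrite vF ?Normc.normc0 ?expr0n// => Kx; apply: nx; rewrite inE.
split; last first.
  rewrite /N2 -E -Rintegral_mkcond.
  exact: le_Rintegral.
have [M [M0 KM]] := compact_sub_cube cK.
split => //; first by exists M; split => // x nx; apply: vF => Kx; apply: nx; exact: KM.
have /(integrable_mkcond _ mK) := iF.
by congr (_.-integrable _ _); apply/funext => x; rewrite -[in RHS]E /= !patchE; case: ifP.
Qed.

Variable u : nat -> V -> 'cV[R[i]]_r.
Hypothesis uL2 : forall n, L2loc Omega (u n).
Hypothesis uw : weak_cvg0 Omega u.

Lemma sqnorm_integrable n K : compact K -> K `<=` Omega ->
  Leb.-integrable K (EFin \o (fun x => sqnorm (u n x))).
Proof.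
move=> cK KO; have [mu1 fin] := uL2 n.
apply/integrableP; split.
  apply/measurable_EFinP; apply: measurable_sum => j; have [m1 m2] := mu1 j.
  by apply: measurable_funD; apply: measurable_funX; apply: measurable_funS KO _ => //;
    exact: open_measurable_rV.
rewrite (eq_integral (fun x => (sqnorm (u n x))%:E)); first exact: fin.
by move=> x _; rewrite /comp abse_EFin ger0_norm// sqnorm_ge0.
Qed.

(** [weakly_bounded] is about real functions, so real and imaginary parts are treated separately:
    [p] is one of them and [c] is 1 or i. The last hypothesis on [p] rewrites the real pairing with
    [g] as the real part of the weak pairing with c g in the j-th component. *)
Let part_bounded (p : R[i] -> R) (c : R[i]) K j : compact K -> K `<=` Omega ->
  p 0 = 0 -> normc c = 1 -> (forall z, p z ^+ 2 <= normc z ^+ 2) ->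
  (forall n, measurable_fun Omega (fun x => p (u n x j 0))) ->
  (forall z (t : R), p z * t = complex.Re (z * conjc (c * t%:C))) ->
  exists C, forall n, \int[Leb]_(x in K) (p (u n x j 0) ^+ 2) <= C.
Proof.
move=> cK KO p0 c1 p2 mp pc.
have mK := compact_measurable_rV cK; have mO := open_measurable_rV oO.
pose f n := (fun x => p (u n x j 0)) \_ K.
have sqE n : (fun x => f n x ^+ 2) = (fun x => p (u n x j 0) ^+ 2) \_ K.
  by apply/funext => x; rewrite /f !patchE; case: ifP; rewrite ?expr0n.
have mf n : measurable_fun setT (f n).
  apply/(measurable_restrict _ mK measurableT); rewrite setTI.
  exact: measurable_funS mO KO (mp n).
have L2f n : L2 Leb (f n).
  split => //.
  rewrite (_ : _ \o _ = (EFin \o (fun x => p (u n x j 0) ^+ 2)) \_ K); last first.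
    by apply/funext => x; rewrite /comp -/(EFin _) (congr1 (fun h =>
      (h x)%:E) (sqE n)) !patchE; case: ifP.
  apply/(integrable_mkcond _ mK).
  apply: (le_integrable mK _ _ (sqnorm_integrable n cK KO)).
    by apply/measurable_EFinP; apply: measurable_funX; exact: measurable_funS mO KO (mp n).
  move=> x Kx; rewrite /comp !abse_EFin lee_fin !ger0_norm ?sqr_ge0 ?sqnorm_ge0//.
  exact: le_trans (p2 _) (normc_le_sqnorm _ _).
have [|C HC] := weakly_bounded L2f.
  move=> g [mg ig].
  pose v (x : V) : 'cV[R[i]]_r := \col_k (if k == j then c * (g x)%:C else 0).
  have sv x : sqnorm (v x) = g x ^+ 2.
    rewrite /sqnorm (bigD1 j)//= big1 ?addr0 => [|k /negbTE kj];
      last by rewrite mxE kj /= expr0n addr0.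
    by rewrite mxE eqxx -normc_sqr Normc.normcM c1 mul1r normc_real real_normK ?num_real.
  have z0 : tends0 (fun n => cintegral Leb K (fun x => \sum_k u n x k 0 * conjc (v x k 0)) - 0).
    apply: cvg_tends0; apply: uw => //.
    - move=> k; rewrite /v; apply: (@eq_cmeasurable _ _ _ _ (fun x =>
      (if k == j then c else 0) * (g x)%:C)).
        by move=> x; rewrite mxE; case: ifP; rewrite ?mul0r.
      apply: cmeasurableM; first exact: cmeasurable_cst.
      by apply: cmeasurable_real; exact: measurable_funS measurableT _ mg.
    - have /integrableP[_] := integrableS measurableT mK (@subsetT _ K) ig.
      apply: le_lt_trans; apply: ge0_le_integral => //.
      + by move=> x _; rewrite lee_fin sqnorm_ge0.
      + apply/measurable_EFinP; apply: (eq_measurable (h' := fun x => g x ^+ 2)) => //.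
        by apply: measurable_funX; exact: measurable_funS measurableT _ mg.
      + apply: measurableT_comp => //; apply/measurable_EFinP; apply: measurable_funX.
        exact: measurable_funS measurableT _ mg.
      + by move=> x _; rewrite sv /comp abse_EFin lee_fin ler_norm.
  have [C HC] := tends0_bounded z0; exists C => n; apply: le_trans (HC n).
  rewrite subr0; apply: le_trans (normc_Re _); rewrite /cintegral /=.
  rewrite (_ : \int[Leb]_x _ = \int[Leb]_(x in K) complex.Re (\sum_k u n x k 0 * conjc (v x k
    0)))//.
  rewrite [RHS]Rintegral_mkcond; apply: eq_Rintegral => x _.
  rewrite /f !patchE; case: ifP => _; last by rewrite mul0r.
  rewrite (bigD1 j)//= big1 ?addr0 => [|k /negbTE kj]; last first.
    by rewrite mxE kj (conjc0 R) mulr0.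
  by rewrite mxE eqxx -pc.
exists C => n; have := HC n; rewrite /sqn sqE -Rintegral_mkcond; exact.
Qed.

Lemma sqnorm_bounded K : compact K -> K `<=` Omega ->
  exists C, forall n, \int[Leb]_(x in K) sqnorm (u n x) <= C.
Proof.
move=> cK KO; have mO := open_measurable_rV oO; have mK := compact_measurable_rV cK.
have mu_ n j := (uL2 n).1 j.
have /choice[C1 H1] : forall j, exists C, forall n, \int[Leb]_(x in K) (complex.Re (u n x j 0)
  ^+ 2) <= C.
  move=> j; apply: (part_bounded (c := 1)) => //.
  - by rewrite /= expr1n expr0n addr0 sqrtr1.
  - by move=> z; rewrite normc_sqr lerDl sqr_ge0.
  - by move=> n; exact: (mu_ n j).1.
  - by move=> z t; rewrite mul1r cReM cRe_conj cIm_conj /= oppr0 mulr0 subr0.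
have /choice[C2 H2] : forall j, exists C, forall n, \int[Leb]_(x in K) (complex.Im (u n x j 0)
  ^+ 2) <= C.
  move=> j; apply: (part_bounded (c := 0 +i* 1)) => //.
  - by rewrite /= expr0n expr1n add0r sqrtr1.
  - by move=> z; rewrite normc_sqr lerDr sqr_ge0.
  - by move=> n; exact: (mu_ n j).2.
  - by move=> z t; rewrite cReM cRe_conj cIm_conj cReM cImM /=; ring.
have iRI n j : Leb.-integrable K (EFin \o (fun x => complex.Re (u n x j 0) ^+ 2)) /\
    Leb.-integrable K (EFin \o (fun x => complex.Im (u n x j 0) ^+ 2)).
  have [m1 m2] := mu_ n j.
  split; apply: (le_integrable mK _ _ (sqnorm_integrable n cK KO)).
  - by apply/measurable_EFinP; apply: measurable_funX; exact: measurable_funS mO KO m1.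
  - move=> x Kx; rewrite /comp !abse_EFin lee_fin !ger0_norm ?sqr_ge0 ?sqnorm_ge0//.
    by apply: le_trans (normc_le_sqnorm _ j); rewrite normc_sqr lerDl sqr_ge0.
  - by apply/measurable_EFinP; apply: measurable_funX; exact: measurable_funS mO KO m2.
  - move=> x Kx; rewrite /comp !abse_EFin lee_fin !ger0_norm ?sqr_ge0 ?sqnorm_ge0//.
    by apply: le_trans (normc_le_sqnorm _ j); rewrite normc_sqr lerDr sqr_ge0.
exists (\sum_j (C1 j + C2 j)) => n; rewrite /sqnorm.
suff [_ ->] : Leb.-integrable K (EFin \o (fun x => \sum_j (complex.Re (u n x j 0) ^+ 2 +
  complex.Im (u n x j 0) ^+ 2))) /\
    \int[Leb]_(x in K) (\sum_j (complex.Re (u n x j 0) ^+ 2 + complex.Im (u n x j 0) ^+ 2)) =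
    \sum_j (\int[Leb]_(x in K) (complex.Re (u n x j 0) ^+ 2) + \int[Leb]_(x in K) (complex.Im
      (u n x j 0) ^+ 2)).
  by apply: ler_sum => j _; apply: lerD.
elim: (index_enum _) => [|j s [ih1 ih2]].
  split.
    rewrite (_ : _ \o _ = cst 0%:E); first exact: integrable0.
    by apply/funext => x; rewrite /= big_nil.
  rewrite big_nil /Rintegral integral0_eq// => x _; by rewrite big_nil.
have [i1 i2] := iRI n j; have i12 := integrableD mK i1 i2.
split.
  rewrite (_ : _ \o _ = (fun x => ((complex.Re (u n x j 0) ^+ 2)%:E + (complex.Im (u n x j 0)
    ^+ 2)%:E) +
     (\sum_(j <- s) (complex.Re (u n x j 0) ^+ 2 + complex.Im (u n x j 0) ^+ 2))%:E)%E);
       first exact: integrableD.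
  by apply/funext => x; rewrite /= big_cons.
rewrite big_cons -ih2 -(RintegralD mK i1 i2) -RintegralD//.
by apply: eq_Rintegral => x _; rewrite big_cons.
Qed.

(** [C] depends on [K] only, so the statement serves both for bounded multipliers and for small
    ones, such as the error of replacing A_n by a smooth function. *)
Lemma L2c_product K k : compact K -> K `<=` Omega ->
  exists C, 0 <= C /\ forall n a e, cmeasurable_fun Omega a -> vanishes_outside K a ->
    (forall x, K x -> normc (a x) <= e) ->
    L2c (fun x => a x * u n x k 0) /\ N2 (fun x => a x * u n x k 0) <= e ^+ 2 * C.
Proof.
move=> cK KO.
have [C HC] := sqnorm_bounded cK KO.
exists `|C|; split => // n a e ma va ae.
have ig := integrableZl (compact_measurable_rV cK) (e ^+ 2) (sqnorm_integrable n cK KO).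
have [| | |l2 n2] := @L2c_dominated K (fun x => a x * u n x k 0) (fun x =>
  e ^+ 2 * sqnorm (u n x)) cK KO _ _ _ ig.
- by apply: cmeasurableM; [exact: ma|exact: (uL2 n).1].
- by move=> x nx; rewrite va// mul0r.
- move=> x Kx; rewrite Normc.normcM exprMn.
  have e0 : 0 <= e by apply: le_trans (ae x Kx); exact: normc_ge0.
  by apply: ler_pM; rewrite ?sqr_ge0 ?normc_le_sqnorm// lerXn2r ?nnegrE ?normc_ge0// ae.
split => //; apply: le_trans n2 _.
rewrite (RintegralZl _ (compact_measurable_rV cK) (sqnorm_integrable n cK KO)).
by apply: ler_wpM2l; [exact: sqr_ge0|apply: le_trans (HC n) (ler_norm _)].
Qed.

End local_square_integrable.

(** * Complex measures *)

Section complex_measures.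
Context dd (T : measurableType dd) (R : realType).
Variables (mu : cmeasure T R) (D : set T).
Hypothesis mD : measurable D.
Implicit Types (f g : T -> R[i]) (K : set T).

Lemma eq_cm_integral f g : (forall x, D x -> f x = g x) ->
  cm_integral mu D f = cm_integral mu D g.
Proof. by move=> fg; rewrite /cm_integral; do 4 (rewrite (eq_cintegral _ fg)). Qed.

Lemma cm_integrableD f g : cm_integrable mu D f -> cm_integrable mu D g ->
  cm_integrable mu D (fun x => f x + g x).
Proof. by move=> [f1 f2 f3 f4] [g1 g2 g3 g4]; split; exact: cintegrableD. Qed.

Lemma cm_integrableZl (c : R[i]) f : cm_integrable mu D f ->
  cm_integrable mu D (fun x => c * f x).
Proof. by move=> [f1 f2 f3 f4]; split; exact: cintegrableZl. Qed.

Lemma cm_integralD f g : cm_integrable mu D f -> cm_integrable mu D g ->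
  cm_integral mu D (fun x => f x + g x) = cm_integral mu D f + cm_integral mu D g.
Proof.
move=> [f1 f2 f3 f4] [g1 g2 g3 g4]; rewrite /cm_integral.
rewrite (cintegralD mD f1 g1) (cintegralD mD f2 g2) (cintegralD mD f3 g3) (cintegralD mD f4 g4).
move: (cintegral _ _ _) (cintegral _ _ _) (cintegral _ _ _) (cintegral _ _ _) => a b c e.
by move: (cintegral _ _ _) (cintegral _ _ _) (cintegral _ _ _) (cintegral _ _ _) => *; ring.
Qed.

Lemma cm_integralZl (c : R[i]) f : cm_integrable mu D f ->
  cm_integral mu D (fun x => c * f x) = c * cm_integral mu D f.
Proof.
move=> [f1 f2 f3 f4]; rewrite /cm_integral.
rewrite (cintegralZl c mD f1) (cintegralZl c mD f2) (cintegralZl c mD f3) (cintegralZl c mD f4).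
by move: (cintegral _ _ _) (cintegral _ _ _) (cintegral _ _ _) (cintegral _ _ _) => *; ring.
Qed.

Lemma cm_integral_sum (I : Type) (s : seq I) (P : pred I) (F : I -> T -> R[i]) :
  (forall i, P i -> cm_integrable mu D (F i)) ->
  cm_integrable mu D (fun x => \sum_(i <- s | P i) F i x) /\
  cm_integral mu D (fun x => \sum_(i <- s | P i) F i x) =
  \sum_(i <- s | P i) cm_integral mu D (F i).
Proof.
move=> iF; have H0 (m : {measure set T -> \bar R}) : cintegrable m D (fun=> 0 : R[i]).
  by split; exact: integrable0.
elim: s => [|i s [ih1 ih2]].
  have -> : (fun x => \sum_(i <- [::] | P i) F i x) = (fun=> 0 : R[i]).
    by apply/funext => x; rewrite big_nil.
  split; first by split; exact: H0.
  have -> : (fun=> 0 : R[i]) = (fun _ : T => 0 * (0 : R[i])) by rewrite mul0r.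
  by rewrite cm_integralZl ?mul0r ?big_nil//; split; exact: H0.
case: (boolP (P i)) => Pi; last first.
  have -> : (fun x => \sum_(i <- i :: s | P i) F i x) = (fun x => \sum_(i <- s | P i) F i x).
    by apply/funext => x; rewrite big_cons (negbTE Pi).
  by rewrite big_cons (negbTE Pi).
have -> : (fun x => \sum_(i <- i :: s | P i) F i x) = (fun x =>
  F i x + \sum_(i <- s | P i) F i x).
  by apply/funext => x; rewrite big_cons Pi.
split; first exact: cm_integrableD (iF i Pi) ih1.
by rewrite (cm_integralD (iF i Pi) ih1) ih2 big_cons Pi.
Qed.

Definition cm_finite K := [/\ (re_pos mu K < +oo)%E, (re_neg mu K < +oo)%E,
  (im_pos mu K < +oo)%E & (im_neg mu K < +oo)%E].

(** An upper bound for the total variation that needs no minimal decomposition into positive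
    measures. *)
Definition cm_mass K : R := fine (re_pos mu K) + fine (re_neg mu K) +
  (fine (im_pos mu K) + fine (im_neg mu K)).

Let bounded1 (m : {measure set T -> \bar R}) K f (e : R) : measurable K -> K `<=` D ->
  (m K < +oo)%E -> cmeasurable_fun D f -> (forall x, ~ K x -> f x = 0) -> 0 <= e ->
  (forall x, K x -> normc (f x) <= e) ->
  cintegrable m D f /\ normc (cintegral m D f) <= e * fine (m K).
Proof.
move=> mK KD mKoo mf vf e0 fe.
have fE x : normc (f x) <= e * \1_K x.
  have [Kx|nKx] := pselect (K x); first by rewrite indicE mem_set// mulr1 fe.
  by rewrite vf// Normc.normc0 mulr_ge0.
have i1 : m.-integrable D (EFin \o (\1_K : T -> R)).
  apply/integrableP; split.
    by apply/measurable_EFinP; apply: measurable_indic.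
  rewrite (eq_integral (EFin \o \1_K)); last by move=> x _ /=; rewrite ger0_norm.
  by rewrite integral_indic ?setIidl.
have i2 := integrableZl mD e i1.
have cf : cintegrable m D f by apply: (le_cintegrable mD mf _ i2) => x _; exact: fE.
split => //; apply: le_trans (cintegral_normc mD cf) _.
apply: (@le_trans _ _ (\int[m]_(x in D) (e * \1_K x))).
  by apply: le_Rintegral => //; exact: cintegrable_normc.
rewrite (RintegralZl _ mD i1) /Rintegral integral_indic ?setIidl//.
Qed.

Lemma cm_bounded K f (e : R) : measurable K -> K `<=` D -> cm_finite K ->
  cmeasurable_fun D f -> (forall x, ~ K x -> f x = 0) -> 0 <= e ->
  (forall x, K x -> normc (f x) <= e) ->
  cm_integrable mu D f /\ normc (cm_integral mu D f) <= e * cm_mass K.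
Proof.
move=> mK KD [k1 k2 k3 k4] mf vf e0 fe.
have [i1 n1] := bounded1 mK KD k1 mf vf e0 fe.
have [i2 n2] := bounded1 mK KD k2 mf vf e0 fe.
have [i3 n3] := bounded1 mK KD k3 mf vf e0 fe.
have [i4 n4] := bounded1 mK KD k4 mf vf e0 fe.
split; first by split.
rewrite /cm_integral /cm_mass; apply: le_trans (le_normcD _ _) _.
have nB (y z : R[i]) : normc (y - z) <= normc y + normc z.
  by rewrite -[normc z]normc_opp; exact: le_normcD.
rewrite Normc.normcM (_ : normc (0 +i* 1) = 1) ?mul1r; last first.
  by rewrite /= expr0n expr1n add0r sqrtr1.
rewrite !mulrDr; apply: lerD; apply: le_trans (nB _ _) _; exact: lerD.
Qed.

End complex_measures.

(** * Limits of pairings *)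

Section pair_linear.
Variables (R : realType) (d : nat).
Local Notation V := ('rV[R]_d).
Implicit Types (a b psi : V -> R[i]) (w : R).

Lemma pairD a a' b psi w : 0 < w -> L2c a -> L2c a' -> L2c b -> TF psi ->
  pair (fun x => a x + a' x) b psi w = pair a b psi w + pair a' b psi w.
Proof.
move=> w0 la la' lb tp; have [C [C0 pC]] := TF_expabsv tp.
have i1 := pair_integrable w0 la lb tp pC.
have i2 := pair_integrable w0 la' lb tp pC.
rewrite /pair -(cintegralD measurableT i1 i2); apply: eq_cintegral => xi _.
rewrite -!mulrDl; congr (_ * _ * _).
have j1 := L1_phase xi (L2c_L1c la).1; have j2 := L1_phase xi (L2c_L1c la').1.
rewrite /fourier -(cintegralD measurableT j1 j2); apply: eq_cintegral => x _.
exact: mulrDr.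
Qed.

Lemma tends0_eventually (z : nat -> R[i]) e : tends0 z -> 0 < e ->
  exists N, forall n, (N <= n)%N -> normc (z n) < e.
Proof.
move=> /cvgrPdist_lt/(_ e) H e0; have [N _ HN] := H e0; exists N => n /HN.
by rewrite /= sub0r normrN (ger0_norm (normc_ge0 _)).
Qed.

(** Lets an epsilon argument end with any fixed multiple [Q] of epsilon; |Q| + 1 is used to divide
    safely. *)
Lemma tends0_linear (z : nat -> R[i]) (Q : R) :
  (forall e, 0 < e -> exists N, forall n, (N <= n)%N -> normc (z n) <= Q * e) -> tends0 z.
Proof.
move=> H; apply/cvgrPdist_le => e e0.
have Q1 : 0 < `|Q| + 1 by have := normr_ge0 Q; lra.
have [|N HN] := H (e / (`|Q| + 1)); first by rewrite divr_gt0.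
exists N => // n /HN; rewrite sub0r normrN (ger0_norm (normc_ge0 _)) => h.
apply: le_trans h _; rewrite mulrCA; apply: (ler_piMr (ltW e0)).
rewrite ler_pdivrMr// mul1r.
by apply: le_trans (ler_norm _) _; rewrite lerDl.
Qed.

End pair_linear.

Section pair_limit.
Variables (R : realType) (d r : nat) (Omega : set 'rV[R]_d).
Hypothesis oO : open Omega.
Local Notation V := ('rV[R]_d).
Local Notation Leb := (lebesgue_rV R d).
Local Notation D := (Omega `*` [set: V]).
Implicit Types (a phi psi : V -> R[i]).
Variables (u : nat -> V -> 'cV[R[i]]_r) (w : nat -> R).
Variable mu : 'M[cmeasure (V * V)%type R]_r.
Hypothesis uL2 : forall n, L2loc Omega (u n).
Hypothesis uw : weak_cvg0 Omega u.
Hypothesis w_gt0 : forall n, 0 < w n.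
Hypothesis sc : semiclassical_measure Omega u w mu.

Lemma test_L2c phi k : test_function Omega phi ->
  (forall n, L2c (fun x => phi x * u n x k 0)) /\
  exists C, forall n, N2 (fun x => phi x * u n x k 0) <= C.
Proof.
move=> [sp [K [cK KO vK]]]; have [M [M0 HM]] := smooth_bounded sp cK.
have [C [C0 HC]] := L2c_product oO uL2 uw k cK KO.
have mphi : cmeasurable_fun Omega phi.
  have [m1 m2] := smooth_cmeasurable sp.
  by split; exact: measurable_funS measurableT _ _.
have H n := HC n phi M mphi vK HM.
split=> [n|]; first exact: (H n).1.
by exists (M ^+ 2 * C) => n; exact: (H n).2.
Qed.

Lemma pair_limit_smooth phi1 phi2 psi i j :
  test_function Omega phi1 -> test_function Omega phi2 -> TF psi ->
  tends0 (fun n => pair (fun x => phi1 x * u n x i 0) (fun x => phi2 x * u n x j 0) psi (w n)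
    - cm_integral (cm_conj (mu i j)) D (fun z => phi1 z.1 * conjc (phi2 z.1) * psi z.2)).
Proof.
move=> t1 t2 [sp [M [M0 vM]]].
have ssp := schwartz_compact sp (@cube_compact _ _ M) vM.
have [_ /cvg_tends0] := sc.2 phi1 phi2 psi t1 t2 ssp i j.
apply: tends0_ext => n; congr (_ - _); apply: eq_cintegral => xi _.
rewrite /outer /vfourier !mxE; congr (_ * conjc _ * _);
  by apply: (congr1 (fun h => fourier h xi)); apply/funext => x; rewrite mxE.
Qed.

Lemma measurable_domain : measurable D.
Proof. by apply: measurableX; [exact: open_measurable_rV|exact: measurableT]. Qed.

Lemma radon_finite i j (K1 K2 : set V) : compact K1 -> K1 `<=` Omega -> compact K2 ->
  measurable (K1 `*` K2) /\ K1 `*` K2 `<=` D /\ cm_finite (mu i j) (K1 `*` K2).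
Proof.
move=> c1 KO c2; have KD : K1 `*` K2 `<=` D by move=> z [z1 z2]; split => //; exact: KO.
split; first by apply: measurableX; exact: compact_measurable_rV.
by split => //; apply: (sc.1.1 i j); [exact: compact_setX|].
Qed.

Lemma cmeasurable_phase_space (f : V * V -> R[i]) a psi : cmeasurable_fun setT a ->
  cmeasurable_fun setT psi -> (forall z, f z = a z.1 * psi z.2) -> cmeasurable_fun D f.
Proof.
move=> ma mp fE; have [m1 m2] : cmeasurable_fun setT f.
  apply: (eq_cmeasurable fE); apply: cmeasurableM.
    exact: (cmeasurable_comp (@measurable_fst _ _ V V) ma).
  exact: (cmeasurable_comp (@measurable_snd _ _ V V) mp).
by split; exact: measurable_funS measurableT _ _.
Qed.

Lemma cm_integral_bounded a psi i j (K : set V) (M e : R) :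
  compact K -> K `<=` Omega -> cmeasurable_fun Omega a -> vanishes_outside K a ->
  cmeasurable_fun setT psi -> vanishes_outside (cube M) psi -> 0 <= e ->
  (forall x y, K x -> normc (a x * psi y) <= e) ->
  cm_integrable (cm_conj (mu i j)) D (fun z => a z.1 * psi z.2) /\
  normc (cm_integral (cm_conj (mu i j)) D (fun z => a z.1 * psi z.2)) <=
    e * cm_mass (cm_conj (mu i j)) (K `*` cube M).
Proof.
move=> cK KO [m1 m2] va mp vp e0 ae.
have mK := compact_measurable_rV cK; have mO := open_measurable_rV oO.
have ma : cmeasurable_fun setT a.
  by apply: (cmeasurable_extend mK) => //; split; exact: measurable_funS mO KO _.
have [mKK [KD [f1 f2 f3 f4]]] := radon_finite i j cK KO (@cube_compact _ _ M).
apply: (cm_bounded measurable_domain mKK KD) => //.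
- exact: (cmeasurable_phase_space ma mp).
- move=> z nz; have [z1|nz1] := pselect (K z.1); last by rewrite va// mul0r.
  by rewrite vp ?mulr0// => z2; apply: nz.
- by move=> z [z1 _]; exact: ae.
Qed.

(** The semiclassical limit is given for smooth functions only, while phi1 a_n is merely continuous.
    Replacing a_n by a smooth [h] close to [a] on the support of phi1 leaves three errors: that of
    a_n - h in the pairing, the convergence for phi1 h, and that of a - h in the limit integral.
    They are the three summands of [Q]. *)
Lemma pair_limit phi1 phi2 psi (a_ : nat -> V -> R[i]) a i j :
  test_function Omega phi1 -> test_function Omega phi2 -> TF psi ->
  (forall n, cont_on Omega (a_ n)) -> loc_unif Omega a_ a ->
  tends0 (fun n =>
    pair (fun x => phi1 x * (a_ n x * u n x i 0)) (fun x => phi2 x * u n x j 0) psi (w n)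
    - cm_integral (cm_conj (mu i j)) D (fun z => phi1 z.1 * a z.1 * conjc (phi2 z.1) * psi
      z.2)).
Proof.
move=> t1 t2 tp ca au.
have cinf := loc_unif_cont oO ca au.
have [s1 [K [cK KO vK]]] := t1; have [s2 _] := t2; have [sp [M [M0 vM]]] := tp.
have [P1 [P10 HP1]] := smooth_bounded s1 cK.
have [P2 [P20 HP2]] := smooth_bounded s2 cK.
have [P3 [P30 HP3]] := smooth_bounded sp (@cube_compact _ _ M).
have psiP y : normc (psi y) <= P3.
  have [My|nMy] := pselect (cube M y); first exact: HP3.
  by rewrite vM// Normc.normc0.
have [l2 [C2 HC2]] := test_L2c j t2.
have [C1 [C10 HC1]] := L2c_product oO uL2 uw i cK KO.
have [C [C0 pC]] := TF_expabsv tp.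
have mT (h : V -> R[i]) : cmeasurable_fun setT h -> cmeasurable_fun Omega h.
  by move=> [m1 m2]; split; exact: measurable_funS measurableT _ _.
have mphi1 := mT _ (smooth_cmeasurable s1).
set mass := cm_mass (cm_conj (mu i j)) (K `*` cube M).
pose Q := C * (2 * P1 * Num.sqrt C1 * Num.sqrt C2) + 1 + P1 * P2 * P3 * mass.
apply: (tends0_linear (Q := Q)) => e e0.
have [h [sh Hh]] := smooth_approx cinf cK KO e0.
have [N1 HN1] := au K cK KO e e0.
have th : test_function Omega (fun x => phi1 x * h x) by exact: test_function_mul.
have [Nb HN2] := tends0_eventually (pair_limit_smooth i j th t2 tp) e0.
exists (maxn N1 Nb) => n; rewrite geq_max => /andP[n1 n2].
have {HN2} := HN2 n n2.
have {HN1}HN x Kx := HN1 n n1 x Kx.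
have md : cmeasurable_fun Omega (fun x => phi1 x * (a_ n x - h x)).
  apply: cmeasurableM => //; apply: (@eq_cmeasurable _ _ _ _ (fun x => a_ n x + (-1) * h x)).
    by move=> x; rewrite mulN1r.
  apply: cmeasurableD; first exact: (cont_on_measurable oO).
  by apply: cmeasurableM; [exact: cmeasurable_cst|apply: mT; exact: smooth_cmeasurable].
have vd : vanishes_outside K (fun x => phi1 x * (a_ n x - h x)).
  by move=> x nx; rewrite vK// mul0r.
have dle x : K x -> normc (phi1 x * (a_ n x - h x)) <= P1 * (2 * e).
  move=> Kx; rewrite Normc.normcM; apply: ler_pM; rewrite ?normc_ge0 ?HP1//.
  have -> : a_ n x - h x = (a_ n x - a x) + (a x - h x) by ring.
  apply: le_trans (le_normcD _ _) _; have := HN x Kx; have := Hh x Kx; lra.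
have [ld nd] := HC1 n _ _ md vd dle.
have [lh _] := test_L2c i th.
set b := fun x => phi2 x * u n x j 0.
have -> : pair (fun x => phi1 x * (a_ n x * u n x i 0)) b psi (w n) =
    pair (fun x => (phi1 x * (a_ n x - h x)) * u n x i 0) b psi (w n) +
    pair (fun x => (phi1 x * h x) * u n x i 0) b psi (w n).
  apply: etrans (pairD (w_gt0 n) ld (lh n) (l2 n) tp).
  apply: (congr1 (fun a => pair a b psi (w n))); apply/funext => x.
  by move: (phi1 x) (a_ n x) (h x) (u n x i 0) => p q s t; ring.
have B1 := pair_bound (w_gt0 n) ld (l2 n) tp C0 pC.
have s0 : Num.sqrt (N2 (fun x => phi1 x * (a_ n x - h x) * u n x i 0)) <=
  P1 * (2 * e) * Num.sqrt C1.
  apply: (@le_trans _ _ (Num.sqrt ((P1 * (2 * e)) ^+ 2 * C1))); first exact: ler_wsqrtr.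
  by rewrite sqrtrM ?sqr_ge0// sqrtr_sqr ger0_norm// !mulr_ge0// ltW.
have s1' : Num.sqrt (N2 (fun x => phi2 x * u n x j 0)) <= Num.sqrt C2 by exact: ler_wsqrtr.
have {}B1 := le_trans B1 (ler_wpM2l C0 (ler_pM (sqrtr_ge0 _) (sqrtr_ge0 _) s0 s1')).
pose g x := phi1 x * (a x - h x) * conjc (phi2 x).
have mg : cmeasurable_fun Omega g.
  apply: cmeasurableM; last by apply: cmeasurable_conj; apply: mT; exact: smooth_cmeasurable.
  apply: cmeasurableM => //; apply: (@eq_cmeasurable _ _ _ _ (fun x => a x + (-1) * h x)).
    by move=> x; rewrite mulN1r.
  apply: cmeasurableD; first exact: (cont_on_measurable oO).
  by apply: cmeasurableM; [exact: cmeasurable_cst|apply: mT; exact: smooth_cmeasurable].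
have vg : vanishes_outside K g by move=> x nx; rewrite /g vK// !mul0r.
have e1 : 0 <= P1 * e * P2 * P3 by rewrite !mulr_ge0// ltW.
have gle x y : K x -> normc (g x * psi y) <= P1 * e * P2 * P3.
  move=> Kx; rewrite !Normc.normcM normc_conj.
  by repeat (apply: ler_pM; rewrite ?mulr_ge0 ?normc_ge0//); [exact: HP1|exact: Hh|exact: HP2].
have mpsi := smooth_cmeasurable sp.
have [ig Bg] := cm_integral_bounded i j cK KO mg vg mpsi vM e1 gle.
have tph : cm_integrable (cm_conj (mu i j)) D (fun z => phi1 z.1 * h z.1 * conjc (phi2 z.1) *
  psi z.2).
  have ssp := schwartz_compact sp (@cube_compact _ _ M) vM.
  by have [[? ? ? ?] _] := sc.2 _ phi2 psi th t2 ssp i j.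
have -> : (fun z : V * V => phi1 z.1 * a z.1 * conjc (phi2 z.1) * psi z.2) =
   (fun z => g z.1 * psi z.2 + phi1 z.1 * h z.1 * conjc (phi2 z.1) * psi z.2).
  by apply/funext => z; rewrite /g; ring.
rewrite (cm_integralD measurable_domain ig tph).
move: B1 Bg; rewrite -/mass; move: (pair _ _ _ _) (pair _ _ _ _) (cm_integral _ _ _)
  (cm_integral _ _ _) => Y X W Z BX BZ BY.
have -> : X + Y - (Z + W) = X + ((Y - W) + - Z) by ring.
apply: le_trans (le_normcD _ _) _; apply: le_trans (lerD BX (le_normcD _ _)) _.
rewrite normc_opp; move: (lerD (ltW BY) BZ) => B; apply: le_trans (lerD (lexx _) B) _.
rewrite [X in X <= _](_ : _ = Q * e) // /Q; ring.
Qed.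

End pair_limit.

(** * The localized equation *)

Section weights.
Variables (R : realType) (d : nat).
Local Notation V := ('rV[R]_d).
Local Notation Leb := (lebesgue_rV R d).
Implicit Types (x xi : V).

Lemma enormZ (w : R) x : 0 < w -> enorm (w *: x) = w * enorm x.
Proof.
move=> w0; rewrite /enorm (_ : dotp _ _ = w ^+ 2 * dotp x x).
  by rewrite sqrtrM ?sqr_ge0// sqrtr_sqr gtr0_norm.
by rewrite /dotp mulr_sumr; apply: eq_bigr => i _; rewrite !mxE; ring.
Qed.

Lemma enorm_cube (M : R) x : 0 <= M -> cube M x -> enorm x <= Num.sqrt (d%:R * M ^+ 2).
Proof.
move=> M0 Mx; apply: ler_wsqrtr; rewrite /dotp.
rewrite (_ : d%:R * M ^+ 2 = \sum_(i < d) M ^+ 2); last by rewrite sumr_const card_ord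
  mulr_natl.
apply: ler_sum => i _; rewrite -expr2 -real_normK ?num_real// lerXn2r ?nnegrE//; exact: Mx.
Qed.

Lemma enorm_ge0 x : 0 <= enorm x. Proof. exact: sqrtr_ge0. Qed.

Lemma measurable_inv_ge1 dd (T : measurableType dd) (h : T -> R) :
  (forall t, 1 <= h t) -> measurable_fun setT h -> measurable_fun setT (fun t => (h t)^-1).
Proof.
move=> h1 mh; pose k (v : R) := (Num.max 1 v)^-1.
have ck : continuous k.
  move=> v; apply: (@continuousV R R (fun v => Num.max 1 v)).
    by apply: lt0r_neq0; rewrite lt_max ltr01.
  by apply: continuous_max; [exact: cst_continuous|move=> ?; exact: cvg_id].
apply: (eq_measurable (h' := k \o h)).
  by move=> t; rewrite /k /= max_r.
by apply: measurableT_comp => //; exact: continuous_measurable_fun.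
Qed.

Lemma measurable_enorm : measurable_fun setT (@enorm R d).
Proof.
have ms : measurable_fun setT (@Num.sqrt R) by apply: continuous_measurable_fun;
  exact: sqrt_continuous.
by apply: (measurableT_comp ms); apply: measurable_dotp; exact: measurable_id.
Qed.

Lemma weight_ge1 l m (e : R) xi : 0 <= e -> 1 <= weight l m e xi.
Proof.
by move=> e0; rewrite lerDl; apply: sumr_ge0 => s _; rewrite mulr_ge0// exprn_ge0// enorm_ge0.
Qed.

Lemma measurable_weight l m (e : R) : measurable_fun setT (fun xi => weight l m e xi).
Proof.
apply: measurable_funD; first exact: measurable_cst.
apply: measurable_sumR => s; apply: measurable_funM; first exact: measurable_cst.
by apply: measurable_funX; exact: measurable_enorm.
Qed.

Lemma expabsv_le1 (w : R) x : 0 < w -> expabsv w x <= 1.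
Proof.
move=> w0; suff /andP[] : 0 <= expabsv w x <= 1 by [].
rewrite /expabsv; apply: (big_ind (fun t : R => 0 <= t <= 1)) => //.
- by rewrite ler01 lexx.
- by move=> s t /andP[s0 s1] /andP[t0 t1]; rewrite mulr_ge0//= mulr_ile1.
- move=> i _; rewrite /expabs expR_ge0 -[leRHS]expR0 ler_expR oppr_le0.
  by rewrite mulr_ge0// ltW.
Qed.

End weights.

Lemma tends0_near_le (R : realType) (z : nat -> R[i]) (r : nat -> R) :
  (\forall n \near \oo, normc (z n) <= r n) -> r @ \oo --> (0 : R) -> tends0 z.
Proof.
move=> zr r0; apply: (@squeeze_cvgr _ _ _ _ (fun=> 0) r) => //; last exact: cvg_cst.
by apply: filterS zr => n ->; rewrite normc_ge0.
Qed.

Lemma cvg_tends0R (R : realType) (k : nat -> R) (c : R) : k @ \oo --> c ->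
  tends0 (fun n => (k n - c)%:C).
Proof.
move=> kc; apply: tends0_real; rewrite -(subrr c); apply: cvgB => //; exact: cvg_cst.
Qed.

Lemma normc_sign (R : realType) (n : nat) : normc ((-1 : R[i]) ^+ n) = 1.
Proof.
elim: n => [|n ih]; first by rewrite expr0 /= expr1n expr0n addr0 sqrtr1.
by rewrite exprS Normc.normcM ih mulr1 normc_opp /= expr1n expr0n addr0 sqrtr1.
Qed.

(** * The right-hand side of the scaled equation *)

Section right_hand_side.
Variables (R : realType) (d q l m : nat).
Local Notation V := ('rV[R]_d).
Local Notation Leb := (lebesgue_rV R d).
Variables (g : nat -> V -> 'cV[R[i]]_q) (b : nat -> V -> R[i]) (psi : V -> R[i]).
Variables (eps w S : nat -> R) (kap : nat -> nat -> R) (B : R) (kmax : nat -> R).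
Hypothesis mg : forall n, vmeasurable_fun setT (g n).
Hypothesis g0 : (\int[Leb]_xi (sqnorm (g n xi) / weight l m (eps n) xi ^+ 2)%:E)%E
        @[n --> \oo] --> 0%E.
Hypothesis lb : forall n, L2c (b n).
Hypothesis bC : exists C, forall n, N2 (b n) <= C.
Hypothesis tp : TF psi.
Hypothesis eps0 : forall n, 0 < eps n.
Hypothesis w0 : forall n, 0 < w n.
Hypothesis S0 : forall n, 0 < S n.
Hypothesis SB : forall n, S n <= B.
Hypothesis SE : forall n s, (l <= s <= m)%N -> S n * eps n ^+ (s - l) = kap s n * w n ^+ s.
Hypothesis kapB : forall n s, kap s n <= kmax s.

Let Psi n xi := conjc (fourier (b n) xi) * psi (w n *: xi).
Let f n xi := normc (fourier (b n) xi) * Num.sqrt (expabsv (w n) xi).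

(** By [SE] the scaled term of order s of the weight is kap_s |w xi|^s. On the support of psi(w .)
    the norm of w xi is at most [E], so the scaled weight is bounded uniformly in n. *)
Let Psi_bound : exists C, 0 <= C /\
  forall n xi, S n * weight l m (eps n) xi * normc (Psi n xi) <= C * f n xi.
Proof.
have [C [C0 pC]] := TF_expabsv tp; have [_ [M [M0 vM]]] := tp.
pose E := Num.sqrt (d%:R * M ^+ 2).
have kap0 n s : (l <= s <= m)%N -> 0 <= kap s n.
  move=> /(SE n) h; rewrite -(pmulr_lge0 _ (exprn_gt0 s (w0 n))) -h.
  by rewrite mulr_ge0 ?exprn_ge0// ltW.
have B0 : 0 <= B by apply: le_trans (ltW (S0 0)) (SB 0).
pose Wt := B + \sum_(l <= s < m.+1) kmax s * E ^+ s.
have Wt0 : 0 <= Wt.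
  rewrite addr_ge0// big_nat_cond; apply: sumr_ge0 => s; rewrite andbT ltnS => ls.
  by rewrite mulr_ge0 ?exprn_ge0 ?sqrtr_ge0// (le_trans (kap0 0 s ls)).
exists (Wt * C); split; first exact: mulr_ge0.
move=> n xi; rewrite /Psi Normc.normcM normc_conj.
have [Mx|nMx] := pselect (cube M (w n *: xi)); last first.
  rewrite vM// Normc.normc0 !mulr0 !mulr_ge0 ?normc_ge0 ?sqrtr_ge0//.
have WW : S n * weight l m (eps n) xi <= Wt.
  rewrite mulrDr mulr1; apply: lerD; first exact: SB.
  rewrite mulr_sumr; apply: ler_sum_nat => s; rewrite ltnS => ls.
  rewrite mulrA (SE n ls) -mulrA -exprMn -enormZ//; apply: ler_pM.
  - exact: kap0.
  - by rewrite exprn_ge0// enorm_ge0.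
  - exact: kapB.
  - by rewrite lerXn2r ?nnegrE ?enorm_ge0 ?sqrtr_ge0// enorm_cube.
rewrite /f [leRHS](_ : _ = Wt * (normc (fourier (b n) xi) * (C * Num.sqrt (expabsv (w n)
  xi)))); last by ring.
apply: ler_pM => //.
- by rewrite mulr_ge0 ?(ltW (S0 n))// (le_trans ler01)// weight_ge1// ltW.
- by rewrite mulr_ge0 ?normc_ge0.
rewrite ler_wpM2l ?normc_ge0//; apply: le_trans (pC _) _; rewrite ler_wpM2l//.
(* Being at most 1, the exponential is bounded by its own square root, which is the damping that
   [bessel_L2] handles. *)
rewrite -expabsv_scale//; have e0 := ltW (expabsv_gt0 (w n) xi).
rewrite -[leLHS](sqr_sqrtr e0) expr2 ler_piMl ?sqrtr_ge0//.
by rewrite -[leRHS]sqrtr1 ler_wsqrtr// expabsv_le1.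
Qed.

Lemma rhs_tends0 j :
  (forall n, cintegrable Leb setT (fun xi => g n xi j 0 * Psi n xi)) ->
  tends0 (fun n => (S n)%:C * cintegral Leb setT (fun xi => g n xi j 0 * Psi n xi)).
Proof.
move=> ig; have [C [C0 HC]] := Psi_bound; have [Cb HCb] := bC.
pose X n := (\int[Leb]_xi (sqnorm (g n xi) / weight l m (eps n) xi ^+ 2)%:E)%E.
have [fin X0] := (fine_cvgP _ _).1 g0.
have sX0 : (fun n => Num.sqrt (fine (X n))) @ \oo --> (0 : R).
  have L := continuous_cvg _ (@sqrt_continuous R 0) X0.
  by rewrite sqrtr0 in L; exact: L.
have L : (fun n => Num.sqrt (fine (X n)) * (C * Num.sqrt Cb)) @ \oo --> (0 : R).
  by have L := cvgM sX0 (cvg_cst (C * Num.sqrt Cb)); rewrite mul0r in L; exact: L.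
(* Convergence in the extended reals makes [X n] finite only from some rank on, so the estimate is
   proved eventually. *)
apply: tends0_near_le L; case: fin => N _ HN; exists N => // n /HN finX {HN}.
have w1 xi : 0 < weight l m (eps n) xi.
  by rewrite (lt_le_trans ltr01)// weight_ge1// ltW.
pose G xi := normc (g n xi j 0) / weight l m (eps n) xi.
have mG : measurable_fun setT G.
  apply: measurable_funM; first by apply: cmeasurable_normc; exact: mg.
  by apply: measurable_inv_ge1 (measurable_weight _ _ _) => xi; exact: weight_ge1 (ltW _).
have G2 xi : G xi ^+ 2 <= sqnorm (g n xi) / weight l m (eps n) xi ^+ 2.
  by rewrite /G exprMn exprVn ler_wpM2r ?invr_ge0 ?sqr_ge0// normc_le_sqnorm.
have mX : measurable_fun setT (fun xi => sqnorm (g n xi) / weight l m (eps n) xi ^+ 2).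
  apply: measurable_funM.
    apply: measurable_sumR => k; have [m1 m2] := mg n k.
    by apply: measurable_funD; exact: measurable_funX.
  apply: measurable_inv_ge1; last by apply: measurable_funX; exact: measurable_weight.
  by move=> xi; rewrite exprn_ege1// weight_ge1// ltW.
have iX : Leb.-integrable setT (EFin \o (fun xi => sqnorm (g n xi) / weight l m (eps n) xi ^+
  2)).
  apply/integrableP; split; first exact/measurable_EFinP.
  rewrite (eq_integral (fun xi => (sqnorm (g n xi) / weight l m (eps n) xi ^+ 2)%:E)).
    by have := finX; rewrite /= /X ge0_fin_numE// integral_ge0// => xi _;
      rewrite lee_fin divr_ge0 ?sqnorm_ge0 ?sqr_ge0.
  by move=> xi _; rewrite /comp abse_EFin ger0_norm// divr_ge0 ?sqnorm_ge0 ?sqr_ge0.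
have LG : L2 Leb G.
  split => //; apply: (@le_integrable _ _ _ Leb setT measurableT _ _ _ _ iX).
    by apply/measurable_EFinP; exact: measurable_funX.
  move=> xi _; rewrite /comp !abse_EFin lee_fin (ger0_norm (sqr_ge0 _)).
  exact: le_trans (G2 xi) (ler_norm _).
have sG : sqn Leb G <= fine (X n).
  have := le_Rintegral measurableT LG.2 iX (fun xi _ => G2 xi); exact.
have [lf sf] := bessel_L2 (w0 n) (lb n).
rewrite Normc.normcM normc_real gtr0_norm//.
apply: le_trans (ler_wpM2l (ltW (S0 n)) (cintegral_normc measurableT (ig n))) _.
have iN := cintegrable_normc measurableT (ig n).
have iGf := L2_mul LG lf.
rewrite -(RintegralZl (S n) measurableT iN).
apply: (@le_trans _ _ (\int[Leb]_xi (C * (G xi * f n xi)))).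
  apply: le_Rintegral.
  - exact: measurableT.
  - exact: (integrableZl measurableT (S n) iN).
  - exact: (integrableZl measurableT C iGf).
  move=> xi _; rewrite Normc.normcM.
  have -> : normc (g n xi j 0) = G xi * weight l m (eps n) xi by rewrite /G divfK// gt_eqF.
  have G0 : 0 <= G xi by rewrite divr_ge0 ?normc_ge0// ltW.
  have := ler_wpM2l G0 (HC n xi); congr (_ <= _); last exact: mulrCA.
  by move: (weight _ _ _ _) (G xi) (S n) (normc _) => *; ring.
rewrite (RintegralZl C measurableT iGf) mulrCA ler_wpM2l//.
apply: le_trans (ler_norm _) _; apply: le_trans (cauchy_schwarz LG lf) _.
by apply: ler_pM; rewrite ?sqrtr_ge0// ler_wsqrtr// (le_trans sf).
Qed.

End right_hand_side.

(** * The limit of the equation tested against phi1 W_n *)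

Section limit_identity.
Variables (R : realType) (d q r l m : nat) (Omega : set 'rV[R]_d).
Hypothesis oO : open Omega.
Local Notation V := ('rV[R]_d).
Local Notation Leb := (lebesgue_rV R d).
Local Notation D := (Omega `*` [set: V]).
Implicit Types (phi psi : V -> R[i]) (alpha : mindex d m).
Variables (u : nat -> V -> 'cV[R[i]]_r) (eps w : nat -> R).
Variables (A : nat -> mindex d m -> V -> 'M[R[i]]_(q, r)) (Ainf : mindex d m -> V ->
  'M[R[i]]_(q, r)).
Variables (f : nat -> functional R d q) (mu : 'M[cmeasure (V * V)%type R]_r).
Hypothesis uL2 : forall n, L2loc Omega (u n).
Hypothesis uw : weak_cvg0 Omega u.
Hypothesis eps_gt0 : forall n, 0 < eps n.
Hypothesis w_gt0 : forall n, 0 < w n.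
Hypothesis w_cvg0 : w @ \oo --> (0 : R).
Local Notation ord alpha := (l <= mlen alpha <= m)%N.
Hypothesis cA : forall n alpha, ord alpha -> forall j k,
  cont_on Omega (fun x => A n alpha x j k).
Hypothesis cvA : forall alpha, ord alpha -> forall j k,
  loc_unif Omega (fun n x => A n alpha x j k) (fun x => Ainf alpha x j k).
Hypothesis fg : forall phi, test_function Omega phi ->
  exists2 g : nat -> V -> 'cV[R[i]]_q, forall n, fourier_mul (f n) phi (g n) &
    (\int[Leb]_xi (sqnorm (g n xi) / weight l m (eps n) xi ^+ 2)%:E)%E @[n --> \oo] --> 0%E.
Hypothesis uf : forall n, solves l Omega (eps n) (A n) (u n) (f n).
Hypothesis sc : semiclassical_measure Omega u w mu.
(* S n scales the n-th equation so that its terms of order s get the coefficient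
   kap s n * w n ^+ s, which treats all regimes of eps / w at once. *)
Variables (S : nat -> R) (kap : nat -> nat -> R) (klim : nat -> R) (B : R).
Hypothesis S_gt0 : forall n, 0 < S n.
Hypothesis SB : forall n, S n <= B.
Hypothesis SE : forall n s, (l <= s <= m)%N -> S n * eps n ^+ (s - l) = kap s n * w n ^+ s.
Hypothesis kap_cvg : forall s, kap s @ \oo --> klim s.

Definition mseq alpha : seq 'I_d := flatten [seq nseq (alpha i) i | i <- enum 'I_d].

Lemma size_mseq alpha : size (mseq alpha) = mlen alpha.
Proof.
rewrite size_flatten sumnE /shape -map_comp big_map /mlen big_enum /=.
by apply: eq_bigr => i _; rewrite size_nseq.
Qed.

Lemma tends0_cst (c : R[i]) : tends0 (fun=> c) -> c = 0.
Proof.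
move=> H; apply: Normc.eq0_normc; apply/eqP; rewrite eq_le normc_ge0 andbT leNgt.
by apply/negP => /(tends0_eventually H)[N /(_ N (leqnn N))]; rewrite ltxx.
Qed.

(** Provides the hypothesis on [F] of [key_induction] for the entries of A_n u_n: the A_n are
    bounded uniformly in n on the support of [phi]. *)
Lemma AuL2 alpha j k phi : ord alpha -> test_function Omega phi ->
  (forall n, L2c (fun x => phi x * (A n alpha x j k * u n x k 0))) /\
  exists C, forall n, N2 (fun x => phi x * (A n alpha x j k * u n x k 0)) <= C.
Proof.
move=> oa [sp [K [cK KO vK]]].
have [P [P0 HP]] := smooth_bounded sp cK.
have [M [M0 [_ HM]]] := loc_unif_bounded (fun n => cA n oa j k) (cvA oa j k) cK KO.
have [C [C0 HC]] := L2c_product oO uL2 uw k cK KO.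
have H n : L2c (fun x => phi x * (A n alpha x j k * u n x k 0)) /\
    N2 (fun x => phi x * (A n alpha x j k * u n x k 0)) <= (P * M) ^+ 2 * C.
  have E : (fun x => phi x * (A n alpha x j k * u n x k 0)) =
      (fun x => (phi x * A n alpha x j k) * u n x k 0).
    by apply/funext => x; rewrite mulrA.
  rewrite E; apply: HC.
  - apply: cmeasurableM; last exact: cont_on_measurable (cA n oa j k).
    have [m1 m2] := smooth_cmeasurable sp.
    by split; exact: measurable_funS measurableT _ _.
  - by move=> x nx; rewrite vK// mul0r.
  - by move=> x Kx; rewrite Normc.normcM; apply: ler_pM; rewrite ?normc_ge0 ?HP ?HM.
split=> [n|]; first exact: (H n).1.
by exists ((P * M) ^+ 2 * C) => n; exact: (H n).2.
Qed.

Section test.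
Variables (phi1 phi2 psi : V -> R[i]) (j : 'I_q) (k' : 'I_r).
Hypotheses (t1 : test_function Omega phi1) (t2 : test_function Omega phi2) (tp : TF psi).

Let b n x := phi2 x * u n x k' 0.
Let W n := dualw (b n) psi (w n).
Let I alpha k := cm_integral (cm_conj (mu k k')) D
  (fun z => phi1 z.1 * Ainf alpha z.1 j k * conjc (phi2 z.1) * dmuls (mseq alpha) psi z.2).
Let T alpha k n := (w n ^+ mlen alpha)%:C * cintegral Leb setT (fun x =>
  A n alpha x j k * u n x k 0 * cpderivs (mseq alpha) (fun y => phi1 y * W n y) x).

Let lb n : L2c (b n). Proof. exact: (test_L2c oO uL2 uw k' t2).1. Qed.
Let bC : exists C, forall n, N2 (b n) <= C.
Proof. exact: (test_L2c oO uL2 uw k' t2).2. Qed.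
Let tW n : test_function Omega (fun y => phi1 y * W n y).
Proof. by apply: test_function_mul t1 _; apply: smooth_dualw => //;
  exact: (L2c_L1c (lb n)).1. Qed.

Let T_limit alpha k : ord alpha -> tends0 (fun n => T alpha k n - I alpha k).
Proof.
move=> oa.
have H1 := key_induction (F := fun n x => A n alpha x j k * u n x k 0)
  (fun phi => @AuL2 alpha j k phi oa) lb bC w_gt0 w_cvg0 (mseq alpha) t1 tp.
have H2 := pair_limit oO uL2 uw w_gt0 sc k k' t1 t2 (TF_dmuls (mseq alpha) tp)
  (fun n => cA n oa j k) (cvA oa j k).
apply: tends0_ext (tends0D H1 H2) => n.
rewrite /T /I size_mseq; move: (pair _ _ _ _) => X.
by rewrite addrA subrK.
Qed.

(** [SE] trades the powers of eps n for the powers of w n that [T] absorbs, leaving only the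
    coefficients [kap]. The integrals over Omega extend to the whole space because the test function
    vanishes outside Omega. *)
Let equation n : (S n)%:C * f n (fun x => phi1 x * W n x) j 0 =
  \sum_(alpha | ord alpha) (kap (mlen alpha) n)%:C * ((-1) ^+ mlen alpha * \sum_k T alpha k n).
Proof.
rewrite -(uf n (tW n)) summxE mulr_sumr; apply: eq_bigr => alpha oa.
rewrite !mxE.
have -> : cintegral Leb Omega (fun x => (A n alpha x *m u n x) j 0 *
      mderiv (fun i => alpha i) (fun x => phi1 x * W n x) x) =
    \sum_k cintegral Leb setT (fun x => A n alpha x j k * u n x k 0 *
       cpderivs (mseq alpha) (fun y => phi1 y * W n y) x).
  have td := test_function_cpderivs (mseq alpha) (tW n).
  have ik k : cintegrable Leb setT (fun x => A n alpha x j k * u n x k 0 *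
       cpderivs (mseq alpha) (fun y => phi1 y * W n y) x).
    by have := integrable_test (F := fun n x => A n alpha x j k * u n x k 0) (fun phi =>
      @AuL2 alpha j k phi oa) n td.
  have [_ <-] := cintegral_sum (index_enum _) measurableT (fun k (_ : xpredT k) => ik k).
  rewrite cintegral_mkcond; apply: eq_cintegral => x _; rewrite -mulr_suml.
  case: ifPn => [_|/negP nx].
    by rewrite mxE.
  have [_ [K [_ KO vK]]] := td; rewrite vK ?mulr0// => Kx.
  by apply: nx; rewrite inE; exact: KO.
apply: etrans (mulrA _ _ _) _; rewrite -RcM (SE n oa) RcM -mulrA; congr (_ * _).
by rewrite mulrCA -mulr_sumr.
Qed.

Let rhs : tends0 (fun n => (S n)%:C * f n (fun x => phi1 x * W n x) j 0).
Proof.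
have [g gm g0] := fg t1.
have kB : forall s, exists C, forall n, kap s n <= C.
  move=> s; have [C HC] := tends0_bounded (cvg_tends0R (@kap_cvg s)).
  exists (C + `|klim s|) => n; have := HC n; rewrite normc_real => h.
  have := ler_norm (kap s n - klim s); have := ler_norm (klim s); lra.
have [kmax Hk] := choice kB.
(* phi1 W_n is phi1 times the Fourier transform of this function, so [fourier_mul] expresses the
   action of f_n on it as an integral against [g n]. *)
have schw n : schwartz (fun xi => conjc (fourier (b n) xi) * psi (w n *: xi)).
  have [sp [M [M0 vM]]] := tp.
  have [l1 [N [N0 vN]]] := L1c_dual (w_gt0 n) (L2c_L1c (lb n)).1 tp.
  apply: (schwartz_compact _ (@cube_compact _ _ N) vN).
  by apply: smoothM; [apply: smooth_conj; exact: smooth_fourier (L2c_L1c (lb n))|exact: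
    smooth_dilate].
have E n : f n (fun x => phi1 x * W n x) j 0 =
    cintegral Leb setT (fun xi => g n xi j 0 * (conjc (fourier (b n) xi) * psi (w n *: xi))).
  exact: ((gm n).2 _ (schw n) j).2.
apply: (@tends0_ext _ (fun n => (S n)%:C * cintegral Leb setT (fun xi =>
  g n xi j 0 * (conjc (fourier (b n) xi) * psi (w n *: xi))))).
  by move=> n; rewrite E.
apply: (rhs_tends0 (fun n => (gm n).1) g0 lb bC tp eps_gt0 w_gt0 S_gt0 SB SE (fun n s =>
  Hk s n)).
by move=> n; exact: ((gm n).2 _ (schw n) j).1.
Qed.

Lemma limit_identity : \sum_(alpha | ord alpha) (klim (mlen alpha))%:C *
  ((-1) ^+ mlen alpha * \sum_k I alpha k) = 0.
Proof.
apply: tends0_cst.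
have H alpha : ord alpha -> tends0 (fun n =>
    (kap (mlen alpha) n)%:C * ((-1) ^+ mlen alpha * \sum_k T alpha k n) -
    (klim (mlen alpha))%:C * ((-1) ^+ mlen alpha * \sum_k I alpha k)).
  move=> oa; have [C HC] := tends0_bounded (cvg_tends0R (@kap_cvg (mlen alpha))).
  have kb n : normc (kap (mlen alpha) n)%:C <= C + normc (klim (mlen alpha))%:C.
    rewrite -[(kap _ n)%:C](subrK (klim (mlen alpha))%:C); apply: le_trans (le_normcD _ _) _.
    by rewrite lerD2r; have := HC n; rewrite (rmorphB (real_complex R)).
  have H1 : tends0 (fun n => \sum_k (T alpha k n - I alpha k)) by apply: tends0_sum => k _;
    exact: T_limit.
  have H2 := tends0M (y := fun=> (-1) ^+ mlen alpha) (C := 1) _ H1.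
  have H3 := tends0M kb (H2 _).
  have H4 := tends0M (y := fun=> (-1) ^+ mlen alpha * \sum_k I alpha k) (fun n =>
    lexx _) (cvg_tends0R (@kap_cvg (mlen alpha))).
  apply: tends0_ext (tends0D (H3 _) H4) => [n|n].
    rewrite sumrB (rmorphB (real_complex R)); move: (\sum_k _) (\sum_k _) => X Y; ring.
  by rewrite normc_sign.
have H1 := tends0_sum (index_enum _) H.
have H2 := tends0D rhs (tends0M (y := fun=> -1) (C := 1) _ H1).
have H3 : tends0 (fun n => \sum_(alpha | ord alpha) (klim (mlen alpha))%:C *
  ((-1) ^+ mlen alpha * \sum_k I alpha k)).
  apply: tends0_ext (H2 _) => [n|n].
    by rewrite equation sumrB mulN1r opprB addrCA subrr addr0.
  by rewrite normc_opp /= expr1n expr0n addr0 sqrtr1.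
exact: H3.
Qed.

End test.
End limit_identity.

(** * From test functions to Borel sets *)

Section vanishing_density.
Variables (R : realType) (d r : nat) (Omega : set 'rV[R]_d).
Hypothesis oO : open Omega.
Local Notation V := ('rV[R]_d).
Local Notation D := (Omega `*` [set: V]).
Variables (nu : 'I_r -> cmeasure (V * V)%type R) (p : 'I_r -> V * V -> R[i]).
Hypothesis nu_fin : forall k (K1 K2 : set V), compact K1 -> K1 `<=` Omega -> compact K2 ->
  cm_finite (nu k) (K1 `*` K2).
Hypothesis mp : forall k, cmeasurable_fun D (p k).
Hypothesis pB : forall k (K1 K2 : set V), compact K1 -> K1 `<=` Omega -> compact K2 ->
  exists P, 0 <= P /\ forall z, (K1 `*` K2) z -> normc (p k z) <= P.
Hypothesis p0 : forall phi1 phi2 psi, test_function Omega phi1 -> test_function Omega phi2 ->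
  TF psi -> \sum_k cm_integral (nu k) D
    (fun z => phi1 z.1 * conjc (phi2 z.1) * psi z.2 * p k z) = 0.
Implicit Types (chi : V * V -> R) (E B : set (V * V)).

(** Only the sum over k is known to vanish on test functions, so the extension to Borel sets is
    carried out for this functional and not for the single measures. *)
Definition LL chi : R[i] := \sum_k cm_integral (nu k) D (fun z => (chi z)%:C * p k z).

(** Bounded functions supported in one compact rectangle: there the measures are finite and [p] is
    bounded, so [LL] is linear and dominated convergence holds. *)
Definition adm (K1 K2 : set V) (M : R) chi := [/\ measurable_fun setT chi,
  forall z, ~ (K1 `*` K2) z -> chi z = 0 & forall z, `|chi z| <= M].

Let mD : measurable D := measurable_domain oO.

Section rectangle.
Variables (K1 K2 : set V).
Hypotheses (c1 : compact K1) (KO : K1 `<=` Omega) (c2 : compact K2).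

Let mK : measurable (K1 `*` K2).
Proof. by apply: measurableX; exact: compact_measurable_rV. Qed.
Let KD : K1 `*` K2 `<=` D.
Proof. by move=> z [z1 _]; split => //; exact: KO. Qed.

Lemma adm_integrable M chi k : adm K1 K2 M chi ->
  cm_integrable (nu k) D (fun z => (chi z)%:C * p k z).
Proof.
move=> [mc vc cM]; have [P [P0 HP]] := pB k c1 KO c2.
have M0 : 0 <= M by apply: le_trans (cM (0, 0)).
apply: (cm_bounded mD mK KD (nu_fin k c1 KO c2) _ _ (mulr_ge0 M0 P0) _).1.
- apply: cmeasurableM; last exact: mp.
  by apply: cmeasurable_real; exact: measurable_funS measurableT _ mc.
- by move=> z nz; rewrite vc// mul0r.
- by move=> z Kz; rewrite Normc.normcM normc_real; apply: ler_pM; rewrite ?normc_ge0 ?HP.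
Qed.

Lemma LLD M chi chi' : adm K1 K2 M chi -> adm K1 K2 M chi' ->
  LL (fun z => chi z + chi' z) = LL chi + LL chi'.
Proof.
move=> ac ac'; rewrite /LL -big_split /=; apply: eq_bigr => k _.
apply: etrans (cm_integralD mD (adm_integrable k ac) (adm_integrable k ac')).
by apply: eq_cm_integral => z _; rewrite (rmorphD (real_complex R)) mulrDl.
Qed.

Lemma LLB M chi chi' : adm K1 K2 M chi -> adm K1 K2 M chi' ->
  LL (fun z => chi z - chi' z) = LL chi - LL chi'.
Proof.
move=> ac [m1 v1 b1].
have ac'' : adm K1 K2 M (fun z => - chi' z).
  split; first exact: measurable_funN.
    by move=> z nz; rewrite v1// oppr0.
  by move=> z; rewrite normrN.
rewrite (LLD ac ac''); congr (_ + _).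
rewrite /LL -sumrN; apply: eq_bigr => k _.
rewrite -mulN1r -(cm_integralZl mD _ (adm_integrable k (And3 m1 v1 b1))).
by apply: eq_cm_integral => z _; rewrite (rmorphN (real_complex R)) mulNr mulN1r.
Qed.

Let dct1 (m : {measure set (V * V) -> \bar R}) k (M : R) (chi_ : nat -> V * V -> R) :
  (m (K1 `*` K2) < +oo)%E -> (forall n, adm K1 K2 M (chi_ n)) ->
  (forall n, cintegrable m D (fun z => (chi_ n z)%:C * p k z)) ->
  (forall z, chi_ ^~ z @ \oo --> (0 : R)) ->
  tends0 (fun n => cintegral m D (fun z => (chi_ n z)%:C * p k z)).
Proof.
move=> fm ac ic c0; have [P [P0 HP]] := pB k c1 KO c2.
have M0 : 0 <= M by have [_ _ /(_ (0, 0))] := ac 0%N; exact: le_trans.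
pose g n z := normc ((chi_ n z)%:C * p k z).
have mg n : measurable_fun D (g n).
  apply: cmeasurable_normc; exact: cintegrable_meas (ic n).
have gP n z : g n z <= M * P * \1_(K1 `*` K2) z.
  have [_ vc cM] := ac n; rewrite /g Normc.normcM normc_real.
  have [Kz|nKz] := pselect ((K1 `*` K2) z); last by rewrite vc// normr0 mul0r !mulr_ge0.
  by rewrite indicE mem_set// mulr1; apply: ler_pM; rewrite ?normc_ge0 ?HP.
have i0 : m.-integrable D (EFin \o (\1_(K1 `*` K2) : V * V -> R)).
  apply/integrableP; split.
    by apply/measurable_EFinP; apply: measurable_indic.
  rewrite (eq_integral (EFin \o \1_(K1 `*` K2))); last by move=> x _ /=; rewrite ger0_norm.
  by rewrite integral_indic ?setIidl.
have i1 : m.-integrable D (EFin \o (fun z => M * P * \1_(K1 `*` K2) z)).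
  exact: (integrableZl mD (M * P) i0).
have [||||_ _ H] := @dominated_convergence _ _ _ m D mD (fun n => EFin \o g n) (cst 0%E)
  (EFin \o (fun z => M * P * \1_(K1 `*` K2) z)) _ _ _ i1.
- by move=> n; exact/measurable_EFinP.
- exact: measurable_cst.
- apply: aeW => z _; apply: cvg_EFin; first exact: nearW.
  apply: (@squeeze_cvgr _ _ _ _ (fun=> 0) (fun n => `|chi_ n z| * normc (p k z))).
  + by apply: nearW => n; rewrite normc_ge0/= /g Normc.normcM normc_real.
  + exact: cvg_cst.
  + have L := cvgM (cvg_norm (c0 z)) (cvg_cst (normc (p k z))).
    by rewrite normr0 mul0r in L; exact: L.
- by apply: aeW => z n _; rewrite /comp abse_EFin lee_fin ger0_norm ?normc_ge0// gP.
apply: (@tends0_le _ _ (fun n => \int[m]_(z in D) g n z)).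
  by move=> n; exact: cintegral_normc.
rewrite integral0 in H; have [_ H'] := (fine_cvgP _ _).1 H; exact: H'.
Qed.

Lemma LL_dct (M : R) (chi_ : nat -> V * V -> R) chi : (forall n, adm K1 K2 M (chi_ n)) ->
  (forall z, chi_ ^~ z @ \oo --> chi z) -> (forall n, LL (chi_ n) = 0) ->
  adm K1 K2 M chi /\ LL chi = 0.
Proof.
move=> ac cc L0.
have ac0 : adm K1 K2 M chi.
  split.
  - by apply: (@measurable_fun_cvg _ _ _ _ chi_) => [n|z _]; [have [] := ac n|exact: cc].
  - move=> z nz; have E n : chi_ n z = 0 by have [_ ->] := ac n.
    apply/eqP; rewrite eq_le; apply/andP; split.
      by apply: (cvgr_to_le (cc z)); apply: nearW => n; rewrite E.
    by apply: (cvgr_to_ge (cc z)); apply: nearW => n; rewrite E.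
  - move=> z; have E n : `|chi_ n z| <= M by have [_ _] := ac n.
    by apply: (cvgr_to_le (cvg_norm (cc z))); apply: nearW => n; exact: E.
split => //.
have ad n : adm K1 K2 (M + M) (fun z => chi_ n z - chi z).
  have [m1 v1 b1] := ac n; have [m2 v2 b2] := ac0; split.
  - exact: measurable_funB.
  - by move=> z nz; rewrite v1// v2// subrr.
  - by move=> z; apply: le_trans (ler_normB _ _) _; exact: lerD.
have c0 z : (fun n => chi_ n z - chi z) @ \oo --> (0 : R).
  by rewrite -(subrr (chi z)); apply: cvgB => //; exact: cvg_cst.
have T k : tends0 (fun n => cm_integral (nu k) D (fun z => (chi_ n z - chi z)%:C * p k z)).
  have ii n := adm_integrable k (ad n).
  have [f1 f2 f3 f4] := nu_fin k c1 KO c2.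
  have t1 : tends0 (fun n => cintegral (re_pos (nu k)) D (fun z =>
    (chi_ n z - chi z)%:C * p k z)).
    by apply: dct1 => // n; case: (ii n).
  have t2 : tends0 (fun n => cintegral (re_neg (nu k)) D (fun z =>
    (chi_ n z - chi z)%:C * p k z)).
    by apply: dct1 => // n; case: (ii n).
  have t3 : tends0 (fun n => cintegral (im_pos (nu k)) D (fun z =>
    (chi_ n z - chi z)%:C * p k z)).
    by apply: dct1 => // n; case: (ii n).
  have t4 : tends0 (fun n => cintegral (im_neg (nu k)) D (fun z =>
    (chi_ n z - chi z)%:C * p k z)).
    by apply: dct1 => // n; case: (ii n).
  have neg (z : nat -> R[i]) : tends0 z -> tends0 (fun n => - z n).
    by apply: tends0_le => n; rewrite normc_opp.
  apply: tends0D; first exact: tends0D t1 (neg _ t2).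
  exact: (tends0M (y := fun=> 0 +i* 1) (fun n => lexx _) (tends0D t3 (neg _ t4))).
have S := tends0_sum (index_enum _) (fun k (_ : xpredT k) => T k).
have {}S : tends0 (fun n => LL (fun z => chi_ n z - chi z)) by exact: S.
apply/oppr_inj; rewrite oppr0 -[LHS]sub0r; apply: (@tends0_cst R).
by apply: tends0_ext S => n; rewrite (LLB (ac n) ac0) L0.
Qed.

End rectangle.

Definition obox2 (a b a' b' : V) : set (V * V) := obox a b `*` obox a' b'.

Lemma adm_indic K1 K2 E : measurable E -> E `<=` K1 `*` K2 -> adm K1 K2 1 (\1_E).
Proof.
move=> mE EK; split; first exact: measurable_indic.
  by move=> z nz; rewrite indicE memNset// => /EK.
by move=> z; rewrite indicE ger0_norm; case: (_ \in _).
Qed.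

Lemma LL_obox (a b a' b' : V) : cbox a b `<=` Omega ->
  LL (\1_(obox2 a b a' b') : V * V -> R) = 0.
Proof.
move=> aO.
(* The bump in x occurs twice because it serves both as phi1 and as phi2; the limit, an indicator,
   equals its square. *)
pose h n z : R := box_bump n.+1%:R a b z.1 * box_bump n.+1%:R a b z.1 * box_bump n.+1%:R a' b'
  z.2.
have n0 n : 0 < n.+1%:R :> R by rewrite ltr0n.
have mb n (e f : V) : measurable_fun setT (box_bump n.+1%:R e f).
  by apply: continuous_measurable_rVR; apply: rsmooth_continuous; exact: rsmooth_box_bump.
have bb n (e f x : V) : 0 <= box_bump n.+1%:R e f x <= 1 by rewrite box_bump_ge0 box_bump_le1.
suff [] : adm (cbox a b) (cbox a' b') 1 (\1_(obox2 a b a' b')) /\ LL (\1_(obox2 a b a' b')) =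
  0 by [].
apply: (@LL_dct (cbox a b) (cbox a' b') (@cbox_compact _ _ a b) aO (@cbox_compact _ _ a' b') 1
  h).
- move=> n; split.
  + apply: measurable_funM; first apply: measurable_funM.
    * exact: measurableT_comp (mb n a b) (@measurable_fst _ _ V V).
    * exact: measurableT_comp (mb n a b) (@measurable_fst _ _ V V).
    * exact: measurableT_comp (mb n a' b') (@measurable_snd _ _ V V).
  + move=> z nz; rewrite /h; have [z1|nz1] := pselect (obox a b z.1).
      rewrite (box_bump_out (a := a')) ?mulr0// => z2; apply: nz.
      by split; exact: obox_sub_cbox.
    by rewrite (box_bump_out (a := a)) ?mul0r.
  + move=> z; have /andP[x0 x1] := bb n a b z.1; have /andP[y0 y1] := bb n a' b' z.2.
    by rewrite /h ger0_norm ?mulr_ge0// mulr_ile1 ?mulr_ge0// mulr_ile1.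
- move=> z; have c1 := @cvg_box_bump R d a b z.1; have c2 := @cvg_box_bump R d a' b' z.2.
  have L := cvgM (cvgM c1 c1) c2.
  have E : (\1_(obox2 a b a' b') z : R) = \1_(obox a b) z.1 * \1_(obox a b) z.1 * \1_(obox a'
    b') z.2.
    by rewrite !indicE in_setX; case: (_ \in _); case: (_ \in _); rewrite ?mulr1 ?mulr0 ?mul0r.
  by rewrite E; exact: L.
- move=> n; have t1 := test_box_bump (n0 n) aO.
  have tp : TF (fun y => (box_bump n.+1%:R a' b' y)%:C : R[i]).
    split; first by apply: smooth_real; exact: rsmooth_box_bump.
    have [M [M0 HM]] := compact_sub_cube (@cbox_compact _ _ a' b').
    exists M; split => // x nx; rewrite box_bump_out// => bx; apply: nx; apply: HM.
    exact: obox_sub_cbox.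
  rewrite -[RHS](p0 t1 t1 tp); apply: eq_bigr => k _; apply: eq_cm_integral => z _.
  by rewrite /h !RcM conjc_real.
Qed.

Lemma obox_measurable (a b : V) : measurable (obox a b).
Proof.
rewrite (_ : obox a b = \bigcap_(i in [set: 'I_d]) ((fun x : V => x 0 i) @^-1` `]a 0 i,
  b 0 i[)).
  apply: fin_bigcap_measurable => // i _; rewrite -[X in measurable X]setTI.
  exact: measurable_coord.
apply/seteqP; split=> x h.
  by move=> i _ /=; rewrite in_itv/= h.
by move=> i; have := h i I; rewrite /= in_itv.
Qed.

Definition boxes : set (set (V * V)) := [set E | exists a b a' b', E = obox2 a b a' b'].

Lemma obox2I (a b a' b' e f e' f' : V) : obox2 a b a' b' `&` obox2 e f e' f' =
  obox2 (\row_i Num.max (a 0 i) (e 0 i)) (\row_i Num.min (b 0 i) (f 0 i))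
        (\row_i Num.max (a' 0 i) (e' 0 i)) (\row_i Num.min (b' 0 i) (f' 0 i)).
Proof.
have H (a1 b1 a2 b2 : V) x : (obox a1 b1 x /\ obox a2 b2 x) <->
    obox (\row_i Num.max (a1 0 i) (a2 0 i)) (\row_i Num.min (b1 0 i) (b2 0 i)) x.
  split=> [[h1 h2] i|h].
    by rewrite !mxE gt_max lt_min; have /andP[-> ->] := h1 i; have /andP[-> ->] := h2 i.
  by split=> i; have := h i; rewrite !mxE gt_max lt_min => /andP[/andP[h1 h2] /andP[h3 h4]];
    exact/andP.
apply/seteqP; split=> z.
  by move=> [[z1 z2] [z3 z4]]; split; apply/H.
by move=> [/H[z1 z3] /H[z2 z4]].
Qed.

Lemma open_bigcup_obox (O : set V) : open O ->
  O = \bigcup_(t : 'rV[rat]_d * 'rV[rat]_d)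
    if `[< obox (map_mx ratr t.1) (map_mx ratr t.2) `<=` O >]
    then obox (map_mx ratr t.1) (map_mx ratr t.2) else set0.
Proof.
move=> OO; apply/seteqP; split=> [x Ox|x [t _]]; last first.
  by case: asboolP => // tO; exact: tO.
have /nbhs_ballP[e /= e0 HO] : nbhs x O by exact: open_nbhs_nbhs.
have lo_ (i : 'I_d) : exists s : rat, x 0 i - e / 2 < ratr s < x 0 i.
  have /rat_in_itvoo[s] : x 0 i - e / 2 < x 0 i by rewrite ltrBlDr ltrDl divr_gt0.
  by rewrite in_itv/=; exists s.
have hi_ (i : 'I_d) : exists s : rat, x 0 i < ratr s < x 0 i + e / 2.
  have /rat_in_itvoo[s] : x 0 i < x 0 i + e / 2 by rewrite ltrDl divr_gt0.
  by rewrite in_itv/=; exists s.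
have [lo Hlo] := choice lo_; have [hi Hhi] := choice hi_.
exists (\row_i lo i, \row_i hi i) => //; case: asboolP => [_ i|[]].
  by rewrite !mxE; have /andP[_ ->] := Hlo i; have /andP[-> _] := Hhi i.
move=> y h; apply: HO; split => // i0 i; rewrite ord1 -ball_normE /ball_ /=.
have := h i; rewrite /= !mxE => /andP[h1 h2].
have /andP[h3 h4] := Hlo i; have /andP[h5 h6] := Hhi i.
by rewrite ltr_norml; lra.
Qed.

Let whole : [set: V] = \bigcup_n obox (\row_i - n%:R) (\row_i n%:R).
Proof.
apply/esym; rewrite -subTset => x _; have [n Hn] : exists n : nat, `|x| < n%:R.
  by exists (Num.bound `|x|); rewrite archi_boundP.
exists n => // i; rewrite !mxE -ltr_norml; exact: le_lt_trans (rV_norm_coord x i) Hn.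
Qed.

(** It is enough that both projections are measurable for the generated sigma-algebra. An open set
    is a countable union of rational boxes, and the other factor is exhausted by boxes of integer
    half-width, so preimages of open sets are countable unions of [boxes]. *)
Lemma boxes_generate : @measurable _ (V * V)%type = <<s boxes >>.
Proof.
apply/seteqP; split; last first.
  apply: smallest_sub; first exact: sigma_algebra_measurable.
  by move=> _ [a [b [a' [b' ->]]]]; apply: measurableX; exact: obox_measurable.
pose T := g_sigma_algebraType boxes.
have mbox a b a' b' : measurable (obox2 a b a' b' : set T).
  by apply: sub_sigma_algebra; do 4 eexists.
have m1 : measurable_fun setT (fun z : T => z.1).
  apply: (measurability [set A : set V | open A]) => //.
  move=> _ [U oU <-]; rewrite setTI.
  rewrite (open_bigcup_obox oU) preimage_bigcup.
  apply: countable_bigcupT_measurable => // t; case: asboolP => _;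
    last by rewrite preimage_set0.
  rewrite (_ : _ @^-1` _ = \bigcup_n obox2 (map_mx ratr t.1) (map_mx ratr t.2) (\row_i - n%:R)
    (\row_i n%:R)).
    by apply: bigcup_measurable => n _; exact: mbox.
  apply/seteqP; split=> z; last by move=> [n _ []].
  move=> z1; have [n _ z2] : (\bigcup_n obox (\row_i - n%:R) (\row_i n%:R)) z.2 by rewrite
    -whole.
  by exists n.
have m2 : measurable_fun setT (fun z : T => z.2).
  apply: (measurability [set A : set V | open A]) => //.
  move=> _ [U oU <-]; rewrite setTI.
  rewrite (open_bigcup_obox oU) preimage_bigcup.
  apply: countable_bigcupT_measurable => // t; case: asboolP => _;
    last by rewrite preimage_set0.
  rewrite (_ : _ @^-1` _ = \bigcup_n obox2 (\row_i - n%:R) (\row_i n%:R) (map_mx ratr t.1)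
    (map_mx ratr t.2)).
    by apply: bigcup_measurable => n _; exact: mbox.
  apply/seteqP; split=> z; last by move=> [n _ []].
  move=> z2; have [n _ z1] : (\bigcup_n obox (\row_i - n%:R) (\row_i n%:R)) z.1 by rewrite
    -whole.
  by exists n.
move=> E mE; have := measurable_fun_pair m1 m2 measurableT mE.
rewrite setTI (_ : _ @^-1` _ = E)//; apply/seteqP; split=> -[z1 z2]; exact.
Qed.

(** Dynkin's lemma inside a fixed box [Q] whose closure projects into Omega. This localization keeps
    all the functions in one class [adm], so complements and countable disjoint unions can be
    taken. *)
Lemma LL_small (a b a' b' : V) E : cbox a b `<=` Omega -> measurable E ->
  LL (\1_(E `&` obox2 a b a' b') : V * V -> R) = 0.
Proof.
move=> aO mE; pose Q := obox2 a b a' b'.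
have mQ : measurable Q by apply: measurableX; exact: obox_measurable.
have QK : Q `<=` cbox a b `*` cbox a' b' by move=> z [z1 z2]; split; exact: obox_sub_cbox.
have aI F : measurable F -> adm (cbox a b) (cbox a' b') 1 (\1_(F `&` Q)).
  move=> mF; apply: adm_indic; first exact: measurableI.
  by move=> z [_ /QK].
have ca := @cbox_compact _ _ a b; have ca' := @cbox_compact _ _ a' b'.
have {mE} : <<s boxes >> E by rewrite -boxes_generate.
move: E; apply: (dynkin_induction boxes_generate).
- by move=> _ _ [a1 [b1 [a2 [b2 ->]]]] [a3 [b3 [a4 [b4 ->]]]]; rewrite obox2I; do 4 eexists.
- rewrite /Q setTI; exact: LL_obox.
- move=> _ [a1 [b1 [a2 [b2 ->]]]]; rewrite /Q obox2I; apply: LL_obox => x h; apply: aO => i.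
  by have := h i; rewrite !mxE ge_max le_min => /andP[/andP[_ ->] /andP[_ ->]].
- move=> F mF LF.
  have -> : (\1_(~` F `&` Q) : V * V -> R) = (fun z => \1_(setT `&` Q) z - \1_(F `&` Q) z).
    apply/funext => z; rewrite !indicE !in_setI in_setT in_setC.
    by case: (z \in F); case: (z \in Q); rewrite ?subrr ?subr0.
  rewrite (LLB ca aO ca' (aI _ measurableT) (aI _ mF)) LF subr0 setTI; exact: LL_obox.
- move=> F mF tF LF.
  have [//|||_ ->//] := @LL_dct _ _ ca aO ca' 1 (fun n =>
    \1_((\bigcup_(k < n) F k) `&` Q)) (\1_((\bigcup_k F k) `&` Q)).
  + move=> n; apply: aI; exact: bigcup_measurable.
  + move=> z; have [[k _ Fk]|nF] := pselect ((\bigcup_k F k) z); last first.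
      rewrite (_ : (fun n => _) = fun=> \1_((\bigcup_k F k) `&` Q) z); first exact: cvg_cst.
      apply/funext => n; rewrite !indicE !memNset// => -[]; [by []|].
      by move=> [k _ Fk] _; apply: nF; exists k.
    apply: cvg_near_cst; exists k.+1 => // n /= kn; apply/eqP; rewrite !indicE !in_setI.
    have -> : z \in \bigcup_(k < n) F k by apply: mem_set; exists k.
    by have -> : z \in \bigcup_k F k by apply: mem_set; exists k.
  + elim=> [|n ih].
      (* The indicator of the empty union is written as a difference of equal functions, so that
         [LLB] gives the value 0. *)
      rewrite (_ : \1_ _ = (fun z => \1_(F 0%N `&` Q) z - \1_(F 0%N `&` Q) z)); last first.
        by apply/funext => z; rewrite subrr indicE memNset//; case=> -[k /= kn _] _.
      by rewrite (LLB ca aO ca' (aI _ (mF _)) (aI _ (mF _))) subrr.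
    have -> : (\1_((\bigcup_(k < n.+1) F k) `&` Q) : V * V -> R) =
        (fun z => \1_((\bigcup_(k < n) F k) `&` Q) z + \1_(F n `&` Q) z).
      apply/funext => z; rewrite !indicE ![z \in _ `&` Q]in_setI.
      case: (boolP (z \in Q)) => Qz; last by rewrite !andbF addr0.
      rewrite !andbT; have [Fz|nFz] := pselect (F n z).
        rewrite (mem_set Fz) mem_set; last by exists n => //=.
        rewrite memNset ?add0r// => -[k /= kn Fk].
        have E : k = n by apply: tF => //; exists z.
        by rewrite E ltnn in kn.
      rewrite (memNset nFz) addr0; congr ((_ : bool)%:R).
      apply/idP/idP => /set_mem[k /= kn Fk]; apply: mem_set; exists k => //=.
        by move: kn; rewrite ltnS leq_eqVlt => /orP[/eqP E|//]; rewrite E in Fk.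
      by rewrite ltnS ltnW.
    by rewrite (LLD ca aO ca' (aI _ _) (aI _ (mF n))) ?ih ?LF ?addr0//;
      exact: bigcup_measurable.
Qed.

(** Cuts [E] along one box at a time; [LL_small] handles the part inside the box and the induction
    the rest, which the remaining boxes cover. *)
Lemma LL_cover (s : seq (V * V * (V * V))) E :
  (forall t, t \in s -> cbox t.1.1 t.1.2 `<=` Omega) -> measurable E ->
  forall K1 K2, compact K1 -> K1 `<=` Omega -> compact K2 ->
  E `<=` K1 `*` K2 ->
  (forall z, E z -> exists2 t, t \in s & obox2 t.1.1 t.1.2 t.2.1 t.2.2 z) ->
  LL (\1_E : V * V -> R) = 0.
Proof.
move=> sO mE K1 K2 c1 KO c2; elim: s sO E mE => [|t s ih] sO E mE EK cov.
  have aE := adm_indic mE EK.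
  rewrite (_ : \1_ _ = (fun z => \1_E z - \1_E z)); first by rewrite (LLB c1 KO c2 aE aE) subrr.
  apply/funext => z; rewrite subrr indicE memNset// => /cov[t].
  by rewrite in_nil.
pose Q := obox2 t.1.1 t.1.2 t.2.1 t.2.2.
have mQ : measurable Q by apply: measurableX; exact: obox_measurable.
have mI : measurable (E `&` Q) by exact: measurableI.
have mN : measurable (E `&` ~` Q) by apply: measurableI => //; exact: measurableC.
have IK : E `&` Q `<=` K1 `*` K2 by move=> z [/EK].
have NK : E `&` ~` Q `<=` K1 `*` K2 by move=> z [/EK].
have -> : (\1_E : V * V -> R) = (fun z => \1_(E `&` Q) z + \1_(E `&` ~` Q) z).
  apply/funext => z; rewrite !indicE ![z \in E `&` _]in_setI in_setC.
  by case: (z \in E); case: (z \in Q); rewrite ?addr0 ?add0r.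
rewrite (LLD c1 KO c2 (adm_indic mI IK) (adm_indic mN NK)).
rewrite LL_small ?add0r//; last by apply: sO; exact: mem_head.
apply: ih => //; first by move=> t' t's; apply: sO; rewrite inE t's orbT.
move=> z [Ez nQz]; have [t'] := cov z Ez.
by rewrite inE => /orP[/eqP->//|t's zt]; exists t'.
Qed.

Lemma vanishing_density B : rel_compact D B ->
  \sum_k cm_integral (nu k) B (p k) = 0.
Proof.
move=> [mB [K [cK KD BK]]].
have c1 : compact (fst @` K) by apply: continuous_compact => //;
  apply: continuous_subspaceT => z; exact: cvg_fst.
have c2 : compact (snd @` K) by apply: continuous_compact => //;
  apply: continuous_subspaceT => z; exact: cvg_snd.
have K1O : fst @` K `<=` Omega by move=> _ [z /KD[Oz _] <-].
have BK2 : B `<=` (fst @` K) `*` (snd @` K) by move=> z /BK Kz; split; exists z.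
have BD : B `<=` D by move=> z /BK /KD.
have -> : \sum_k cm_integral (nu k) B (p k) = LL (\1_B).
  apply: eq_bigr => k _.
  have E (m : {measure set (V * V) -> \bar R}) : cintegral m B (p k) =
      cintegral m D (fun z => (\1_B z)%:C * p k z).
    rewrite cintegral_mkcond [RHS]cintegral_mkcond; apply: eq_cintegral => z _.
    rewrite indicE; case: ifPn => [/set_mem Bz|/negP nBz].
      by rewrite !mem_set ?mul1r//; exact: BD.
    by case: ifP => // _; rewrite mul0r.
  by rewrite /cm_integral !E.
have /choice[rho Hrho] : forall y : V, exists rho, Omega y -> 0 < rho /\
    cbox (\row_i (y 0 i - rho)) (\row_i (y 0 i + rho)) `<=` Omega.
  move=> y; have [Oy|nOy] := pselect (Omega y); last by exists 0.
  have /nbhs_ballP[e /= e0 HO] : nbhs y Omega by exact: open_nbhs_nbhs.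
  exists (e / 2) => _; split; first by rewrite divr_gt0.
  move=> x h; apply: HO; split => // i0 i; rewrite ord1 -ball_normE /ball_ /=.
  by have := h i; rewrite !mxE ltr_norml => /andP[h1 h2]; lra.
have [s [sK cov]] := compact_cover_box c1 (fun y Ky => (Hrho y (K1O y Ky)).1).
have [M [M0 HM]] := compact_sub_cube c2.
(* The half-width M + 1 is needed because these boxes are open while [HM] only gives coordinates of
   modulus at most [M]. *)
pose bx (y : V) : V * V * (V * V) := ((\row_i (y 0 i - rho y), \row_i (y 0 i + rho y)),
    (\row_i - (M + 1), \row_i (M + 1))).
apply: (@LL_cover [seq bx y | y <- s] B _ mB _ _ c1 K1O c2 BK2).
  by move=> _ /mapP[y ys ->] /=; exact: (Hrho y (K1O y (sK y ys))).2.
move=> z Bz; have [z1 z2] := BK2 z Bz.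
have [y ys zy] := cov _ z1.
exists (bx y); first by apply/mapP; exists y.
split=> i /=; rewrite !mxE.
  by have := zy i; rewrite ltr_norml => /andP[h1 h2]; apply/andP; split; lra.
by have := HM _ z2 i; rewrite ler_norml => /andP[h1 h2]; apply/andP; split; lra.
Qed.

End vanishing_density.

(** * Integrals against complex measures with the same values *)

Section equal_values.
Context dd (T : measurableType dd) (R : realType).
Implicit Types (m n : {measure set T -> \bar R}) (B E : set T) (f : T -> R[i]).

Lemma bounded_cintegrable m B f (P : R) : measurable B -> (m B < +oo)%E ->
  cmeasurable_fun B f -> (forall z, B z -> normc (f z) <= P) -> cintegrable m B f.
Proof.
move=> mB Boo mf fP; apply: (@le_cintegrable _ _ _ m B f (fun=> P)) => //.
apply/integrableP; split; first exact: measurable_cst.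
by rewrite integral_cst// lte_mul_pinfty// abse_ge0.
Qed.

(** Equality of the differences m1 - n1 and m2 - n2 is rearranged into equality of the positive
    measures m1 + n2 and m2 + n1 on subsets of [B], whose integrals then agree. *)
Let Rintegral_ext m1 n1 m2 n2 B (g : T -> R) : measurable B ->
  [/\ (m1 B < +oo)%E, (n1 B < +oo)%E, (m2 B < +oo)%E & (n2 B < +oo)%E] ->
  (forall E, measurable E -> E `<=` B ->
    fine (m1 E) - fine (n1 E) = fine (m2 E) - fine (n2 E)) ->
  m1.-integrable B (EFin \o g) -> n1.-integrable B (EFin \o g) ->
  m2.-integrable B (EFin \o g) -> n2.-integrable B (EFin \o g) ->
  \int[m1]_(x in B) g x - \int[n1]_(x in B) g x = \int[m2]_(x in B) g x - \int[n2]_(x in B) g x.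
Proof.
move=> mB [f1 f2 f3 f4] H i1 i2 i3 i4.
have fin m E : measurable E -> E `<=` B -> (m B < +oo)%E -> m E \is a fin_num.
  move=> mE EB mBoo; rewrite ge0_fin_numE//; apply: le_lt_trans mBoo.
  by apply: le_measure; rewrite ?inE.
have : (\int[measure_add m1 n2]_(x in B) (EFin \o g) x =
  \int[measure_add m2 n1]_(x in B) (EFin \o g) x)%E.
  apply: eq_measure_integral => E mE EB.
  apply: etrans (measure_addE m1 n2 E) _; apply: etrans (esym (measure_addE m2 n1 E)).
  have := H E mE EB.
  rewrite -(fineK (fin m1 E mE EB f1)) -(fineK (fin n1 E mE EB f2)).
  rewrite -(fineK (fin m2 E mE EB f3)) -(fineK (fin n2 E mE EB f4)) /= => h.
  by congr (_%:E); lra.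
rewrite !integral_measure_add// /Rintegral => h.
have F m : m.-integrable B (EFin \o g) -> (\int[m]_(x in B) (EFin \o g) x)%E \is a fin_num.
  exact: integrable_fin_num.
move: h; rewrite -(fineK (F _ i1)) -(fineK (F _ i2)) -(fineK (F _ i3)) -(fineK (F _ i4)).
rewrite -!EFinD => -[]; rewrite /comp; lra.
Qed.

(** Bridges the gap between hermitian symmetry, which concerns values on sets, and the density,
    which is defined by integrals against a chosen decomposition. *)
Lemma cm_integral_ext (nu1 nu2 : cmeasure T R) B f (P : R) : measurable B ->
  cm_finite nu1 B -> cm_finite nu2 B -> cmeasurable_fun B f ->
  (forall z, B z -> normc (f z) <= P) ->
  (forall E, measurable E -> E `<=` B -> cm_val nu1 E = cm_val nu2 E) ->
  cm_integral nu1 B f = cm_integral nu2 B f.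
Proof.
move=> mB [a1 a2 a3 a4] [b1 b2 b3 b4] mf fP H.
have I m : (m B < +oo)%E -> cintegrable m B f.
  by move=> mBoo; exact: bounded_cintegrable mB mBoo mf fP.
have re := Rintegral_ext mB (And4 a1 a2 b1 b2) (fun E mE EB =>
  congr1 (@complex.Re R) (H E mE EB)).
have im := Rintegral_ext mB (And4 a3 a4 b3 b4) (fun E mE EB =>
  congr1 (@complex.Im R) (H E mE EB)).
have e1 := re _ (I _ a1).1 (I _ a2).1 (I _ b1).1 (I _ b2).1.
have e2 := re _ (I _ a1).2 (I _ a2).2 (I _ b1).2 (I _ b2).2.
have e3 := im _ (I _ a3).1 (I _ a4).1 (I _ b3).1 (I _ b4).1.
have e4 := im _ (I _ a3).2 (I _ a4).2 (I _ b3).2 (I _ b4).2.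
rewrite /cm_integral; congr (_ + _ * _); apply: complexP; rewrite ?cReD ?cImD !raddfN;
  assumption.
Qed.

End equal_values.

(** * Vanishing of the density for the limit symbol *)

Section symbol_vanishing.
Variables (R : realType) (d q r l m : nat) (Omega : set 'rV[R]_d).
Hypothesis oO : open Omega.
Local Notation V := ('rV[R]_d).
Local Notation Leb := (lebesgue_rV R d).
Local Notation D := (Omega `*` [set: V]).
Implicit Types (phi psi : V -> R[i]) (alpha : mindex d m).
Variables (u : nat -> V -> 'cV[R[i]]_r) (eps w : nat -> R).
Variables (A : nat -> mindex d m -> V -> 'M[R[i]]_(q, r)) (Ainf : mindex d m -> V ->
  'M[R[i]]_(q, r)).
Variables (f : nat -> functional R d q) (mu : 'M[cmeasure (V * V)%type R]_r).
Hypothesis uL2 : forall n, L2loc Omega (u n).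
Hypothesis uw : weak_cvg0 Omega u.
Hypothesis eps_gt0 : forall n, 0 < eps n.
Hypothesis w_gt0 : forall n, 0 < w n.
Hypothesis w_cvg0 : w @ \oo --> (0 : R).
Local Notation ord alpha := (l <= mlen alpha <= m)%N.
Hypothesis cA : forall n alpha, ord alpha -> forall j k,
  cont_on Omega (fun x => A n alpha x j k).
Hypothesis cvA : forall alpha, ord alpha -> forall j k,
  loc_unif Omega (fun n x => A n alpha x j k) (fun x => Ainf alpha x j k).
Hypothesis fg : forall phi, test_function Omega phi ->
  exists2 g : nat -> V -> 'cV[R[i]]_q, forall n, fourier_mul (f n) phi (g n) &
    (\int[Leb]_xi (sqnorm (g n xi) / weight l m (eps n) xi ^+ 2)%:E)%E @[n --> \oo] --> 0%E.
Hypothesis uf : forall n, solves l Omega (eps n) (A n) (u n) (f n).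
Hypothesis sc : semiclassical_measure Omega u w mu.
Variables (S : nat -> R) (kap : nat -> nat -> R) (klim : nat -> R) (C : R).
Hypothesis S_gt0 : forall n, 0 < S n.
Hypothesis SC : forall n, S n <= C.
Hypothesis SE : forall n s, (l <= s <= m)%N -> S n * eps n ^+ (s - l) = kap s n * w n ^+ s.
Hypothesis kap_cvg : forall s, kap s @ \oo --> klim s.

(** One formula for all three cases of [symbol]: the limits [klim] are 0 at the orders that drop
    out. *)
Definition limit_symbol (z : V * V) : 'M[R[i]]_(q, r) :=
  \sum_(alpha : mindex d m | ord alpha)
    ((klim (mlen alpha))%:C * (twopii R ^+ mlen alpha * (monom alpha z.2)%:C)) *: Ainf alpha
      z.1.

(** The sign from the definition of distributional derivatives cancels that of [dmul], which is -2
    pi i times the coordinate. *)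
Lemma dmuls_mseq alpha psi y : (-1) ^+ mlen alpha * dmuls (mseq alpha) psi y =
  twopii R ^+ mlen alpha * (monom alpha y)%:C * psi y.
Proof.
rewrite /dmuls mulrA; congr (_ * _).
have dE i : dmul i y = - twopii R * (y 0 i)%:C.
  by apply: complexP; rewrite /dmul /twopii ?cReM ?cImM /=; move: (@pi R) => t; ring.
have -> : \prod_(i <- mseq alpha) dmul i y = (- twopii R) ^+ mlen alpha * (monom alpha y)%:C.
  rewrite /mseq big_flatten big_map /monom /mlen -prodrXr big_enum /=.
  rewrite (rmorph_prod (real_complex R)) -big_split /=; apply: eq_bigr => i _.
  by rewrite big_nseq iter_mulr_1 dE exprMn (rmorphXn (real_complex R)).
by rewrite mulrA -exprMn mulN1r opprK.
Qed.

Let monom_smooth alpha : rsmooth (monom alpha : V -> R).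
Proof.
apply: rsmooth_prod => i; elim: (nat_of_ord (alpha i)) => [|n ih].
  exact: rsmooth_cst.
rewrite (_ : (fun x : V => x 0 i ^+ n.+1) = (fun x => x 0 i) * (fun x => x 0 i ^+ n)).
  exact: rsmoothM (rsmooth_coord _ _) ih.
by apply/funext => x; rewrite exprS.
Qed.

Let Ainf_cont alpha j k : ord alpha -> cont_on Omega (fun x => Ainf alpha x j k).
Proof. by move=> oa; exact: (@loc_unif_cont _ _ _ oO (fun n x => A n alpha x j k) _ (fun n =>
  cA n oa j k) (cvA oa j k)). Qed.

Let limit_symbolE z j k : limit_symbol z j k =
  \sum_(alpha : mindex d m | ord alpha)
    (klim (mlen alpha))%:C * (twopii R ^+ mlen alpha * (monom alpha z.2)%:C) * Ainf alpha z.1 j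
      k.
Proof. by rewrite /limit_symbol summxE; apply: eq_bigr => alpha _; rewrite mxE. Qed.

Lemma limit_symbol_measurable j k : cmeasurable_fun D (fun z => limit_symbol z j k).
Proof.
have mO := open_measurable_rV oO.
(* The coefficients are controlled only on Omega and for admissible orders, so they are cut off to
   get functions measurable on the whole space. *)
pose a alpha x := if (x \in Omega) && ord alpha then Ainf alpha x j k else 0.
have ma alpha : cmeasurable_fun setT (a alpha).
  have [oa|noa] := boolP (ord alpha); last first.
    by apply: (@eq_cmeasurable _ _ _ _ (fun=> 0)) (cmeasurable_cst _ _) => x;
      rewrite /a (negbTE noa) andbF.
  have [m1 m2] := cont_on_measurable oO (Ainf_cont j k oa).
  apply: (cmeasurable_extend mO); last by move=> x nx; rewrite /a memNset.
  split; [apply: eq_measurable_fun m1|apply: eq_measurable_fun m2];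
    by move=> x xO; rewrite /a xO oa.
have [m1 m2] : cmeasurable_fun setT (fun z : V * V => \sum_(alpha : mindex d m | ord alpha)
    (klim (mlen alpha))%:C * (twopii R ^+ mlen alpha * (monom alpha z.2)%:C) * a alpha z.1).
  apply: cmeasurable_sum => alpha.
  apply: cmeasurableM; last exact: (cmeasurable_comp (@measurable_fst _ _ V V) (ma _)).
  apply: cmeasurableM; first exact: cmeasurable_cst.
  apply: cmeasurableM; first exact: cmeasurable_cst.
  apply: cmeasurable_real; apply: measurableT_comp (@measurable_snd _ _ V V).
  by apply: continuous_measurable_rVR; exact: rsmooth_continuous.
have E z : z \in D -> \sum_(alpha : mindex d m | ord alpha)
    (klim (mlen alpha))%:C * (twopii R ^+ mlen alpha * (monom alpha z.2)%:C) * a alpha z.1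
    = limit_symbol z j k.
  move=> /set_mem[z1 _]; rewrite limit_symbolE; apply: eq_bigr => alpha oa.
  by rewrite /a mem_set// oa.
have mDT (g : V * V -> R) : measurable_fun setT g -> measurable_fun D g by exact:
  measurable_funS.
by split; [apply: (eq_measurable_fun _ _ (mDT _ m1))|apply: (eq_measurable_fun _ _ (mDT _ m2))];
  move=> z /E zE; rewrite -zE.
Qed.

Lemma limit_symbol_bounded j k (K1 K2 : set V) : compact K1 -> K1 `<=` Omega -> compact K2 ->
  exists P, 0 <= P /\ forall z, (K1 `*` K2) z -> normc (limit_symbol z j k) <= P.
Proof.
move=> c1 KO c2.
have /choice[P HP] alpha : exists P, 0 <= P /\ (ord alpha -> forall z, (K1 `*` K2) z ->
    normc ((klim (mlen alpha))%:C * (twopii R ^+ mlen alpha * (monom alpha z.2)%:C) * Ainf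
      alpha z.1 j k) <= P).
  have [oa|noa] := boolP (ord alpha); last by exists 0.
  have [Pa [Pa0 HPa]] := cont_on_bounded (Ainf_cont j k oa) c1 KO.
  have [Pm [Pm0 HPm]] := compact_ubound c2 (rsmooth_continuous (monom_smooth alpha)).
  exists (normc (klim (mlen alpha))%:C * (normc (twopii R ^+ mlen alpha) * Pm) * Pa).
  split; first by rewrite !mulr_ge0 ?normc_ge0.
  move=> _ z [z1 z2]; rewrite !Normc.normcM.
  apply: ler_pM; rewrite ?mulr_ge0 ?normc_ge0 ?HPa//.
  by rewrite !ler_wpM2l ?normc_ge0// normc_real HPm.
exists (\sum_alpha P alpha); split; first by rewrite sumr_ge0// => alpha _; exact: (HP alpha).1.
move=> z Kz; rewrite limit_symbolE big_mkcond /=.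
elim/big_ind2: _ => [|x1 x2 y1 y2 h1 h2|alpha _].
- by rewrite Normc.normc0.
- by apply: le_trans (le_normcD _ _) _; exact: lerD.
- by case: ifP => oa; [exact: (HP alpha).2|rewrite Normc.normc0; exact: (HP alpha).1].
Qed.

Lemma limit_symbol_test j k' phi1 phi2 psi : test_function Omega phi1 ->
  test_function Omega phi2 -> TF psi ->
  \sum_k cm_integral (cm_conj (mu k k')) D
    (fun z => phi1 z.1 * conjc (phi2 z.1) * psi z.2 * limit_symbol z j k) = 0.
Proof.
move=> t1 t2 tp.
have L := limit_identity oO uL2 uw eps_gt0 w_gt0 w_cvg0 cA cvA fg uf sc S_gt0 SC SE kap_cvg j
  k' t1 t2 tp.
rewrite -[RHS]L.
transitivity (\sum_k \sum_(alpha : mindex d m | ord alpha) ((klim (mlen alpha))%:C * (-1) ^+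
  mlen alpha) *
   cm_integral (cm_conj (mu k k')) D (fun z => phi1 z.1 * Ainf alpha z.1 j k * conjc (phi2 z.1)
     * dmuls (mseq alpha) psi z.2)).
  apply: eq_bigr => k _.
  have ii alpha : ord alpha -> cm_integrable (cm_conj (mu k k')) D
      (fun z => phi1 z.1 * Ainf alpha z.1 j k * conjc (phi2 z.1) * dmuls (mseq alpha) psi z.2).
    move=> oa; have [s1 [K [cK KO vK]]] := t1; have [s2 _] := t2.
    have [sd [M [M0 vM]]] := TF_dmuls (mseq alpha) tp.
    have [P1 [P10 HP1]] := smooth_bounded s1 cK.
    have [P2 [P20 HP2]] := smooth_bounded s2 cK.
    have [P3 [P30 HP3]] := smooth_bounded sd (@cube_compact _ _ M).
    have [P4 [P40 HP4]] := cont_on_bounded (Ainf_cont j k oa) cK KO.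
    have mT (h : V -> R[i]) : smooth h -> cmeasurable_fun Omega h.
      by move=> /smooth_cmeasurable[m1 m2]; split; exact: measurable_funS measurableT _ _.
    have [||||ii _] := @cm_integral_bounded _ _ _ _ oO _ _ _ sc
      (fun x => phi1 x * Ainf alpha x j k * conjc (phi2 x)) _ k k' K M (P1 * P4 * P2 * P3) cK
        KO _ _ (smooth_cmeasurable sd) vM.
    - apply: cmeasurableM; last by apply: cmeasurable_conj; exact: mT.
      by apply: cmeasurableM; [exact: mT|exact: cont_on_measurable (Ainf_cont j k oa)].
    - by move=> x nx; rewrite vK// !mul0r.
    - by rewrite !mulr_ge0.
    - move=> x y Kx; have dB : normc (dmuls (mseq alpha) psi y) <= P3.
        have [My|nMy] := pselect (cube M y); first exact: HP3.
        by rewrite vM// Normc.normc0.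
      move: (dmuls _ psi y) dB => t tB; rewrite !Normc.normcM normc_conj.
      by repeat (apply: ler_pM; rewrite ?mulr_ge0 ?normc_ge0//); rewrite ?HP1 ?HP2 ?HP4.
    exact: ii.
  have iZ alpha (oa : ord alpha) := cm_integrableZl (measurable_domain oO) ((klim (mlen
    alpha))%:C * (-1) ^+ mlen alpha) (ii alpha oa).
  have [_ E] := cm_integral_sum (measurable_domain oO) (index_enum _) iZ.
  have Z : \sum_(alpha : mindex d m | ord alpha) ((klim (mlen alpha))%:C * (-1) ^+ mlen alpha) *
     cm_integral (cm_conj (mu k k')) D (fun z => phi1 z.1 * Ainf alpha z.1 j k * conjc (phi2
       z.1) * dmuls (mseq alpha) psi z.2) =
     \sum_(alpha : mindex d m | ord alpha) cm_integral (cm_conj (mu k k')) D (fun z =>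
       ((klim (mlen alpha))%:C * (-1) ^+ mlen alpha) *
       (phi1 z.1 * Ainf alpha z.1 j k * conjc (phi2 z.1) * dmuls (mseq alpha) psi z.2)).
    by apply: eq_bigr => alpha oa; rewrite (cm_integralZl (measurable_domain oO) _ (ii alpha
      oa)).
  rewrite Z -E; apply: eq_cm_integral => z _.
  rewrite limit_symbolE mulr_sumr; apply: eq_bigr => alpha _.
  rewrite [RHS]mulrCA -[X in _ = _ * X]mulrA dmuls_mseq.
  by move: (phi1 _) (conjc _) (psi _) (Ainf _ _ _ _) (twopii _ ^+ _) (monom _ _)%:C (klim _)%:C
    => *; ring.
rewrite exchange_big /=; apply: eq_bigr => alpha _.
by rewrite mulrA mulr_sumr.
Qed.

Lemma limit_symbol_vanishing B : rel_compact D B ->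
  mx_density limit_symbol mu^T B = 0.
Proof.
move=> rB; have [mB [K [cK KD BK]]] := rB; apply/matrixP => j k'; rewrite !mxE.
have c1 : compact (fst @` K) by apply: continuous_compact => //;
  apply: continuous_subspaceT => z; exact: cvg_fst.
have c2 : compact (snd @` K) by apply: continuous_compact => //;
  apply: continuous_subspaceT => z; exact: cvg_snd.
have K1O : fst @` K `<=` Omega by move=> _ [z /KD[Oz _] <-].
have BK2 : B `<=` (fst @` K) `*` (snd @` K) by move=> z /BK Kz; split; exists z.
have V0 : \sum_k cm_integral (cm_conj (mu k k')) B (fun z => limit_symbol z j k) = 0.
  apply: (@vanishing_density _ _ _ _ oO (fun k => cm_conj (mu k k')) (fun k z =>
    limit_symbol z j k)) => //.
  - move=> k K1 K2 k1 kO k2.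
    by have [_ [_ [f1 f2 f3 f4]]] := radon_finite sc k k' k1 kO k2.
  - by move=> k; exact: limit_symbol_measurable.
  - by move=> k; exact: limit_symbol_bounded.
  - by move=> phi1 phi2 psi; exact: limit_symbol_test.
rewrite -[RHS]V0; apply: eq_bigr => k _; rewrite mxE.
have [P [P0 HP]] := limit_symbol_bounded j k c1 K1O c2.
have BD : B `<=` D by move=> z /BK /KD.
have finB k1 k2 : cm_finite (mu k1 k2) B.
  have [mK [_ [f1 f2 f3 f4]]] := radon_finite sc k1 k2 c1 K1O c2.
  have le (n : {measure set (V * V) -> \bar R}) : (n (fst @` K `*` snd @` K) < +oo)%E ->
    (n B < +oo)%E.
    by apply: le_lt_trans; apply: le_measure; rewrite ?inE.
  by split; exact: le.
have [g1 g2 g3 g4] := finB k k'.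
apply: (cm_integral_ext (P := P) mB (finB k' k)) => //.
- by have [m1 m2] := limit_symbol_measurable j k; split;
  exact: measurable_funS (measurable_domain oO) BD _.
- by move=> z /BK2; exact: HP.
(* The entry (k, k') of the transpose is [mu k' k], whose values are the conjugates of those of
   [mu k k']; hence the vanishing for [cm_conj (mu k k')] carries over. *)
- move=> E mE EB; have [herm _] := sc.1.2 E (conj mE (ex_intro _ K (And3 cK KD (subset_trans EB
  BK)))).
  have := herm k' k; rewrite !mxE => ->.
  by rewrite /cm_val /= opprB.
Qed.

End symbol_vanishing.

(** * The three regimes *)

Lemma cvg_ub (R : realType) (k : nat -> R) (c : R) : k @ \oo --> c -> exists C, forall n,
  k n <= C.
Proof.
move=> /cvg_tends0R/tends0_bounded[C HC]; exists (C + c) => n.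
have := HC n; rewrite normc_real => h; have := ler_norm (k n - c); lra.
Qed.

Lemma cvg_exprn (R : realType) (k : nat -> R) (c : R) p : k @ \oo --> c ->
  (fun n => k n ^+ p) @ \oo --> c ^+ p.
Proof.
move=> kc; elim: p => [|p ih].
  by rewrite expr0; under eq_fun do rewrite expr0; exact: cvg_cst.
by rewrite exprS; under eq_fun do rewrite exprS; exact: cvgM.
Qed.

Lemma increasing_cvg (sigma : nat -> nat) : {homo sigma : a b / (a < b)%N} ->
  sigma @ \oo --> \oo.
Proof.
move=> s P [N _ HN]; exists N => // n /= Nn; apply: HN => /=; apply: leq_trans Nn _.
by elim: n => // n ih; apply: leq_ltn_trans ih (s _ _ _).
Qed.

Theorem corollary9 (R : realType) (d q r l m : nat) (Omega : set 'rV[R]_d)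
  (u : nat -> 'rV[R]_d -> 'cV[R[i]]_r)
  (eps omega : nat -> R)
  (A : nat -> mindex d m -> 'rV[R]_d -> 'M[R[i]]_(q, r))
  (Ainf : mindex d m -> 'rV[R]_d -> 'M[R[i]]_(q, r))
  (f : nat -> functional R d q)
  (c : \bar R) (sigma : nat -> nat)
  (mu : 'M[cmeasure ('rV[R]_d * 'rV[R]_d)%type R]_r) :
  open Omega -> (l <= m)%N ->
  (forall n, L2loc Omega (u n)) -> weak_cvg0 Omega u ->
  (forall n, 0 < eps n) -> (exists M : R, forall n, eps n <= M) ->
  (forall n (alpha : mindex d m), (l <= mlen alpha <= m)%N ->
    {within Omega, continuous (A n alpha)}) ->
  (forall alpha : mindex d m, (l <= mlen alpha <= m)%N ->
    forall K : set 'rV[R]_d, compact K -> K `<=` Omega ->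
      {uniform K, (fun n => A n alpha) @ \oo --> Ainf alpha}) ->
  (forall n, Hloc_neg Omega m (f n)) ->
  (forall phi, test_function Omega phi ->
    exists2 g : nat -> 'rV[R]_d -> 'cV[R[i]]_q,
      forall n, fourier_mul (f n) phi (g n) &
      (\int[lebesgue_rV R d]_xi
         (sqnorm (g n xi) / weight l m (eps n) xi ^+ 2)%:E)%E
        @[n --> \oo] --> 0%E) ->
  (forall n, solves l Omega (eps n) (A n) (u n) (f n)) ->
  (forall n, 0 < omega n) -> omega n @[n --> \oo] --> 0 ->
  (eps n / omega n)%:E @[n --> \oo] --> c ->
  {homo sigma : a b / (a < b)%N} ->
  semiclassical_measure Omega (u \o sigma) (omega \o sigma) mu ->
  forall B, rel_compact (Omega `*` setT) B ->
    mx_density (symbol l Ainf c) mu^T B = 0.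
Proof.
move=> oO lm uL2 uw e0 _ cA uA _ fg uf w0 w_cvg rho_cvg sinc sc B rB.
have sy := increasing_cvg sinc.
have uw' : weak_cvg0 Omega (u \o sigma).
  by move=> K v cK KO mv fv; exact: cvg_comp sy (uw K v cK KO mv fv).
have w_cvg' : (omega \o sigma) @ \oo --> (0 : R) by exact: cvg_comp sy w_cvg.
have rho' : ((eps \o sigma) n / (omega \o sigma) n)%:E @[n --> \oo] --> c by exact: cvg_comp sy
  rho_cvg.
have cA' n (alpha : mindex d m) : (l <= mlen alpha <= m)%N -> forall j k,
    cont_on Omega (fun x => A (sigma n) alpha x j k).
  by move=> oa j k; apply: (within_cont_on oO); exact: cA.
have uA' (alpha : mindex d m) : (l <= mlen alpha <= m)%N -> forall j k,
    loc_unif Omega (fun n x => A (sigma n) alpha x j k) (fun x => Ainf alpha x j k).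
  move=> oa j k K cK KO e ep.
  have [N HN] := uniform_loc_unif j k (uA alpha oa) cK KO ep.
  have [N' _ HN'] := sy _ (nbhs_infty_ge N).
  by exists N' => n nN; apply: HN; exact: (HN' n nN).
have fg' phi : test_function Omega phi -> exists2 g : nat -> 'rV[R]_d -> 'cV[R[i]]_q,
    forall n, fourier_mul ((f \o sigma) n) phi (g n) &
    (\int[lebesgue_rV R d]_xi (sqnorm (g n xi) / weight l m ((eps \o sigma) n) xi ^+ 2)%:E)%E
      @[n --> \oo] --> 0%E.
  move=> /fg[g gm g0]; exists (g \o sigma); first by move=> n; exact: gm.
  exact: cvg_comp sy g0.
(* Each regime only has to supply a scaling, the limits of its coefficients, and the identification
   of the symbol. *)
have key S kap klim : (forall n, 0 < S n) -> (exists C, forall n, S n <= C) ->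
    (forall n s, (l <= s <= m)%N ->
      S n * (eps \o sigma) n ^+ (s - l) = kap s n * (omega \o sigma) n ^+ s) ->
    (forall s, kap s @ \oo --> klim s) ->
    (forall z, symbol l Ainf c z = limit_symbol l Ainf klim z) ->
    mx_density (symbol l Ainf c) mu^T B = 0.
  move=> S0 [C SC] SE kc /funext ->.
  exact: (limit_symbol_vanishing oO (fun n => uL2 (sigma n)) uw' (fun n => e0 (sigma n))
    (fun n => w0 (sigma n)) w_cvg' cA' uA' fg' (fun n => uf (sigma n)) sc S0 SC SE kc rB).
pose rho n := (eps \o sigma) n / (omega \o sigma) n.
have rho0 n : 0 < rho n by rewrite /rho /= divr_gt0.
have wE n s : (l <= s)%N -> (omega \o sigma) n ^+ s = (omega \o sigma) n ^+ l * (omega \o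
  sigma) n ^+ (s - l).
  by move=> ls; rewrite -exprD subnKC.
have epsE n : (eps \o sigma) n = rho n * (omega \o sigma) n by rewrite /rho divfK// gt_eqF// w0.
have c0 : (0%E <= c)%E.
  by apply: (cvge_to_ge rho'); apply: nearW => n; rewrite lee_fin; exact: ltW (rho0 n).
case: c rho' key {rho_cvg} c0 => [e| |] rho' key c0; last by rewrite leeNy_eq in c0.
- have [_ rho_e] := (fine_cvgP _ _).1 rho'.
  have {rho_e} rho_e : rho @ \oo --> e by exact: rho_e.
  (* Scaling by omega^l alone gives coefficients tending to e^(s - l), whereas the symbol for e > 0
     carries e^s; the factor e^l makes up the difference. For e = 0 it could make the scaling
     vanish, and 0^(s - l) already selects s = l. *)
  pose K0 := if e == 0 then 1 else e ^+ l.
  have K00 : 0 < K0 by rewrite /K0; case: eqVneq => // en;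
    rewrite exprn_gt0// lt_neqAle eq_sym en.
  apply: (key (fun n => K0 * (omega \o sigma) n ^+ l) (fun s n => K0 * rho n ^+ (s - l))
    (fun s => K0 * e ^+ (s - l))).
  + by move=> n; rewrite mulr_gt0// exprn_gt0// w0.
  + by apply: cvg_ub; apply: cvgM; [exact: cvg_cst|exact: cvg_exprn w_cvg'].
  + move=> n s /andP[ls _]; rewrite epsE exprMn (wE n s ls).
    by move: (rho n) ((omega \o sigma) n) => t1 t2; ring.
  + by move=> s; apply: cvgM; [exact: cvg_cst|exact: cvg_exprn rho_e].
  + move=> z; rewrite /limit_symbol /symbol /K0; case: (eqVneq e 0) => [->|en].
      rewrite big_mkcond [RHS]big_mkcond /=; apply: eq_bigr => alpha _;
        rewrite mul1r expr0n subn_eq0.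
      have [al|] := eqVneq (mlen alpha) l; first by rewrite al leqnn lm /= mul1r.
      rewrite neq_ltn => /orP[al|al]; first by rewrite leqNgt al.
      by case: ifP => // _; rewrite leqNgt al /= mul0r scale0r.
    apply: eq_bigr => alpha /andP[la _].
    rewrite -exprD (subnKC la) exprMn (rmorphXn (real_complex R)); congr (_ *: _).
    by rewrite -mulrA mulrCA.
- have {}rho' : rho @ \oo --> +oo by apply/cvgeryP.
  have ri : (fun n => (rho n)^-1) @ \oo --> (0 : R).
    by apply/gtr0_cvgV0 => //; exact: nearW.
  (* The extra factor rho^(l - m) normalizes the top order: the coefficient of order s becomes
     rho^(s - m), whose limit 0^(m - s) selects s = m among the admissible orders. *)
  apply: (key (fun n => (omega \o sigma) n ^+ l * (rho n)^-1 ^+ (m - l))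
    (fun s n => (rho n)^-1 ^+ (m - s)) (fun s => 0 ^+ (m - s))).
  + by move=> n; rewrite mulr_gt0// exprn_gt0// ?invr_gt0// w0.
  + by apply: cvg_ub; apply: cvgM; [exact: cvg_exprn w_cvg'|exact: cvg_exprn ri].
  + move=> n s /andP[ls sm]; rewrite epsE exprMn (wE n s ls).
    have -> : (m - l = (m - s) + (s - l))%N by rewrite addnBA// subnK.
    rewrite exprD; have : (rho n)^-1 ^+ (s - l) * rho n ^+ (s - l) = 1.
      by rewrite -exprMn mulVf ?expr1n// gt_eqF.
    move=> h; rewrite -[RHS]mulr1 -h.
    by move: (rho n)^-1 (rho n) ((omega \o sigma) n) => t1 t2 t3; ring.
  + by move=> s; exact: cvg_exprn ri.
  + move=> z; rewrite /limit_symbol /symbol.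
    rewrite big_mkcond [RHS]big_mkcond /=; apply: eq_bigr => alpha _; rewrite expr0n subn_eq0.
    have [al|] := eqVneq (mlen alpha) m; first by rewrite al leqnn lm /= mul1r.
    rewrite neq_ltn => /orP[al|al]; last by rewrite (leqNgt (mlen alpha) m) al andbF.
    by case: ifP => // _; rewrite leqNgt al /= mul0r scale0r.
Qed.
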